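(* Let $\mathrm{Top}$ be the category of topological spaces. There is a model category structure on $\mathrm{Top}$ in which a map $f\colon X\to Y$ is (i) a weak equivalence if and only if it is a weak homotopy equivalence; (ii) a cofibration if and only if it is a relative cell complex or a retract of a relative cell complex; (iii) a fibration if and only if it is a Serre fibration.
   Context: $\mathrm{Top}$ denotes any one of the following complete and cocomplete categories: all topological spaces; compactly generated spaces; compactly generated weak Hausdorff spaces; compactly generated Hausdorff spaces. ''Space'' and ''map'' mean object and morphism of $\mathrm{Top}$. Retract: a map $i\colon A\to B$ is a retract of $j\colon C\to D$ if there are maps $A\to C\to A$ and $B\to D\to B$, each composing to the identity, such that both resulting squares (from $i$ to $j$ and from $j$ to $i$) commute. Model category: a category $\mathcal{M}$ with three classes of maps (weak equivalences, cofibrations, fibrations) such that: M1: $\mathcal{M}$ has all small limits and colimits. M2: if $gf$ is defined and two of $f,g,gf$ are weak equivalences, so is the third. M3: if $f$ is a retract of $g$ and $g$ is a weak equivalence, a fibration, or a cofibration, then so is $f$. M4: for every commutative square with top $A\to X$, bottom $B\to Y$, left $i\colon A\to B$, right $p\colon X\to Y$, there is a map $B\to X$ making both triangles commute if either (1) $i$ is a cofibration and $p$ is both a fibration and a weak equivalence, or (2) $i$ is both a cofibration and a weak equivalence and $p$ is a fibration. M5: every map $g$ has two functorial factorizations: (1) $g=pi$ with $i$ a cofibration and $p$ both a fibration and a weak equivalence; (2) $g=qj$ with $j$ both a cofibration and a weak equivalence and $q$ a fibration. (A factorization $X\to W_f\to Y$ of every map $f\colon X\to Y$ is functorial if every commutative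 square from $f$ to $f'$ induces a map $W_f\to W_{f'}$ compatible with the factorizations, respecting identities and composition.) Weak homotopy equivalence: $f\colon X\to Y$ such that either $X$ and $Y$ are both empty, or both are nonempty and for every $x\in X$ the induced map $f_*\colon \pi_i(X,x)\to\pi_i(Y,f(x))$ is an isomorphism of groups for $i>0$ and a bijection of sets for $i=0$. Relative cell complex: $Y$ is obtained from a subspace $X$ by attaching a cell if, for some $n\ge 0$, there is a pushout square with left map the inclusion $S^{n-1}\to D^n$ and right map the inclusion $X\to Y$ (here $S^{-1}=\emptyset$). A relative cell complex is an inclusion of a subspace $X\to Y$ such that $Y$ can be constructed from $X$ by a possibly infinite (transfinite) process of repeatedly attaching cells; i.e. it is a transfinite composition of pushouts of the inclusions $S^{n-1}\to D^n$, $n\ge0$. Serre fibration: a map with the right lifting property with respect to the inclusions $D^n\times\{0\}\to D^n\times[0,1]$ for all $n\ge0$, i.e. every commutative square from such an inclusion to the map admits a diagonal filler making both triangles commute. *)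

(* Defs.v *)
From HB Require Import structures.
From mathcomp Require Import all_boot all_order all_algebra generic_quotient.
From mathcomp Require Import all_classical all_reals topology normedtype.
From mathcomp Require Import ring lra.
From mathcomp Require wochoice.
Import Order.TTheory GRing.Theory Num.Theory.
Import numFieldNormedType.Exports.

Set Implicit Arguments.
Unset Strict Implicit.
Unset Printing Implicit Defensive.

Local Open Scope classical_set_scope.
Local Open Scope ring_scope.
Local Open Scope quotient_scope.

Declare Scope cat_scope.
Delimit Scope cat_scope with cat.
Local Open Scope cat_scope.

Reserved Notation "g ∘ f" (at level 40, left associativity).

Record category := Category {
  ob :> Type;
  mor : ob -> ob -> Type;
  idm : forall X, mor X X;
  mcomp : forall X Y Z, mor Y Z -> mor X Y -> mor X Z;
  mcomp_idl : forall X Y (f : mor X Y), mcomp (idm Y) f = f;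
  mcomp_idr : forall X Y (f : mor X Y), mcomp f (idm X) = f;
  mcomp_assoc : forall X Y Z W (h : mor Z W) (g : mor Y Z) (f : mor X Y),
    mcomp h (mcomp g f) = mcomp (mcomp h g) f }.

Arguments mor {c} X Y.
Arguments idm {c} X.
Arguments mcomp {c X Y Z} g f.
Notation "g ∘ f" := (mcomp g f) : cat_scope.

(* [Topological.axioms_.u0] is the universe of the carriers of the topological
   spaces of the library: "small" means small relative to the category of all
   topological spaces. A plain [category] would be too big an indexing shape,
   since it may be the category of spaces itself. *)
Record small_category := SmallCategory {
  sob : Type@{Topological.axioms_.u0};
  shom : sob -> sob -> Type@{Topological.axioms_.u0};
  sidm : forall X, shom X X;
  scomp : forall X Y Z, shom Y Z -> shom X Y -> shom X Z;
  scomp_idl : forall X Y (f : shom X Y), scomp (sidm Y) f = f;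
  scomp_idr : forall X Y (f : shom X Y), scomp f (sidm X) = f;
  scomp_assoc : forall X Y Z W (h : shom Z W) (g : shom Y Z) (f : shom X Y),
    scomp h (scomp g f) = scomp (scomp h g) f }.

Definition category_of_small (J : small_category) : category :=
  Category (@scomp_idl J) (@scomp_idr J) (@scomp_assoc J).
Coercion category_of_small : small_category >-> category.

Record functor (J C : category) := Functor {
  fob :> J -> C;
  fmap : forall i j : J, mor i j -> mor (fob i) (fob j);
  fmap_id : forall i : J, fmap (idm i) = idm (fob i);
  fmap_comp : forall (i j k : J) (v : mor j k) (u : mor i j),
    fmap (v ∘ u) = fmap v ∘ fmap u }.

Section FullSubcategory.
Variables (C : category) (P : C -> Prop).

Lemma full_sub_idl (X Y : sig P) (f : mor (sval X) (sval Y)) :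
  idm (sval Y) ∘ f = f.
Proof. exact: mcomp_idl. Qed.

Lemma full_sub_idr (X Y : sig P) (f : mor (sval X) (sval Y)) :
  f ∘ idm (sval X) = f.
Proof. exact: mcomp_idr. Qed.

Lemma full_sub_assoc (X Y Z W : sig P) (h : mor (sval Z) (sval W))
    (g : mor (sval Y) (sval Z)) (f : mor (sval X) (sval Y)) :
  h ∘ (g ∘ f) = h ∘ g ∘ f.
Proof. exact: mcomp_assoc. Qed.

Definition full_sub : category :=
  @Category (sig P) (fun X Y => mor (sval X) (sval Y)) (fun X => idm (sval X))
    (fun X Y Z g f => g ∘ f) full_sub_idl full_sub_idr full_sub_assoc.

Definition restrict (D : category) (F : functor C D) : functor full_sub D :=
  @Functor full_sub D (fun X => F (sval X)) (fun X Y u => fmap F u)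
    (fun X => fmap_id F (sval X)) (fun X Y Z v u => fmap_comp F v u).

End FullSubcategory.

Section Limits.
Variables (J C : category) (F : functor J C).

Record cone := Cone {
  cone_ob : C;
  cone_leg : forall j, mor cone_ob (F j);
  cone_natural : forall i j (u : mor i j), fmap F u ∘ cone_leg i = cone_leg j }.

Definition is_limit (L : cone) : Prop :=
  forall K : cone, exists! h : mor (cone_ob K) (cone_ob L),
    forall j, cone_leg L j ∘ h = cone_leg K j.

Record cocone := Cocone {
  cocone_ob : C;
  cocone_leg : forall j, mor (F j) cocone_ob;
  cocone_natural : forall i j (u : mor i j),
    cocone_leg j ∘ fmap F u = cocone_leg i }.

Definition is_colimit (L : cocone) : Prop :=
  forall K : cocone, exists! h : mor (cocone_ob L) (cocone_ob K),
    forall j, h ∘ cocone_leg L j = cocone_leg K j.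

End Limits.

Definition has_small_limits (C : category) : Prop :=
  forall (J : small_category) (F : functor J C), exists L, @is_limit J C F L.

Definition has_small_colimits (C : category) : Prop :=
  forall (J : small_category) (F : functor J C), exists L, @is_colimit J C F L.

(* The square with left side [i], top [u], bottom [v] and right side [f]. *)
Definition is_pushout (C : category) (A B X Y : C) (i : mor A B) (u : mor A X)
    (v : mor B Y) (f : mor X Y) : Prop :=
  v ∘ i = f ∘ u /\
  forall (Z : C) (b : mor B Z) (x : mor X Z), b ∘ i = x ∘ u ->
    exists! h : mor Y Z, h ∘ v = b /\ h ∘ f = x.

Definition map_class (C : category) := forall X Y : C, mor X Y -> Prop.

Section ModelCategory.
Variable C : category.

Definition retract_of (A B D E : C) (i : mor A B) (j : mor D E) : Prop :=
  exists (s : mor A D) (r : mor D A) (t : mor B E) (q : mor E B),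
    [/\ r ∘ s = idm A, q ∘ t = idm B, t ∘ i = j ∘ s & q ∘ j = i ∘ r].

Definition has_lifting (A B X Y : C) (i : mor A B) (p : mor X Y) : Prop :=
  forall (u : mor A X) (v : mor B Y), p ∘ u = v ∘ i ->
    exists h : mor B X, h ∘ i = u /\ p ∘ h = v.

Record functorial_factorization := FunctorialFactorization {
  mid : forall X Y : C, mor X Y -> C;
  left_part : forall (X Y : C) (f : mor X Y), mor X (mid f);
  right_part : forall (X Y : C) (f : mor X Y), mor (mid f) Y;
  factorE : forall (X Y : C) (f : mor X Y), right_part f ∘ left_part f = f;
  mid_map : forall (X Y X' Y' : C) (f : mor X Y) (f' : mor X' Y')
    (a : mor X X') (b : mor Y Y'), b ∘ f = f' ∘ a -> mor (mid f) (mid f');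
  mid_map_left : forall (X Y X' Y' : C) (f : mor X Y) (f' : mor X' Y')
    (a : mor X X') (b : mor Y Y') (e : b ∘ f = f' ∘ a),
    mid_map e ∘ left_part f = left_part f' ∘ a;
  mid_map_right : forall (X Y X' Y' : C) (f : mor X Y) (f' : mor X' Y')
    (a : mor X X') (b : mor Y Y') (e : b ∘ f = f' ∘ a),
    right_part f' ∘ mid_map e = b ∘ right_part f;
  mid_map_id : forall (X Y : C) (f : mor X Y) (e : idm Y ∘ f = f ∘ idm X),
    mid_map e = idm (mid f);
  mid_map_comp : forall (X Y X' Y' X'' Y'' : C)
    (f : mor X Y) (f' : mor X' Y') (f'' : mor X'' Y'')
    (a : mor X X') (b : mor Y Y') (a' : mor X' X'') (b' : mor Y' Y'')
    (e : b ∘ f = f' ∘ a) (e' : b' ∘ f' = f'' ∘ a')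
    (e'' : (b' ∘ b) ∘ f = f'' ∘ (a' ∘ a)),
    mid_map e'' = mid_map e' ∘ mid_map e }.

Definition retract_closed (S : map_class C) : Prop :=
  forall (A B D E : C) (f : mor A B) (g : mor D E),
    retract_of f g -> S _ _ g -> S _ _ f.

Record model_structure := ModelStructure {
  weq : map_class C;
  cof : map_class C;
  fib : map_class C;
  model_limits : has_small_limits C;
  model_colimits : has_small_colimits C;
  model_two_of_three : forall (X Y Z : C) (f : mor X Y) (g : mor Y Z),
    [/\ weq f -> weq g -> weq (g ∘ f),
        weq f -> weq (g ∘ f) -> weq g &
        weq g -> weq (g ∘ f) -> weq f];
  model_retract_weq : retract_closed weq;
  model_retract_fib : retract_closed fib;
  model_retract_cof : retract_closed cof;
  model_lift_trivial_fib : forall (A B X Y : C) (i : mor A B) (p : mor X Y),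
    cof i -> fib p -> weq p -> has_lifting i p;
  model_lift_trivial_cof : forall (A B X Y : C) (i : mor A B) (p : mor X Y),
    cof i -> weq i -> fib p -> has_lifting i p;
  model_factor_trivial_fib : exists F : functorial_factorization,
    forall (X Y : C) (g : mor X Y),
      [/\ cof (left_part F g), fib (right_part F g) & weq (right_part F g)];
  model_factor_trivial_cof : exists F : functorial_factorization,
    forall (X Y : C) (g : mor X Y),
      [/\ cof (left_part F g), weq (left_part F g) & fib (right_part F g)] }.

End ModelCategory.

Arguments weq {C} m {X Y}.
Arguments cof {C} m {X Y}.
Arguments fib {C} m {X Y}.

Section PosetCategory.
Context {d : Order.disp_t} (I : porderType d).

Definition poset_category : category :=
  @Category I (fun i j => (i <= j)%O : Type) (fun i => lexx i)
    (fun i j k jk ij => le_trans ij jk)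
    (fun i j u => bool_irrelevance _ _) (fun i j u => bool_irrelevance _ _)
    (fun i j k l w v u => bool_irrelevance _ _).

Definition covers (i j : I) : Prop :=
  (i < j)%O /\ forall k, ~ (i < k < j)%O.

Definition limit_element (i : I) : Prop :=
  (exists j, (j < i)%O) /\ forall j, ~ covers j i.

Definition below (i : I) : poset_category -> Prop := fun j => (j < i)%O.

End PosetCategory.

Section TransfiniteComposition.
Variable C : category.

Section InitialSegment.
Context {d : Order.disp_t} (I : porderType d).
Variables (F : functor (poset_category I) C) (i : I).

Lemma initial_segment_natural (j k : full_sub (@below d I i)) (u : mor j k) :
  fmap F (ltW (svalP k)) ∘ fmap (restrict (@below d I i) F) u =
  fmap F (ltW (svalP j)).
Proof.
pose ki : mor (sval k : poset_category I) i := ltW (svalP k).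
apply: etrans (esym (fmap_comp F ki (u : mor (sval j) (sval k)))) _.
by congr fmap; exact: bool_irrelevance.
Qed.

Definition initial_segment_cocone : cocone (restrict (@below d I i) F) :=
  Cocone initial_segment_natural.

End InitialSegment.

(* The ordinal length is a nonempty well-ordered type [I] with least element
   [bot]; the composite is the leg of the colimit of [F] at [bot]. As [L] may
   be any colimit of [F], isomorphisms are the composites of length one. *)
Variant transfinite_composite (S : map_class C) : map_class C :=
  TransfiniteComposite (d : Order.disp_t) (I : orderType d)
      (F : functor (poset_category I) C) (L : cocone F) (bot : I) of
    wochoice.well_order (<=%O : rel I) &
    (forall i, bot <= i)%O &
    (forall i j (ij : covers i j), S _ _ (fmap F (ltW ij.1))) &
    (forall i, limit_element i -> is_colimit (initial_segment_cocone F i)) &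
    is_colimit L :
    transfinite_composite S (cocone_leg L bot).

End TransfiniteComposition.

Section Spaces.

Lemma spaces_idl (X Y : topologicalType) (f : continuousType X Y) :
  (idfun \o f : continuousType X Y) = f.
Proof. exact/continuousEP. Qed.

Lemma spaces_idr (X Y : topologicalType) (f : continuousType X Y) :
  (f \o idfun : continuousType X Y) = f.
Proof. exact/continuousEP. Qed.

Lemma spaces_assoc (X Y Z W : topologicalType) (h : continuousType Z W)
    (g : continuousType Y Z) (f : continuousType X Y) :
  (h \o (g \o f) : continuousType X W) = ((h \o g) \o f : continuousType X W).
Proof. exact/continuousEP. Qed.

Definition spaces : category :=
  @Category topologicalType (fun X Y => continuousType X Y)
    (fun X => idfun : continuousType X X)
    (fun X Y Z g f => g \o f : continuousType X Z)
    spaces_idl spaces_idr spaces_assoc.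

End Spaces.

(* For spaces that need not be Hausdorff, the test spaces are mapped into [X];
   they are not subspaces of [X]. *)
Definition compactly_generated (X : topologicalType) : Prop :=
  forall A : set X,
    (forall (K : topologicalType) (u : K -> X), compact [set: K] ->
       hausdorff_space K -> continuous u -> closed (u @^-1` A)) ->
    closed A.

Definition weak_hausdorff (X : topologicalType) : Prop :=
  forall (K : topologicalType) (u : K -> X), compact [set: K] ->
    hausdorff_space K -> continuous u -> closed (range u).

Variant space_kind := AllSpaces | CG | CGWeakHausdorff | CGHausdorff.

Definition is_space (k : space_kind) (X : topologicalType) : Prop :=
  match k with
  | AllSpaces => True
  | CG => compactly_generated X
  | CGWeakHausdorff => compactly_generated X /\ weak_hausdorff X
  | CGHausdorff => compactly_generated X /\ hausdorff_space X
  end.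

Definition Top (k : space_kind) : category :=
  @full_sub spaces (is_space k).

Lemma compact_hausdorff_is_space (k : space_kind) (X : topologicalType) :
  compact [set: X] -> hausdorff_space X -> is_space k X.
Proof.
move=> cX hX; have cgX : compactly_generated X.
  by move=> A /(_ X id cX hX); rewrite preimage_id; apply=> x; exact: cvg_id.
case: k => //=; split=> // K u cK hK cu.
apply: compact_closed => //; apply: continuous_compact => //.
exact: continuous_subspaceT.
Qed.

Lemma glue_continuous (R : realType) (T X : topologicalType) (c : R)
    (h : T -> R) (f g : T -> X) :
  continuous h -> continuous f -> continuous g ->
  (forall t, h t = c -> f t = g t) ->
  continuous (fun t => if h t <= c then f t else g t).
Proof.
move=> ch cf cg fg t U /=; have [htc|htc|htc] := ltgtP (h t) c; move=> nU.
- have hs : \forall s \near t, h s < c by exact: (ch t _ (lt_nbhsl htc)).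
  have fU : \forall s \near t, U (f s) by exact: cf.
  change (\forall s \near t, U (if h s <= c then f s else g s)).
  by move: hs fU; apply: filterS2 => s /ltW ->.
- have hs : \forall s \near t, c < h s.
    exact: (ch t [set y | c < y] (lt_nbhsr htc)).
  have gU : \forall s \near t, U (g s) by exact: cg.
  change (\forall s \near t, U (if h s <= c then f s else g s)).
  by move: hs gU; apply: filterS2 => s hs; rewrite leNgt hs.
- have fU : \forall s \near t, U (f s) by exact: cf.
  have gU : \forall s \near t, U (g s) by apply: cg; rewrite -fg.
  change (\forall s \near t, U (if h s <= c then f s else g s)).
  by move: fU gU; apply: filterS2 => s fU gU; case: ifP.
Qed.

Lemma continuous_set_val_inj (T X : topologicalType) (A : set X) (f : T -> A) :
  continuous (fun t => \val (f t) : X) -> continuous f.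
Proof. by move=> cf; exact/continuous_comp_initial. Qed.

Lemma set_val_continuous (X : topologicalType) (A : set X) :
  continuous (fun t : A => \val t : X).
Proof. exact: initial_continuous. Qed.

Lemma pair_continuous (T X Y : topologicalType) (f : T -> X) (g : T -> Y) :
  continuous f -> continuous g -> continuous (fun t => (f t, g t)).
Proof. by move=> cf cg t; apply: (cvg_pair (cf t) (cg t)). Qed.

Lemma set_type_hausdorff (X : topologicalType) (A : set X) :
  hausdorff_space X -> hausdorff_space A.
Proof.
move=> hX p q pq; apply: val_inj; apply: hX => U V nU nV.
have [||t [Ut Vt]] := pq (\val @^-1` U) (\val @^-1` V).
- exact: set_val_continuous.
- exact: set_val_continuous.
- by exists (\val t).
Qed.

Lemma set_type_compact (X : topologicalType) (A : set X) :
  compact A -> compact [set: A].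
Proof.
move=> cA F FF _; have [|p [Ap clp]] := cA ((\val : A -> X) @ F) _.
  rewrite /= /fmap /=; apply: filterS (@filterT _ F _) => t _.
  exact: set_valP.
exists (exist _ p (mem_set Ap)); split=> // U V FU [W [[W' oW' <-] /= Wp WV]].
have nW : nbhs p W' by apply: open_nbhs_nbhs; split.
have [|_ [[t Ut <-] W't]] := clp (\val @` U) W' _ nW.
- change (F (\val @^-1` (\val @` U))); apply: filterS FU => t Ut; by exists t.

- by exists t; split=> //; exact: WV.
Qed.

Lemma prod_hausdorff (X Y : topologicalType) :
  hausdorff_space X -> hausdorff_space Y -> hausdorff_space (X * Y)%type.
Proof.
move=> hX hY [x y] [x' y'] cl; congr pair.
- apply: hX => U V nU nV.
  have [||[u v] [/= Uu Vu]] := cl (fst @^-1` U) (fst @^-1` V).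
  + by apply: cvg_fst.
  + by apply: cvg_fst.
  + by exists u.
- apply: hY => U V nU nV.
  have [||[u v] [/= Uu Vu]] := cl (snd @^-1` U) (snd @^-1` V).
  + by apply: cvg_snd.
  + by apply: cvg_snd.
  + by exists v.
Qed.

Section Disks.
Variable R : realType.

Definition unit_interval : topologicalType := set_type `[0 : R, 1]%classic.

(* Closed unit ball and unit sphere of the Euclidean norm of R^n; the norm of
   ['rV[R]_n] in the library is the sup norm. The sphere S^(n-1) lies in
   R^n, and S^(-1) is empty. *)
Definition sq_norm n (x : 'rV[R]_n) : R := \sum_i x ord0 i ^+ 2.

Definition disk_set n : set 'rV[R]_n := [set x | sq_norm x <= 1].
Definition sphere_set n : set 'rV[R]_n := [set x | sq_norm x = 1].

Arguments disk_set n : clear implicits.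
Arguments sphere_set n : clear implicits.

Definition disk n : topologicalType := set_type (disk_set n).
Definition sphere n : topologicalType := set_type (sphere_set n).

Lemma unit_interval_compact : compact [set: unit_interval].
Proof. exact/set_type_compact/segment_compact. Qed.

Lemma unit_interval_hausdorff : hausdorff_space unit_interval.
Proof. exact/set_type_hausdorff/Rhausdorff. Qed.

Lemma sq_norm_continuous n : continuous (@sq_norm n).
Proof.
move=> x; rewrite /sq_norm; apply: (@cvg_big R _ +%R 0) => [||i _].
- exact: add_continuous.
- exact: (@nbhs_filter _ x).
by apply: continuousM; exact: coord_continuous.
Qed.

Lemma disk_set_bounded n : bounded_set (disk_set n).
Proof.
exists 1; split => // M /ltW M1 x /= x1; rewrite /Num.norm /= mx_normrE.
apply/bigmax_leP; split => /=; first exact: le_trans M1.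
move=> [i j] _ /=; rewrite (ord1 i); apply: le_trans M1.
rewrite -(@expr_le1 _ 2) // real_normK ?num_real //; apply: le_trans x1.
rewrite /sq_norm (bigD1 j) //= lerDl; apply: sumr_ge0 => k _; exact: sqr_ge0.
Qed.

Lemma disk_set_closed n : closed (disk_set n).
Proof.
rewrite (_ : disk_set n = @sq_norm n @^-1` [set y | y <= 1]) //.
apply: preimage_closed; last exact: (@closed_le R 1).
by move=> x _; exact: sq_norm_continuous.
Qed.

Lemma sphere_set_closed n : closed (sphere_set n).
Proof.
rewrite (_ : sphere_set n = @sq_norm n @^-1` [set y | y = 1]) //.
apply: preimage_closed; last exact: (@closed_eq R 1).
by move=> x _; exact: sq_norm_continuous.
Qed.

Lemma sphere_sub_disk n : sphere_set n `<=` disk_set n.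
Proof. by move=> x x1; rewrite /disk_set /= x1. Qed.

Lemma disk_compact n : compact [set: disk n].
Proof.
apply: set_type_compact; apply: bounded_closed_compact.
- exact: disk_set_bounded.
- exact: disk_set_closed.
Qed.

Lemma sphere_compact n : compact [set: sphere n].
Proof.
apply: set_type_compact; apply: (@subclosed_compact _ _ (disk_set n)).
- exact: sphere_set_closed.
- apply: bounded_closed_compact; last exact: disk_set_closed.
  exact: disk_set_bounded.
- exact: sphere_sub_disk.
Qed.

Lemma disk_hausdorff n : hausdorff_space (disk n).
Proof. exact/set_type_hausdorff/norm_hausdorff. Qed.

Lemma sphere_hausdorff n : hausdorff_space (sphere n).
Proof. exact/set_type_hausdorff/norm_hausdorff. Qed.

Definition sphere_incl n (x : sphere n) : disk n :=
  exist _ (\val x) (mem_set (sphere_sub_disk (set_valP x))).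

Lemma sphere_incl_continuous n : continuous (@sphere_incl n).
Proof. by apply: continuous_set_val_inj; exact: set_val_continuous. Qed.

Definition cylinder n : topologicalType := (disk n * unit_interval)%type.

Definition cylinder_bottom_set n : set (cylinder n) :=
  [set p | \val p.2 = 0].

Arguments cylinder_bottom_set n : clear implicits.

Definition cylinder_bottom n : topologicalType :=
  set_type (cylinder_bottom_set n).

Lemma cylinder_compact n : compact [set: cylinder n].
Proof.
rewrite -setXTT; apply: compact_setX; first exact: disk_compact.
exact: unit_interval_compact.
Qed.

Lemma cylinder_hausdorff n : hausdorff_space (cylinder n).
Proof.
exact: prod_hausdorff (@disk_hausdorff n) unit_interval_hausdorff.
Qed.

Lemma cylinder_bottom_compact n : compact [set: cylinder_bottom n].
Proof.
apply: set_type_compact; apply: (@subclosed_compact _ _ setT) => //.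
- rewrite (_ : cylinder_bottom_set n =
    (fun p : cylinder n => \val p.2 : R) @^-1` [set y | y = 0]) //.
  apply: preimage_closed; last exact: (@closed_eq R 0).
  move=> p _; apply: (@continuous_comp (cylinder n) unit_interval R).
    exact: cvg_snd.
  exact: set_val_continuous.
- exact: cylinder_compact.
Qed.

Lemma cylinder_bottom_hausdorff n : hausdorff_space (cylinder_bottom n).
Proof. exact/set_type_hausdorff/cylinder_hausdorff. Qed.

Definition cylinder_bottom_incl n (x : cylinder_bottom n) : cylinder n :=
  \val x.

Lemma cylinder_bottom_incl_continuous n : continuous (@cylinder_bottom_incl n).
Proof. exact: set_val_continuous. Qed.

Section InTop.
Variable k : space_kind.

Definition top_disk n : Top k :=
  exist _ (disk n)
    (compact_hausdorff_is_space k (@disk_compact n) (@disk_hausdorff n)).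

Definition top_sphere n : Top k :=
  exist _ (sphere n)
    (compact_hausdorff_is_space k (@sphere_compact n) (@sphere_hausdorff n)).

Definition top_cylinder n : Top k :=
  exist _ (cylinder n)
    (compact_hausdorff_is_space k (@cylinder_compact n)
       (@cylinder_hausdorff n)).

Definition top_cylinder_bottom n : Top k :=
  exist _ (cylinder_bottom n)
    (compact_hausdorff_is_space k (@cylinder_bottom_compact n)
       (@cylinder_bottom_hausdorff n)).

Definition top_sphere_incl n : mor (top_sphere n) (top_disk n) :=
  mkcts (@sphere_incl_continuous n).

Definition top_cylinder_bottom_incl n :
    mor (top_cylinder_bottom n) (top_cylinder n) :=
  mkcts (@cylinder_bottom_incl_continuous n).

Definition attaches_cell : map_class (Top k) := fun X Y f =>
  exists n (phi : mor (top_sphere n) X) (chi : mor (top_disk n) Y),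
    is_pushout (top_sphere_incl n) phi chi f.

Definition relative_cell_complex : map_class (Top k) :=
  transfinite_composite attaches_cell.

Definition serre_fibration : map_class (Top k) := fun X Y p =>
  forall n, has_lifting (top_cylinder_bottom_incl n) p.

End InTop.
End Disks.

Section HomotopyGroups.
Variable R : realType.

Local Notation I := (unit_interval R).

Definition cube_set n : set 'rV[R]_n :=
  [set t | forall i, 0 <= t ord0 i <= 1].
Arguments cube_set n : clear implicits.

Definition cube n : topologicalType := set_type (cube_set n).

Definition cube_boundary n : set (cube n) :=
  [set t | exists i, (\val t : 'rV[R]_n) ord0 i = 0 \/
                     (\val t : 'rV[R]_n) ord0 i = 1].

Record nloop n (X : topologicalType) (x : X) := NLoop {
  nloop_fun :> continuousType (cube n) X;
  nloop_boundary : forall t, cube_boundary t -> nloop_fun t = x }.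

HB.instance Definition _ n (X : topologicalType) (x : X) :=
  gen_eqMixin (nloop n x).
HB.instance Definition _ n (X : topologicalType) (x : X) :=
  gen_choiceMixin (nloop n x).

Definition homotopic n (X : topologicalType) (x : X) (a b : nloop n x) : Prop :=
  exists H : cube n * I -> X,
    [/\ continuous H,
        forall t (s : I), \val s = 0 -> H (t, s) = a t,
        forall t (s : I), \val s = 1 -> H (t, s) = b t &
        forall t s, cube_boundary t -> H (t, s) = x].

(* [clamp] makes piecewise definitions total; on the branch selected in
   [nloop_concat_fun] it acts as the identity. *)
Definition clamp_val (s : R) : R := Num.max 0 (Num.min 1 s).

Lemma clamp_val_itv s : 0 <= clamp_val s <= 1.
Proof. by rewrite /clamp_val le_max lexx /= ge_max ler01 ge_min lexx. Qed.

Lemma clamp_valE s : 0 <= s <= 1 -> clamp_val s = s.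
Proof. by move=> /andP[s0 s1]; rewrite /clamp_val min_r // max_r. Qed.

Lemma clamp_val_continuous : continuous clamp_val.
Proof.
move=> s.
apply: (@continuous_max R R (cst 0) (cst 1 \min id)); first exact: cvg_cst.
by apply: (@continuous_min R R (cst 1) id); [exact: cvg_cst | exact: cvg_id].
Qed.

Definition clamp (s : R) : I := exist _ (clamp_val s)
  (mem_set (clamp_val_itv s : [set` `[0 : R, 1]] (clamp_val s))).

Lemma clamp_continuous : continuous clamp.
Proof. by apply: continuous_set_val_inj; exact: clamp_val_continuous. Qed.

Lemma homotopic_refl n (X : topologicalType) (x : X) (a : nloop n x) :
  homotopic a a.
Proof.
exists (fun p => a p.1); split=> //; last by move=> t s; exact: nloop_boundary.
move=> p; apply: (@continuous_comp _ (cube n) X fst a); first exact: cvg_fst.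
exact: cts_fun.
Qed.

Definition repar n (g : R -> R) (p : cube n * I) : cube n * I :=
  (p.1, clamp (g (\val p.2))).

Lemma param_continuous n : continuous (fun p : cube n * I => \val p.2 : R).
Proof.
move=> p; apply: (@continuous_comp _ I R); first exact: cvg_snd.
exact: set_val_continuous.
Qed.

Lemma repar_continuous n (g : R -> R) : continuous g -> continuous (@repar n g).
Proof.
move=> cg; apply: pair_continuous => p; first exact: cvg_fst.
apply: (@continuous_comp _ R I _ clamp); last exact: clamp_continuous.
apply: (@continuous_comp _ R R (fun p : cube n * I => \val p.2 : R) g).
  exact: param_continuous.
exact: cg.
Qed.

Lemma homotopic_sym n (X : topologicalType) (x : X) (a b : nloop n x) :
  homotopic a b -> homotopic b a.
Proof.
move=> [H [cH H0 H1 Hx]]; exists (H \o repar (fun s => 1 - s)); split.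
- move=> p; apply: continuous_comp; last exact: cH.
  apply: repar_continuous => s; apply: cvgB; [exact: cvg_cst | exact: cvg_id].
- move=> t s s0 /=; apply: H1; rewrite /= s0 subr0.
  by rewrite clamp_valE // ler01 lexx.
- move=> t s s1 /=; apply: H0; rewrite /= s1 subrr.
  by rewrite clamp_valE // ler01 lexx.
- by move=> t s tx /=; exact: Hx.
Qed.

Lemma half_double (s : R) : s = 2^-1 -> 2 * s = 1.
Proof. by move=> ->; rewrite mulfV // pnatr_eq0. Qed.

Lemma double_continuous : continuous (fun s : R => 2 * s).
Proof. by move=> s; apply: cvgM; [exact: cvg_cst | exact: cvg_id]. Qed.

Lemma double1_continuous : continuous (fun s : R => 2 * s - 1).
Proof.
by move=> s; apply: cvgB; [exact: double_continuous | exact: cvg_cst].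
Qed.

Lemma homotopic_trans n (X : topologicalType) (x : X) (a b c : nloop n x) :
  homotopic a b -> homotopic b c -> homotopic a c.
Proof.
move=> [H [cH H0 H1 Hx]] [K [cK K0 K1 Kx]].
exists (fun p => if \val p.2 <= 2^-1 :> R then H (repar (fun s => 2 * s) p)
                 else K (repar (fun s => 2 * s - 1) p)); split.
- apply: glue_continuous.
  + exact: param_continuous.
  + move=> p; apply: continuous_comp; last exact: cH.
    exact/repar_continuous/double_continuous.
  + move=> p; apply: continuous_comp; last exact: cK.
    exact/repar_continuous/double1_continuous.
  + move=> [t s] /= /half_double e; rewrite H1; last first.
      by rewrite /= e clamp_valE // ler01 lexx.
    by rewrite K0 //= e subrr clamp_valE // ler01 lexx.
- move=> t s s0 /=; rewrite s0 invr_ge0 ler0n H0 //=.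
  by rewrite s0 mulr0 clamp_valE // ler01 lexx.
- move=> t s s1 /=; rewrite s1 leNgt invf_lt1 ?ltr0n // ltr1n /= K1 //=.
  rewrite s1 (_ : 2 * 1 - 1 = 1); last by rewrite mulr1 (natrD R 1 1) addrK.
  by rewrite clamp_valE // ler01 lexx.
- by move=> t s tx /=; case: ifP => _; [exact: Hx | exact: Kx].
Qed.

Section HomotopySet.
Context (n : nat) (X : topologicalType) (x : X).

Definition homotopicb : rel (nloop n x) := fun a b => `[< homotopic a b >].

Lemma homotopicb_refl : reflexive homotopicb.
Proof. by move=> a; apply/asboolP/homotopic_refl. Qed.

Lemma homotopicb_sym : symmetric homotopicb.
Proof. by move=> a b; apply/asbool_equiv_eq; split; exact: homotopic_sym. Qed.

Lemma homotopicb_trans : transitive homotopicb.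
Proof.
move=> b a c /asboolP ab /asboolP bc; apply/asboolP.
exact: homotopic_trans ab bc.
Qed.

Canonical homotopic_equiv :=
  EquivRel homotopicb homotopicb_refl homotopicb_sym homotopicb_trans.

Definition homotopy_group := {eq_quot homotopic_equiv}.

Definition homotopy_class (a : nloop n x) : homotopy_group :=
  \pi_{eq_quot homotopic_equiv} a.

Lemma homotopy_classP (a b : nloop n x) :
  homotopy_class a = homotopy_class b <-> homotopic a b.
Proof. by split=> [/eqquotP/asboolP|ab]; last exact/eqquotP/asboolP. Qed.

Lemma homotopic_repr (a : nloop n x) : homotopic (repr (homotopy_class a)) a.
Proof. by apply/homotopy_classP; exact: reprK. Qed.

End HomotopySet.

Section InducedMap.
Context (n : nat) (X Y : topologicalType) (f : continuousType X Y) (x : X).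

Lemma nloop_map_boundary (a : nloop n x) t :
  cube_boundary t -> (f \o a) t = f x.
Proof. by move=> tx /=; rewrite nloop_boundary. Qed.

Definition nloop_map (a : nloop n x) : nloop n (f x) :=
  @NLoop n Y (f x) (f \o a : continuousType _ _) (@nloop_map_boundary a).

Definition homotopy_map (p : homotopy_group n x) : homotopy_group n (f x) :=
  homotopy_class (nloop_map (repr p)).

Lemma homotopic_map (a b : nloop n x) :
  homotopic a b -> homotopic (nloop_map a) (nloop_map b).
Proof.
move=> [H [cH H0 H1 Hx]]; exists (f \o H); split.
- by move=> p; apply: continuous_comp; [exact: cH | exact: cts_fun].
- by move=> t s s0 /=; rewrite H0.
- by move=> t s s1 /=; rewrite H1.
- by move=> t s tx /=; rewrite Hx.
Qed.

Lemma homotopy_map_class (a : nloop n x) :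
  homotopy_map (homotopy_class a) = homotopy_class (nloop_map a).
Proof. exact/homotopy_classP/homotopic_map/homotopic_repr. Qed.

End InducedMap.

Section Multiplication.
Variable n : nat.

Definition set_coord0_val (s : R) (t : 'rV[R]_n.+1) : 'rV[R]_n.+1 :=
  \row_i (if i == ord0 then clamp_val s else t ord0 i).

Lemma set_coord0_cube (s : R) (t : cube n.+1) :
  cube_set n.+1 (set_coord0_val s (\val t)).
Proof.
move=> i; rewrite mxE; case: ifP => _; first exact: clamp_val_itv.
exact: (set_valP t).
Qed.

Definition set_coord0 (s : R) (t : cube n.+1) : cube n.+1 :=
  exist _ (set_coord0_val s (\val t)) (mem_set (set_coord0_cube s t)).

Definition coord0 (t : cube n.+1) : R := (\val t : 'rV[R]_n.+1) ord0 ord0.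

Lemma cube_coord_continuous i :
  continuous (fun t : cube n.+1 => (\val t : 'rV[R]_n.+1) ord0 i).
Proof.
move=> t; apply: (@continuous_comp _ 'rV[R]_n.+1 R
  (fun t : cube n.+1 => \val t) (fun M => M ord0 i)).
  exact: set_val_continuous.
exact: coord_continuous.
Qed.

Lemma coord0_continuous : continuous coord0.
Proof. exact: cube_coord_continuous. Qed.

Lemma set_coord0_continuous (T : topologicalType) (u : T -> R)
    (v : T -> cube n.+1) : continuous u -> continuous v ->
  continuous (fun t => set_coord0 (u t) (v t)).
Proof.
move=> cu cv; apply: continuous_set_val_inj => t U [P nP PU] /=.
have nQ i j : nbhs t (fun t' : T =>
    P i j (set_coord0_val (u t') (\val (v t')) i j)).
  have := nP i j; rewrite !(ord1 i) /= /set_coord0_val !mxE.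
  case: ifP => j0 nPj.
  - have cc : continuous (fun t' : T => clamp_val (u t')).
      move=> t'; apply: (@continuous_comp _ R R u clamp_val); first exact: cu.
      exact: clamp_val_continuous.
    have : nbhs t (fun t' => P ord0 j (clamp_val (u t'))) by exact: cc nPj.
    by apply: filterS => t' /=; rewrite mxE j0.
  - have cc : continuous (fun t' : T => (\val (v t') : 'rV[R]_n.+1) ord0 j).
      move=> t'; apply: (@continuous_comp _ _ R v
        (fun t : cube n.+1 => (\val t : 'rV[R]_n.+1) ord0 j)); first exact: cv.
      exact: cube_coord_continuous.
    have : nbhs t (fun t' => P ord0 j ((\val (v t') : 'rV[R]_n.+1) ord0 j)).
      exact: cc nPj.
    by apply: filterS => t' /=; rewrite mxE j0.
apply: (@filterS _ _ (nbhs_filter t) (fun t' : T => forall i j,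
     P i j (set_coord0_val (u t') (\val (v t')) i j))).
  by move=> t' Pt'; exact: PU.
apply: (@filter_forall _ _ (fun i t' => forall j,
  P i j (set_coord0_val (u t') (\val (v t')) i j)) _ (nbhs_filter t)).
move=> i; apply: (@filter_forall _ _ (fun j t' =>
  P i j (set_coord0_val (u t') (\val (v t')) i j)) _ (nbhs_filter t)).
exact: nQ.
Qed.

Definition map_coord0 (g : R -> R) (t : cube n.+1) : cube n.+1 :=
  set_coord0 (g (coord0 t)) t.

Lemma map_coord0_continuous (g : R -> R) :
  continuous g -> continuous (map_coord0 g).
Proof.
move=> cg; apply: set_coord0_continuous; last by move=> t; exact: cvg_id.
move=> t; apply: (@continuous_comp _ R R coord0 g); last exact: cg.
exact: coord0_continuous.
Qed.

Lemma coord0_itv t : 0 <= coord0 t <= 1.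
Proof. exact: (set_valP t). Qed.

Lemma coord0_set s t : coord0 (set_coord0 s t) = clamp_val s.
Proof. by rewrite /coord0 /= mxE eqxx. Qed.

Lemma set_coord0_set s r t : set_coord0 s (set_coord0 r t) = set_coord0 s t.
Proof.
by apply: val_inj; apply/rowP => i; rewrite /= !mxE; case: ifP => // ->.
Qed.

Lemma set_coord0_clamp s t : set_coord0 (clamp_val s) t = set_coord0 s t.
Proof.
apply: val_inj; apply/rowP => i; rewrite /= !mxE.
by rewrite clamp_valE ?clamp_val_itv.
Qed.

Lemma set_coord0_id t : set_coord0 (coord0 t) t = t.
Proof.
apply: val_inj; apply/rowP => i; rewrite /= !mxE.
by case: eqP => // ->; rewrite clamp_valE ?coord0_itv.
Qed.

Lemma set_coord0_boundary s t :
  s = 0 \/ s = 1 -> cube_boundary (set_coord0 s t).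
Proof.
move=> s01; exists ord0; rewrite /= mxE eqxx clamp_valE //.
by case: s01 => ->; rewrite lexx ler01.
Qed.

Lemma half_boundary t : cube_boundary t ->
  if coord0 t <= 2^-1 then cube_boundary (map_coord0 (fun s => 2 * s) t)
  else cube_boundary (map_coord0 (fun s => 2 * s - 1) t).
Proof.
move=> [i ti]; have [i0|i0] := eqVneq i ord0.
  rewrite i0 -/(coord0 t) in ti; rewrite /map_coord0; case: ti => ->.
    by rewrite invr_ge0 ler0n mulr0; apply: set_coord0_boundary; left.
  rewrite leNgt invf_lt1 ?ltr0n // ltr1n /=.
  by apply: set_coord0_boundary; right; rewrite mulr1 (natrD R 1 1) addrK.
by case: ifP => _; exists i; rewrite /= mxE (negbTE i0).
Qed.

Section Concat.
Context (X : topologicalType) (x : X) (a b : nloop n.+1 x).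

Definition nloop_concat_fun (t : cube n.+1) : X :=
  if coord0 t <= 2^-1 then a (map_coord0 (fun s => 2 * s) t)
  else b (map_coord0 (fun s => 2 * s - 1) t).

Lemma nloop_concat_continuous : continuous nloop_concat_fun.
Proof.
apply: glue_continuous.
- exact: coord0_continuous.
- move=> t; apply: (@continuous_comp _ _ X
    (map_coord0 (fun s => 2 * s)) a); last exact: cts_fun.
  exact: (@map_coord0_continuous _ double_continuous).
- move=> t; apply: (@continuous_comp _ _ X
    (map_coord0 (fun s => 2 * s - 1)) b); last exact: cts_fun.
  exact: (@map_coord0_continuous _ double1_continuous).
- move=> t /half_double e; rewrite /map_coord0 e subrr !nloop_boundary //;
    apply: set_coord0_boundary; by [left|right].
Qed.

Lemma nloop_concat_boundary t : cube_boundary t -> nloop_concat_fun t = x.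
Proof.
by move=> /half_boundary; rewrite /nloop_concat_fun; case: ifP => _ tx;
  exact: nloop_boundary.
Qed.

Definition nloop_concat : nloop n.+1 x :=
  @NLoop n.+1 X x (mkcts nloop_concat_continuous : continuousType _ _)
    nloop_concat_boundary.

End Concat.

Context {X : topologicalType} {x : X}.

Definition homotopy_mul (p q : homotopy_group n.+1 x) : homotopy_group n.+1 x :=
  homotopy_class (nloop_concat (repr p) (repr q)).

Lemma homotopic_concat (a a' b b' : nloop n.+1 x) :
  homotopic a a' -> homotopic b b' ->
  homotopic (nloop_concat a b) (nloop_concat a' b').
Proof.
move=> [H [cH H0 H1 Hx]] [K [cK K0 K1 Kx]].
have cfst : continuous (fst : cube n.+1 * I -> cube n.+1).
  by move=> p; exact: cvg_fst.
have cpair (g : R -> R) : continuous g ->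
    continuous (fun p : cube n.+1 * I => (map_coord0 g p.1, p.2)).
  move=> cg; apply: pair_continuous => p; last exact: cvg_snd.
  apply: (@continuous_comp _ _ _ fst (map_coord0 g)).
    exact: cfst.
  exact: map_coord0_continuous.
exists (fun p => if coord0 p.1 <= 2^-1
  then H (map_coord0 (fun s => 2 * s) p.1, p.2)
  else K (map_coord0 (fun s => 2 * s - 1) p.1, p.2)); split.
- apply: glue_continuous.
  + move=> p; apply: (@continuous_comp _ _ _ fst coord0); first exact: cfst.
    exact: coord0_continuous.
  + move=> p; apply: continuous_comp; last exact: cH.
    exact: (cpair _ double_continuous).
  + move=> p; apply: continuous_comp; last exact: cK.
    exact: (cpair _ double1_continuous).
  + move=> [t s] /= /half_double e; rewrite /map_coord0 e subrr Hx ?Kx //;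
      apply: set_coord0_boundary; by [left|right].
- by move=> t s s0 /=; rewrite /nloop_concat_fun H0 ?K0.
- by move=> t s s1 /=; rewrite /nloop_concat_fun H1 ?K1.
- by move=> t s /half_boundary /=; case: ifP => _ tx; [exact: Hx | exact: Kx].
Qed.

Lemma homotopy_mul_class (a b : nloop n.+1 x) :
  homotopy_mul (homotopy_class a) (homotopy_class b) =
  homotopy_class (nloop_concat a b).
Proof.
by apply/homotopy_classP/homotopic_concat; exact: homotopic_repr.
Qed.

Lemma homotopic_repar (a c d : nloop n.+1 x) (g h : R -> R) :
  continuous g -> continuous h ->
  (forall t, c t = a (map_coord0 g t)) ->
  (forall t, d t = a (map_coord0 h t)) ->
  (forall s, s = 0 \/ s = 1 -> clamp_val (g s) = clamp_val (h s)) ->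
  (forall s, s = 0 \/ s = 1 -> clamp_val (h s) = 0 \/ clamp_val (h s) = 1) ->
  homotopic c d.
Proof.
move=> cg ch ca da gh h01.
pose u (p : cube n.+1 * I) : R := (1 - \val p.2) * clamp_val (g (coord0 p.1))
  + \val p.2 * clamp_val (h (coord0 p.1)).
have cc0 : continuous (fun p : cube n.+1 * I => coord0 p.1).
  move=> p; apply: (@continuous_comp _ _ R fst coord0); first exact: cvg_fst.
  exact: coord0_continuous.
have ccl (k : R -> R) : continuous k ->
    continuous (fun p : cube n.+1 * I => clamp_val (k (coord0 p.1))).
  move=> ck p; apply: (@continuous_comp _ R R
    (fun p : cube n.+1 * I => k (coord0 p.1)) clamp_val);
    last exact: clamp_val_continuous.
  by apply: (@continuous_comp _ R R (fun p : cube n.+1 * I => coord0 p.1) k);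
    [exact: cc0 | exact: ck].
have cu : continuous u.
  move=> p; apply: cvgD; apply: cvgM.
  - by apply: cvgB; [exact: cvg_cst | exact: param_continuous].
  - exact: ccl.
  - exact: param_continuous.
  - exact: ccl.
exists (fun p => a (set_coord0 (u p) p.1)); split.
- move=> p; apply: (@continuous_comp _ _ X
    (fun p => set_coord0 (u p) p.1) a); last exact: cts_fun.
  by apply: set_coord0_continuous => // q; exact: cvg_fst.
- move=> t s s0; rewrite /u /= s0 subr0 mul1r mul0r addr0.
  by rewrite set_coord0_clamp ca.
- move=> t s s1; rewrite /u /= s1 subrr mul1r mul0r add0r.
  by rewrite set_coord0_clamp da.
- move=> t s [i ti]; apply: nloop_boundary.
  have [i0|i0] := eqVneq i ord0; last first.
    by exists i; rewrite /= mxE (negbTE i0).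
  rewrite i0 -/(coord0 t) in ti; rewrite /u /= gh // -mulrDl subrK mul1r.
  exact/set_coord0_boundary/h01.
Qed.

Definition nloop_const : nloop n.+1 x :=
  @NLoop n.+1 X x (cst x : continuousType _ _) (fun _ _ => erefl).

Lemma rev_continuous : continuous (fun s : R => 1 - s).
Proof. by move=> s; apply: cvgB; [exact: cvg_cst | exact: cvg_id]. Qed.

Lemma nloop_rev_continuous (a : nloop n.+1 x) :
  continuous (fun t => a (map_coord0 (fun s => 1 - s) t)).
Proof.
move=> t; apply: (@continuous_comp _ _ X (map_coord0 (fun s => 1 - s)) a);
  last exact: cts_fun.
exact: (@map_coord0_continuous _ rev_continuous).
Qed.

Lemma nloop_rev_boundary (a : nloop n.+1 x) t :
  cube_boundary t -> mkcts (@nloop_rev_continuous a) t = x.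
Proof.
move=> [i ti]; apply: nloop_boundary.
have [i0|i0] := eqVneq i ord0; last first.
  by exists i; rewrite /= mxE (negbTE i0).
rewrite i0 -/(coord0 t) in ti; apply: set_coord0_boundary.
by case: ti => ->; rewrite ?subr0 ?subrr; [right | left].
Qed.

Definition nloop_rev (a : nloop n.+1 x) : nloop n.+1 x :=
  @NLoop n.+1 X x (mkcts (@nloop_rev_continuous a) : continuousType _ _)
    (@nloop_rev_boundary a).

Lemma nloopE (a : nloop n.+1 x) t : a t = a (map_coord0 id t).
Proof. by rewrite /map_coord0 set_coord0_id. Qed.

Lemma nloop_concatE (a b : nloop n.+1 x) t :
  nloop_concat a b t =
  if coord0 t <= 2^-1 then a (map_coord0 (fun s => 2 * s) t)
  else b (map_coord0 (fun s => 2 * s - 1) t).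
Proof. by []. Qed.

Lemma clamp_val_le0 s : s <= 0 -> clamp_val s = 0.
Proof. by move=> s0; rewrite /clamp_val max_l // ge_min s0 orbT. Qed.

Lemma clamp_val_ge1 s : 1 <= s -> clamp_val s = 1.
Proof. by move=> s1; rewrite /clamp_val min_l // max_r // ler01. Qed.

Lemma nloop_le0 (a : nloop n.+1 x) s t : s <= 0 -> a (set_coord0 s t) = x.
Proof.
move=> s0; rewrite nloop_boundary // -set_coord0_clamp clamp_val_le0 //.
by apply: set_coord0_boundary; left.
Qed.

Lemma nloop_ge1 (a : nloop n.+1 x) s t : 1 <= s -> a (set_coord0 s t) = x.
Proof.
move=> s1; rewrite nloop_boundary // -set_coord0_clamp clamp_val_ge1 //.
by apply: set_coord0_boundary; right.
Qed.

Lemma homotopic_concat1l (a : nloop n.+1 x) :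
  homotopic (nloop_concat nloop_const a) a.
Proof.
apply: (@homotopic_repar a _ _ (fun s => 2 * s - 1) id).
- exact: double1_continuous.
- by move=> s; exact: cvg_id.
- move=> t; rewrite nloop_concatE; case: ifP => // t2.
  have e : 2 * coord0 t - 1 <= 0 by lra.
  by rewrite /map_coord0 (nloop_le0 a t e).
- exact: nloopE.
- by move=> s [->|->]; [rewrite !clamp_val_le0 //; lra|rewrite !clamp_val_ge1 //; lra].
- by move=> s [->|->]; [left; rewrite clamp_val_le0|right; rewrite clamp_val_ge1].
Qed.

Lemma homotopic_concat1r (a : nloop n.+1 x) :
  homotopic (nloop_concat a nloop_const) a.
Proof.
apply: (@homotopic_repar a _ _ (fun s => 2 * s) id).
- exact: double_continuous.
- by move=> s; exact: cvg_id.
- move=> t; rewrite nloop_concatE; case: ifPn => // t2.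
  have e : 1 <= 2 * coord0 t by lra.
  by rewrite /map_coord0 (nloop_ge1 a t e).
- exact: nloopE.
- by move=> s [->|->]; [rewrite !clamp_val_le0 //; lra|rewrite !clamp_val_ge1 //; lra].
- by move=> s [->|->]; [left; rewrite clamp_val_le0|right; rewrite clamp_val_ge1].
Qed.

Lemma homotopic_concatV (a : nloop n.+1 x) :
  homotopic (nloop_concat a (nloop_rev a)) nloop_const.
Proof.
apply: (@homotopic_repar a _ _ (fun s => Num.min (2 * s) (2 - 2 * s)) (cst 0)).
- move=> s; apply: (@continuous_min R R (fun s => 2 * s) (fun s => 2 - 2 * s)).
    exact: double_continuous.
  by apply: cvgB; [exact: cvg_cst | exact: double_continuous].
- by move=> s; exact: cvg_cst.
- move=> t; rewrite nloop_concatE /map_coord0; case: ifPn => t2.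
    by rewrite min_l //; lra.
  rewrite min_r; last lra.
  rewrite /= /mkcts /map_coord0 coord0_set set_coord0_set.
  have := coord0_itv t => /andP[t0 t1].
  by rewrite clamp_valE; [congr (a (set_coord0 _ _)); lra | apply/andP; split; lra].
- by move=> t; rewrite nloop_le0.
- move=> s [->|->]; rewrite !clamp_val_le0 ?ge_min //=; apply/orP; [left|right]; lra.
- by move=> s _; left; rewrite clamp_val_le0.
Qed.

Lemma nloop_revK (a : nloop n.+1 x) : nloop_rev (nloop_rev a) =1 a.
Proof.
move=> t; rewrite /= /mkcts /map_coord0 coord0_set set_coord0_set.
have := coord0_itv t => /andP[t0 t1].
rewrite clamp_valE; last by apply/andP; split; lra.
by rewrite (_ : 1 - (1 - coord0 t) = coord0 t) ?set_coord0_id //; lra.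
Qed.

Lemma homotopic_eqfun (a b : nloop n.+1 x) : a =1 b -> homotopic a b.
Proof.
move=> ab; have [H [cH H0 H1 Hx]] := homotopic_refl a.
by exists H; split=> // t s s1; rewrite H1.
Qed.

Lemma homotopic_concatA (a b c : nloop n.+1 x) :
  homotopic (nloop_concat a (nloop_concat b c))
            (nloop_concat (nloop_concat a b) c).
Proof.
apply: (@homotopic_repar (nloop_concat (nloop_concat a b) c) _ _
  (fun s => Num.max (s / 2) (Num.max (s - 4^-1) (2 * s - 1))) id).
- move=> s; apply: (@continuous_max R R (fun s => s / 2)
    (fun s => Num.max (s - 4^-1) (2 * s - 1))).
    by apply: cvgM; [exact: cvg_id | exact: cvg_cst].
  apply: (@continuous_max R R (fun s => s - 4^-1) (fun s => 2 * s - 1)).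
    by apply: cvgB; [exact: cvg_id | exact: cvg_cst].
  exact: double1_continuous.
- by move=> s; exact: cvg_id.
- move=> t; have := coord0_itv t => /andP[t0 t1].
  rewrite !nloop_concatE /map_coord0 !coord0_set !set_coord0_set.
  have [t2|t2] := leP (coord0 t) 2^-1.
    rewrite (@max_l _ _ (coord0 t / 2)); last by rewrite ge_max; apply/andP; split; lra.
    rewrite (@clamp_valE (coord0 t / 2)); last by apply/andP; split; lra.
    rewrite ifT; last lra.
    rewrite (@clamp_valE (2 * _)); last by apply/andP; split; lra.
    rewrite ifT; last lra.
    by congr (a (set_coord0 _ _)); lra.
  rewrite (@max_r _ _ (coord0 t / 2)); last first.
    by rewrite le_max; apply/orP; left; lra.
  rewrite (@clamp_valE (2 * coord0 t - 1)); last by apply/andP; split; lra.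
  have [t3|t3] := leP (2 * coord0 t - 1) 2^-1.
    rewrite (@max_l _ _ (coord0 t - _)); last lra.
    rewrite (@clamp_valE (coord0 t - _)); last by apply/andP; split; lra.
    rewrite ifT; last lra.
    rewrite (@clamp_valE (2 * (coord0 t - _))); last by apply/andP; split; lra.
    rewrite ifF; last by apply/negbTE; rewrite -ltNge; lra.
    by congr (b (set_coord0 _ _)); lra.
  rewrite (@max_r _ _ (coord0 t - _)); last lra.
  rewrite (@clamp_valE (2 * coord0 t - 1)); last by apply/andP; split; lra.
  by rewrite ifF //; apply/negbTE; rewrite -ltNge; lra.
- exact: nloopE.
- move=> s [->|->].
    rewrite !clamp_val_le0 // !ge_max; apply/and3P; split; lra.
  by rewrite !clamp_val_ge1 // !le_max; apply/or3P; apply: Or33; lra.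
- by move=> s [->|->]; [left; rewrite clamp_val_le0|right; rewrite clamp_val_ge1].
Qed.

Definition homotopy_one : homotopy_group n.+1 x := homotopy_class nloop_const.

Definition homotopy_inv (p : homotopy_group n.+1 x) : homotopy_group n.+1 x :=
  homotopy_class (nloop_rev (repr p)).

Lemma homotopy_class_repr (p : homotopy_group n.+1 x) :
  homotopy_class (repr p) = p.
Proof. exact: reprK. Qed.

Lemma homotopy_mulA : associative homotopy_mul.
Proof.
move=> p q r; rewrite -(homotopy_class_repr p) -(homotopy_class_repr q).
rewrite -(homotopy_class_repr r) !homotopy_mul_class.
exact/homotopy_classP/homotopic_concatA.
Qed.

Lemma homotopy_mul1l : left_id homotopy_one homotopy_mul.
Proof.
move=> p; rewrite -(homotopy_class_repr p) !homotopy_mul_class.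
exact/homotopy_classP/homotopic_concat1l.
Qed.

Lemma homotopy_mul1r : right_id homotopy_one homotopy_mul.
Proof.
move=> p; rewrite -(homotopy_class_repr p) !homotopy_mul_class.
exact/homotopy_classP/homotopic_concat1r.
Qed.

Lemma homotopy_mulV : right_inverse homotopy_one homotopy_inv homotopy_mul.
Proof.
move=> p; rewrite -{1}(homotopy_class_repr p) homotopy_mul_class.
exact/homotopy_classP/homotopic_concatV.
Qed.

Lemma homotopy_mulVl : left_inverse homotopy_one homotopy_inv homotopy_mul.
Proof.
move=> p; rewrite -{2}(homotopy_class_repr p) homotopy_mul_class.
apply/homotopy_classP.
apply: homotopic_trans (homotopic_concatV (nloop_rev (repr p))).
apply: homotopic_concat; first exact: homotopic_refl.
by apply: homotopic_eqfun => t; rewrite nloop_revK.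
Qed.

End Multiplication.

HB.instance Definition _ n (X : topologicalType) (x : X) :=
  Choice.on (homotopy_group n x).

HB.instance Definition _ n (X : topologicalType) (x : X) :=
  isGroup.Build (homotopy_group n.+1 x) (@homotopy_mulA n X x)
    (@homotopy_mul1l n X x) (@homotopy_mul1r n X x)
    (@homotopy_mulVl n X x) (@homotopy_mulV n X x).

End HomotopyGroups.

Arguments homotopy_map R n {X Y} f x p.

Definition group_isomorphism (G H : groupType) (phi : G -> H) : Prop :=
  {morph phi : p q / (p * q)%g} /\ bijective phi.

Definition weak_homotopy_equivalence (R : realType) (X Y : topologicalType)
    (f : continuousType X Y) : Prop :=
  ~ inhabited X /\ ~ inhabited Y \/
  [/\ inhabited X, inhabited Y &
      forall x : X, bijective (homotopy_map R 0 f x) /\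
        forall n, group_isomorphism (homotopy_map R n.+1 f x)].

(* Main.v *)
From HB Require Import structures.
From mathcomp Require Import all_boot all_order all_algebra.
From mathcomp Require Import all_classical all_reals topology normedtype realfun.
From mathcomp Require Import ring lra.
From mathcomp Require wochoice.
Require Import Defs.
Import Order.TTheory GRing.Theory Num.Theory.
Import numFieldNormedType.Exports.

Set Implicit Arguments.
Unset Strict Implicit.
Unset Printing Implicit Defensive.

Local Open Scope classical_set_scope.
Local Open Scope ring_scope.
Local Open Scope cat_scope.

(** The structure is Quillen's: the cofibrations have the left lifting property
    against the maps that fill all spheres, and the proof rests on one criterion
    for weak homotopy equivalences and on two functorial factorizations.

    Disks are replaced by cubes throughout. A map of spaces [f : X -> Y] is
    called compressible if every cube in [Y] whose boundary is lifted to [X] is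
    homotopic, relative to the boundary, to the image of a cube in [X] with the
    given boundary. Compressible maps are the weak homotopy equivalences
    ([compressible_weq], [weq_compressible]); a map is compressible if and only
    if the end point map [path_end f] of its mapping path space fills the
    boundaries of all cubes ([path_end_acyclic]), and a Serre fibration is
    compressible if and only if it does so itself ([acyclicE]). Hence the
    fibrations that are weak equivalences are exactly the maps with the right
    lifting property against the sphere inclusions. No base points occur in this
    criterion, which is what the nontrivial case of two out of three needs
    ([compressible_cancel]).

    Any map factors into a countable sequence of steps, each of which attaches
    one cell for every square from a sphere inclusion to the rest of the map,
    followed by a map that fills spheres: a sphere in the colimit of the
    sequence lies in one stage, by compactness ([tower_compact_factor]). This is
    the first factorization. Its left part is, up to isomorphism, a relative cell
    complex, since the cells of all the steps can be attached one by one along a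
    well-order ([cell_decomposition_retract]). The second factorization comes from
    the first one and the mapping path space, whose end point map is a Serre
    fibration.

    The first lifting axiom follows, as lifting properties pass to pushouts,
    transfinite composites and retracts. For the second one, let [i] be a
    cofibration and a weak equivalence. By the criterion and the first axiom, [i]
    lifts against its own [path_end i], so that it is the inclusion of a
    deformation retract; a lift of a square from [i] to a Serre fibration [p] is
    the end of a homotopy that starts from the retraction, and this homotopy
    exists because the map of path spaces induced by [p] fills spheres
    ([path_push_acyclic]).

    All the constructions stay in the given kind of spaces because each of them
    carries the final topology for some family of maps into it, so that only
    the separation axioms have to be checked. *)

(** * Final topologies and the kinds of spaces *)

(** Every space built below carries the finest topology making a given family
    of maps into it continuous. The family is a predicate on all maps out of
    all spaces, so that it may be a proper class such as the continuous maps
    out of all compact Hausdorff spaces. *)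
Definition tests (T : Type) := forall K : topologicalType, (K -> T) -> Prop.

Definition final (T : Type) (t : tests T) : Type := T.

Section FinalTopology.
Variables (T : Type) (t : tests T).

Definition final_open (A : set (final t)) : Prop :=
  forall (K : topologicalType) (g : K -> T), @t K g -> open (g @^-1` A).

Lemma final_openT : final_open setT.
Proof. by move=> K g _; rewrite preimage_setT; exact: openT. Qed.

Lemma final_openI : setI_closed final_open.
Proof.
move=> A B oA oB K g tg; rewrite preimage_setI.
by apply: openI; [exact: oA | exact: oB].
Qed.

Lemma final_open_bigU (I : Type) (f : I -> set (final t)) :
  (forall i, final_open (f i)) -> final_open (\bigcup_i f i).
Proof.
move=> of_ K g tg; rewrite preimage_bigcup.
by apply: bigcup_open => i _; exact: of_.
Qed.

HB.instance Definition _ := gen_eqMixin (final t).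
HB.instance Definition _ := gen_choiceMixin (final t).
HB.instance Definition _ := isOpenTopological.Build (final t)
  final_openT final_openI final_open_bigU.

Lemma final_openE (A : set (final t)) :
  open A <-> forall (K : topologicalType) (g : K -> T), @t K g -> open (g @^-1` A).
Proof. by []. Qed.

Lemma final_closedE (A : set (final t)) :
  closed A <-> forall (K : topologicalType) (g : K -> T), @t K g -> closed (g @^-1` A).
Proof.
rewrite -openC final_openE; split=> cA K g /cA.
  by rewrite preimage_setC openC.
by rewrite preimage_setC openC.
Qed.

Lemma final_test (K : topologicalType) (g : K -> T) : @t K g -> continuous (g : K -> final t).
Proof. by move=> tg; apply/continuousP => A /final_openE; exact. Qed.

Lemma final_continuous (Z : topologicalType) (h : final t -> Z) :
  (forall (K : topologicalType) (g : K -> T), @t K g -> continuous (h \o g)) -> continuous h.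
Proof.
move=> hg; apply/continuousP => A oA; apply/final_openE => K g /hg.
by move/continuousP => /(_ A oA).
Qed.

End FinalTopology.

Lemma continuous_comp_fun (X Y Z : topologicalType) (f : X -> Y) (g : Y -> Z) :
  continuous f -> continuous g -> continuous (g \o f).
Proof. by move=> cf cg x; apply: continuous_comp; [exact: cf | exact: cg]. Qed.

Lemma continuous_idfun (X : topologicalType) : continuous (fun x : X => x).
Proof. by move=> x; exact: cvg_id. Qed.

Lemma continuous_eqfun (X Y : topologicalType) (f g : X -> Y) :
  f =1 g -> continuous f -> continuous g.
Proof. by move=> /funext ->. Qed.

(** The separation condition in each kind of space: it is the part of
    [is_space] that has to be checked by hand for a final topology. *)
Definition separated (k : space_kind) (X : topologicalType) : Prop :=
  match k with
  | CGWeakHausdorff => weak_hausdorff X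
  | CGHausdorff => hausdorff_space X
  | _ => True
  end.

Lemma is_space_separated k (X : topologicalType) : is_space k X -> separated k X.
Proof. by case: k => //= -[]. Qed.

Lemma is_space_cg k (X : topologicalType) : k <> AllSpaces -> is_space k X -> compactly_generated X.
Proof. by case: k => //= _ []. Qed.

Lemma final_compactly_generated (T : Type) (t : tests T) :
  (forall (K : topologicalType) (g : K -> T), @t K g -> compactly_generated K) ->
  compactly_generated (final t).
Proof.
move=> cgt A uA; apply/final_closedE => K g tg; apply: (cgt _ _ tg).
move=> L u cL hL cu; apply: (uA L (g \o u)) => //.
exact: (continuous_comp_fun cu (final_test tg)).
Qed.

Lemma final_is_space k (T : Type) (t : tests T) :
  (forall (K : topologicalType) (g : K -> T), @t K g -> is_space k K) ->
  separated k (final t) -> is_space k (final t).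
Proof.
have cg : k <> AllSpaces -> (forall (K : topologicalType) (g : K -> T), @t K g -> is_space k K) ->
    compactly_generated (final t).
  by move=> k0 tk; apply: final_compactly_generated => K g /tk; exact: is_space_cg.
by case: k cg => [|cg tk _|cg tk|cg tk] //=; [exact: cg|split=> //; exact: cg..].
Qed.

(** Spaces on which continuity out of a space of kind [k] can be tested, and
    for which the tube lemma is available in the compactly generated case. *)
Definition probe (k : space_kind) (K : topologicalType) : Prop :=
  if k is AllSpaces then True else compact [set: K] /\ hausdorff_space K.

Lemma probe_is_space k (K : topologicalType) : probe k K -> is_space k K.
Proof. by case: k => // -[cK hK]; exact: compact_hausdorff_is_space. Qed.

Lemma compact_hausdorff_probe k (K : topologicalType) :
  compact [set: K] -> hausdorff_space K -> probe k K.
Proof. by case: k. Qed.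

Lemma probe_continuous k (X Z : topologicalType) (h : X -> Z) :
  is_space k X ->
  (forall (K : topologicalType) (g : K -> X), probe k K -> continuous g -> continuous (h \o g)) ->
  continuous h.
Proof.
move=> Xk hg; have [k0|k0] := pselect (k = AllSpaces).
  by subst k; apply: (hg X id) => // x; exact: cvg_id.
apply/continuous_closedP => A cA; apply: (is_space_cg k0 Xk) => K u cK hK cu.
have /continuous_closedP := hg K u (compact_hausdorff_probe k cK hK) cu.
exact.
Qed.

Lemma closed_compact_subspace (K : topologicalType) (C : set K) :
  compact [set: K] -> hausdorff_space K -> closed C ->
  compact [set: C] /\ hausdorff_space C.
Proof.
move=> cK hK cC; split; last exact: set_type_hausdorff.
by apply: set_type_compact; exact: (subclosed_compact cC cK).
Qed.

Lemma weak_hausdorff_image (X K : topologicalType) (u : K -> X) (C : set K) :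
  weak_hausdorff X -> compact [set: K] -> hausdorff_space K -> continuous u ->
  closed C -> closed (u @` C).
Proof.
move=> wX cK hK cu cC; have [cC' hC'] := closed_compact_subspace cK hK cC.
have := wX C (u \o \val) cC' hC'.
rewrite (_ : range _ = u @` C).
  by apply; apply: continuous_comp_fun => //; exact: set_val_continuous.
apply/seteqP; split=> [_ [x _ <-]|_ [x Cx <-]] /=.
  by exists (\val x) => //; exact: set_valP.
by exists (exist _ x (mem_set Cx)).
Qed.

Lemma weak_hausdorff_closed1 (X : topologicalType) (x : X) :
  weak_hausdorff X -> closed [set x].
Proof.
move=> wX; have cb : compact [set: bool] by exact/finite_compact/finite_finset.
have hb : hausdorff_space bool by exact: discrete_hausdorff.
have := wX bool (fun=> x) cb hb (@cst_continuous _ _ x).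
rewrite (_ : range _ = [set x]) //.
by apply/seteqP; split=> [_ [? _ <-]|_ ->] //=; exists true.
Qed.

(** The reason why limits, path spaces and quotients are weak Hausdorff again.
    A point off the image of a compact [K] is separated from the image of a
    neighbourhood of each point of [K] by one of the maps, and compactness of
    [K] does the rest. *)
Lemma separated_by_maps k (Z : topologicalType) :
  (forall z z' : Z, z <> z' -> exists (W : topologicalType) (g : Z -> W),
     [/\ separated k W, continuous g & g z <> g z']) ->
  separated k Z.
Proof.
case: k => //= sepZ.
  move=> K u cK hK cu; rewrite -openC openE => z uz.
  have /compact_near_coveringP nK := cK.
  suff : \forall z' \near z, [set: K] `<=` [set k | u k <> z'].
    by apply: filterS => z' + [k _ kz']; move=> /(_ k I).
  apply: nK => k _; have ukz : u k <> z by move=> kz; apply: uz; exists k.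
  have [W [g [wW cg gkz]]] := sepZ _ _ ukz.
  have cgu : continuous (g \o u) by exact: continuous_comp_fun cu cg.
  have : nbhs k ((g \o u) @^-1` ~` [set g z]).
    apply: open_nbhs_nbhs; split; last exact: gkz.
    rewrite -preimage_setC openC; move/continuous_closedP: cgu; apply.
    exact: weak_hausdorff_closed1.
  have := @compact_regular K k setT hK cK filterT.
  move=> /[apply] -[D nD Dgz].
  exists (D, g @^-1` ~` ((g \o u) @` closure D)).
    split=> //=; apply: open_nbhs_nbhs; split.
      rewrite -preimage_setC openC; move/continuous_closedP: cg; apply.
      exact: weak_hausdorff_image (@closed_closure _ _).
    by move=> [k' /Dgz].
  move=> [k' z'] /= [Dk' gz'] uk'; apply: gz'; exists k'; last by rewrite /= uk'.
  exact: subset_closure.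
rewrite open_hausdorff => z z' /eqP zz'.
have [W [g [hW cg gzz']]] := sepZ _ _ zz'.
move: hW; rewrite open_hausdorff => /(_ (g z) (g z')) [|[A B] /=]; first exact/eqP.
move=> [Az Bz'] [oA oB /eqP AB]; exists (g @^-1` A, g @^-1` B) => /=.
  by split; [move: Az; rewrite !inE | move: Bz'; rewrite !inE].
split; [by move/continuousP: cg; exact | by move/continuousP: cg; exact|].
by apply/eqP; rewrite -preimage_setI AB preimage_set0.
Qed.

Lemma separated_inj k (Z W : topologicalType) (g : Z -> W) :
  separated k W -> continuous g -> injective g -> separated k Z.
Proof.
by move=> sW cg gI; apply: separated_by_maps => z z' zz'; exists W, g; split=> // /gI.
Qed.

(** * Limits and colimits of spaces *)

Lemma sval_eq (T : Type) (P : T -> Prop) (x y : {x | P x}) :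
  sval x = sval y -> x = y.
Proof. by case: x y => [x Px] [y Py] /= xy; exact: eq_exist. Qed.

Definition app k (X Y : Top k) (f : mor X Y) : sval X -> sval Y :=
  (f : continuousType (sval X) (sval Y)).

Definition mk_mor k (X Y : Top k) (h : sval X -> sval Y)
    (ch : continuous h) : mor X Y := mkcts ch.

Section Morphisms.
Variable k : space_kind.

Lemma app_continuous (X Y : Top k) (f : mor X Y) : continuous (app f).
Proof. exact: cts_fun. Qed.

Lemma mor_eq (X Y : Top k) (f g : mor X Y) : app f =1 app g -> f = g.
Proof. by move=> fg; apply/continuousEP. Qed.

Lemma app_eq (X Y : Top k) (f g : mor X Y) : f = g -> app f =1 app g.
Proof. by move=> ->. Qed.

Lemma app_comp (X Y Z : Top k) (g : mor Y Z) (f : mor X Y) x :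
  app (g ∘ f) x = app g (app f x).
Proof. by []. Qed.

Lemma app_id (X : Top k) x : app (idm X) x = x.
Proof. by []. Qed.

Lemma app_mk (X Y : Top k) (h : sval X -> sval Y) (ch : continuous h) :
  app (mk_mor ch) = h.
Proof. by []. Qed.

End Morphisms.

Arguments app_continuous {k X Y} f.

Section Limit.
Variables (k : space_kind) (J : small_category) (F : functor J (Top k)).

Definition sections : Type :=
  {x : forall j : sob J, sval (F j) |
    forall (i j : sob J) (u : shom i j), @app k (F i) (F j) (@fmap J (Top k) F i j u) (x i) = x j}.

Definition section_tests : tests sections := fun K g =>
  probe k K /\ forall j, continuous (fun z => sval (g z) j).

Lemma section_leg_continuous j :
  continuous (fun x : final section_tests => sval x j).
Proof. by apply: final_continuous => K g [_ /(_ j)]. Qed.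

Lemma section_is_space : is_space k (final section_tests).
Proof.
apply: final_is_space => [K g [pK _]|]; first exact: probe_is_space.
apply: separated_by_maps => x y xy.
have [j xyj] : exists j, sval x j <> sval y j.
  apply: contra_notP xy => xy; apply: sval_eq; apply: functional_extensionality_dep.
  by move=> j; apply: contrapT => xyj; apply: xy; exists j.
exists (sval (F j)), (fun x => sval x j); split => //.
  exact: is_space_separated (svalP (F j)).
exact: section_leg_continuous.
Qed.

Definition section_ob : Top k :=
  exist (is_space k) (final section_tests : topologicalType) section_is_space.

Definition section_leg (j : sob J) : mor section_ob (F j) :=
  @mk_mor k section_ob (F j) _ (@section_leg_continuous j).

Lemma section_natural (i j : sob J) (u : shom i j) :
  @fmap J (Top k) F i j u ∘ section_leg i = section_leg j.
Proof. by apply: mor_eq => x; exact: (svalP (x : sections)). Qed.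

Definition section_cone : cone F := @Cone J (Top k) F _ _ section_natural.

Lemma section_cone_is_limit : is_limit section_cone.
Proof.
move=> K.
have hP (z : sval (cone_ob K)) (i j : sob J) (u : shom i j) :
    app (@fmap J (Top k) F i j u) (app (cone_leg K i) z) = app (cone_leg K j) z.
  exact: app_eq (@cone_natural J (Top k) F K i j u) z.
pose h (z : sval (cone_ob K)) : sections :=
  exist _ (fun j : sob J => app (cone_leg K j) z) (hP z).
have ch : continuous (h : _ -> final section_tests).
  apply: (probe_continuous (svalP (cone_ob K))) => L g pL cg.
  apply: final_test; split => // j.
  exact: continuous_comp_fun cg (app_continuous (cone_leg K j)).
exists (@mk_mor k (cone_ob K) section_ob _ ch); split.
  by move=> j; exact: mor_eq.
move=> h' h'K; apply: mor_eq => z; apply: sval_eq.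
by apply: functional_extensionality_dep => j; exact: esym (app_eq (h'K j) z).
Qed.

End Limit.

(** The colimit identifies exactly the points that every cocone of spaces of
    the given kind identifies, so that no weak Hausdorff or Hausdorff
    reflection has to be applied afterwards. *)
Section Colimit.
Variables (k : space_kind) (J : small_category) (F : functor J (Top k)).

Definition points : Type := {j : sob J & sval (F j)}.

Definition same_image (p q : points) : Prop := forall K : cocone F,
  app (cocone_leg K (projT1 p)) (projT2 p) =
  app (cocone_leg K (projT1 q)) (projT2 q).

Definition colimit_class (p : points) : set points := same_image p.

Definition colimit_points : Type :=
  {A : set points | exists p, A = colimit_class p}.

Definition colimit_inj (p : points) : colimit_points :=
  exist _ (colimit_class p) (ex_intro _ p erefl).

Lemma colimit_injP p q : colimit_inj p = colimit_inj q <-> same_image p q.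
Proof.
split=> [/(congr1 sval) /= pq|pq]; first by have : colimit_class q q by []; rewrite -pq.
apply: sval_eq; apply/seteqP; split=> r pr K; [rewrite -pq | rewrite pq]; exact: pr.
Qed.

Lemma colimit_inj_surj (z : colimit_points) : exists p, z = colimit_inj p.
Proof. by case: z => A [p Ap]; exists p; apply: sval_eq. Qed.

Inductive colimit_tests : tests colimit_points :=
  ColimitTest (j : sob J) :
    @colimit_tests (sval (F j)) (fun x => colimit_inj (existT _ j x)).

Definition colimit_desc (K : cocone F) (z : colimit_points) :
    sval (cocone_ob K) :=
  let p := projT1 (cid (colimit_inj_surj z)) in
  app (cocone_leg K (projT1 p)) (projT2 p).

Lemma colimit_descE (K : cocone F) p :
  colimit_desc K (colimit_inj p) = app (cocone_leg K (projT1 p)) (projT2 p).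
Proof.
rewrite /colimit_desc; case: cid => q /= /esym/colimit_injP; exact.
Qed.

Lemma colimit_desc_continuous (K : cocone F) :
  continuous (colimit_desc K : final colimit_tests -> _).
Proof.
apply: final_continuous => L g [j].
apply: continuous_eqfun (app_continuous (cocone_leg K j)) => x.
by rewrite /= colimit_descE.
Qed.

Lemma colimit_is_space : is_space k (final colimit_tests).
Proof.
apply: final_is_space => [K g [j]|]; first exact: (svalP (F j)).
apply: separated_by_maps => z z'.
have [p ->] := colimit_inj_surj z; have [q ->] := colimit_inj_surj z'.
move=> /colimit_injP/existsNP[K pqK].
exists (sval (cocone_ob K)), (colimit_desc K); split.
- exact: is_space_separated (svalP (cocone_ob K)).
- exact: colimit_desc_continuous.
- by rewrite !colimit_descE.
Qed.

Definition colimit_ob : Top k :=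
  exist (is_space k) (final colimit_tests : topologicalType) colimit_is_space.

Definition colimit_leg (j : J) : mor (F j) colimit_ob :=
  @mk_mor k (F j) colimit_ob _ (final_test (ColimitTest j)).

Lemma colimit_natural i j (u : mor i j) :
  colimit_leg j ∘ fmap F u = colimit_leg i.
Proof.
apply: mor_eq => x; apply/colimit_injP => K.
exact: (app_eq (cocone_natural K u) x).
Qed.

Definition colimit_cocone : cocone F := Cocone colimit_natural.

Lemma colimit_cocone_is_colimit : is_colimit colimit_cocone.
Proof.
move=> K; exists (@mk_mor k colimit_ob (cocone_ob K) _ (@colimit_desc_continuous K)).
split=> [j|h hK]; first by apply: mor_eq => x; exact: colimit_descE.
apply: mor_eq => z; have [[j x] ->] := colimit_inj_surj z.
by rewrite app_mk colimit_descE; exact: esym (app_eq (hK j) x).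
Qed.

End Colimit.

Lemma top_limits k : has_small_limits (Top k).
Proof. by move=> J F; exists (section_cone F); exact: section_cone_is_limit. Qed.

Lemma top_colimits k : has_small_colimits (Top k).
Proof.
by move=> J F; exists (colimit_cocone F); exact: colimit_cocone_is_colimit.
Qed.

(** * Lifting properties of transfinite composites *)

Section Lifting.
Variable C : category.

Lemma colimit_joint_epi (J : category) (F : functor J C) (L : cocone F) (Z : C)
    (h h' : mor (cocone_ob L) Z) :
  is_colimit L -> (forall j, h ∘ cocone_leg L j = h' ∘ cocone_leg L j) ->
  h = h'.
Proof.
move=> colim hh'.
have nat_ i j (u : mor i j) :
    (h' ∘ cocone_leg L j) ∘ fmap F u = h' ∘ cocone_leg L i.
  by rewrite -mcomp_assoc cocone_natural.
have [m [_ mU]] := colim (Cocone nat_).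
by rewrite -(mU h) // -(mU h').
Qed.

Lemma lifting_retract (A B D E X Y : C) (i : mor A B) (j : mor D E)
    (p : mor X Y) : retract_of i j -> has_lifting j p -> has_lifting i p.
Proof.
move=> [s [r [t [q [rs qt ts qj]]]]] lift u v uv.
have [|h [hu hv]] := lift (u ∘ r) (v ∘ q).
  by rewrite mcomp_assoc uv -!mcomp_assoc qj.
exists (h ∘ t); split.
  by rewrite -mcomp_assoc ts mcomp_assoc hu -mcomp_assoc rs mcomp_idr.
by rewrite mcomp_assoc hv -mcomp_assoc qt mcomp_idr.
Qed.

Lemma lifting_retractr (A B D E X Y : C) (i : mor A B) (j : mor D E)
    (p : mor X Y) : retract_of i j -> has_lifting p j -> has_lifting p i.
Proof.
move=> [s [r [t [q [rs qt ts qj]]]]] lift u v uv.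
have [|h [hu hv]] := lift (s ∘ u) (t ∘ v).
  by rewrite mcomp_assoc -ts -mcomp_assoc uv mcomp_assoc.
exists (r ∘ h); split.
  by rewrite -mcomp_assoc hu mcomp_assoc rs mcomp_idl.
by rewrite mcomp_assoc -qj -mcomp_assoc hv mcomp_assoc qt mcomp_idl.
Qed.

Lemma retract_trans (A B D E G H : C) (f : mor A B) (g : mor D E)
    (h : mor G H) : retract_of f g -> retract_of g h -> retract_of f h.
Proof.
move=> [s [r [t [q [rs qt ts qj]]]]] [s' [r' [t' [q' [rs' qt' ts' qj']]]]].
exists (s' ∘ s), (r ∘ r'), (t' ∘ t), (q ∘ q'); split.
- by rewrite mcomp_assoc -(mcomp_assoc r) rs' mcomp_idr.
- by rewrite mcomp_assoc -(mcomp_assoc q) qt' mcomp_idr.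
- by rewrite -mcomp_assoc ts mcomp_assoc ts' -mcomp_assoc.
- by rewrite -mcomp_assoc qj' mcomp_assoc qj -mcomp_assoc.
Qed.

Lemma lifting_pushout (A B D E X Y : C) (i : mor A B) (a : mor A D)
    (b : mor B E) (j : mor D E) (p : mor X Y) :
  is_pushout i a b j -> has_lifting i p -> has_lifting j p.
Proof.
move=> [ba po] lift u v uv.
have [|g [gi gv]] := lift (u ∘ a) (v ∘ b).
  by rewrite mcomp_assoc uv -!mcomp_assoc ba.
have [h [[hb hj] _]] := po _ g u gi; exists h; split=> //.
have [m [_ mU]] := po _ (p ∘ g) (p ∘ u) (etrans (esym (mcomp_assoc _ _ _))
  (etrans (congr1 (mcomp p) gi) (mcomp_assoc _ _ _))).
rewrite -(mU (p ∘ h)); first by apply: mU; rewrite gv uv.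
by rewrite -!mcomp_assoc hb hj.
Qed.

Lemma well_order_wf d (I : orderType d) :
  wochoice.well_order (<=%O : rel I) -> well_founded (fun i j : I => (i < j)%O).
Proof.
move=> wo; apply: contrapT => /existsNP[i0 Ni0].
pose A : {pred I} := fun i => `[< ~ Acc (fun i j : I => (i < j)%O) i >].
have [|z [[zA minz] _]] := wo A; first by exists i0; exact/asboolP.
apply: (asboolW zA); constructor=> y yz; apply: contrapT => Ny.
suff : (z <= y)%O by rewrite leNgt yz.
by apply: minz; exact/asboolP.
Qed.

Section TransfiniteLift.
Variables (d : Order.disp_t) (I : orderType d).
Variables (F : functor (poset_category I) C) (L : cocone F) (bot : I).
Hypothesis wf_lt : well_founded (fun i j : I => (i < j)%O).
Hypothesis bot_le : forall i : I, (bot <= i)%O.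
Variables (X Y : C) (p : mor X Y) (u : mor (F bot) X) (v : mor (cocone_ob L) Y).
Hypothesis uv : p ∘ u = v ∘ cocone_leg L bot.

Let Fm (i j : I) (ij : (i <= j)%O) : mor (F i) (F j) := @fmap _ _ F i j ij.

Let Fm_comp (i j k : I) (ij : (i <= j)%O) (jk : (j <= k)%O) (ik : (i <= k)%O) :
  Fm jk ∘ Fm ij = Fm ik.
Proof.
rewrite /Fm -fmap_comp; congr (fmap F _); exact: bool_irrelevance.
Qed.

Let Fm_id (i : I) (ii : (i <= i)%O) : Fm ii = idm (F i).
Proof. by rewrite -fmap_id /Fm; congr (fmap F _); exact: bool_irrelevance. Qed.

Let Fm_irr (i j : I) (a b : (i <= j)%O) : Fm a = Fm b.
Proof. by rewrite (bool_irrelevance a b). Qed.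

Let leg_Fm (i j : I) (ij : (i <= j)%O) :
  cocone_leg L j ∘ Fm ij = cocone_leg L i.
Proof. exact: (@cocone_natural _ _ F L i j ij). Qed.

(* The value at [i] of a lift that extends all the values at smaller
   indices. *)
Let extends (i : I) (rec : forall j, (j < i)%O -> option (mor (F j) X))
    (h : mor (F i) X) : Prop :=
  [/\ p ∘ h = v ∘ cocone_leg L i, h ∘ Fm (bot_le i) = u &
      forall j (ji : (j < i)%O), rec j ji = Some (h ∘ Fm (ltW ji))].

Let step (i : I) (rec : forall j, (j < i)%O -> option (mor (F j) X)) :
    option (mor (F i) X) :=
  if pselect (exists h, extends rec h) is left e
  then Some (projT1 (cid e)) else None.

Let lift_at : forall i : I, option (mor (F i) X) :=
  Fix wf_lt (fun i => option (mor (F i) X)) step.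

Let lift_atE i : lift_at i = step (fun j (_ : (j < i)%O) => lift_at j).
Proof.
rewrite /lift_at Fix_eq // => j f g fg; congr step.
by apply: functional_extensionality_dep => l;
  apply: functional_extensionality_dep => lj; exact: fg.
Qed.

Hypothesis succ_lift :
  forall (i j : I) (ij : covers i j), has_lifting (Fm (ltW ij.1)) p.
Hypothesis limit_colim :
  forall i : I, limit_element i -> is_colimit (initial_segment_cocone F i).

Let lift_at_spec i : exists h, lift_at i = Some h /\
  extends (fun j (_ : (j < i)%O) => lift_at j) h.
Proof.
have wf := wf_lt; elim/(well_founded_ind wf): i => i IH.
suff [h eh] : exists h, extends (fun j (_ : (j < i)%O) => lift_at j) h.
  rewrite lift_atE /step; case: pselect => [e|]; last by case; exists h.
  by exists (projT1 (cid e)); split=> //; case: cid.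
have [ib|ib] := eqVneq i bot.
  subst i; exists u; split; first exact: uv.
  - by rewrite Fm_id mcomp_idr.
  - by move=> j jb; move: (bot_le j); rewrite leNgt jb.
have bi : (bot < i)%O by rewrite lt_neqAle eq_sym ib bot_le.
have [[j ji]|ncov] := pselect (exists j, covers j i).
  have [g [gS [gp gu gr]]] := IH j ji.1.
  have [|h [hg hp]] := @succ_lift j i ji g (v ∘ cocone_leg L i).
    by rewrite gp -mcomp_assoc leg_Fm.
  exists h; split=> //.
    by rewrite -(Fm_comp (bot_le j) (ltW ji.1)) mcomp_assoc hg gu.
  move=> l li; have lj : (l <= j)%O.
    by rewrite leNgt; apply/negP => jl; apply: (ji.2 l); rewrite jl.
  rewrite -(Fm_comp lj (ltW ji.1) (ltW li)) mcomp_assoc hg.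
  have [lj'|] := boolP (l < j)%O.
    by rewrite gr (Fm_irr _ lj).
  rewrite -leNgt => jl; have jl' : l = j by apply/le_anti; rewrite lj jl.
  by subst l; rewrite gS Fm_id mcomp_idr.
have colim : is_colimit (initial_segment_cocone F i).
  by apply: limit_colim; split; [exists bot | exact/forallNP].
pose g (j : full_sub (@below d I i)) : mor (F (sval j)) X :=
  projT1 (cid (IH (sval j) (svalP j))).
have gE (j : full_sub (@below d I i)) : lift_at (sval j) = Some (g j) /\
    extends (fun l (_ : (l < sval j)%O) => lift_at l) (g j).
  by rewrite /g; case: cid.
have g_nat (j l : full_sub (@below d I i)) (jl : mor j l) :
    g l ∘ fmap (restrict (@below d I i) F) jl = g j.
  have [gl [_ _ gr]] := gE l; have [gj _] := gE j.
  move: (jl : (sval j <= sval l)%O) => {}jl.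
  change (g l ∘ Fm jl = g j).
  have [jl'|] := boolP (sval j < sval l)%O.
    by have := gr _ jl'; rewrite gj => -[->]; rewrite (Fm_irr _ jl).
  rewrite -leNgt => lj; have e : sval j = sval l by apply/le_anti; rewrite jl lj.
  have e' : j = l by exact: sval_eq.
  by subst l; rewrite Fm_id mcomp_idr.
have [h [hg _]] := colim (Cocone g_nat); exists h.
have hj (j : I) (ji : (j < i)%O) : h ∘ Fm (ltW ji) = g (exist _ j ji).
  rewrite -[RHS](hg (exist (@below d I i) j ji)); congr (h ∘ _).
  exact: Fm_irr.
split.
- apply: (colimit_joint_epi colim) => j.
  rewrite -mcomp_assoc hg -mcomp_assoc.
  have -> : cocone_leg L i ∘ cocone_leg (initial_segment_cocone F i) j =
      cocone_leg L (sval j) by exact: leg_Fm.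
  by have [_ [gp _ _]] := gE j.
- have [_ [_ gu _]] := gE (exist _ bot bi).
  by rewrite -gu -hj -mcomp_assoc (Fm_comp _ _ (bot_le i)).
- by move=> j ji; rewrite hj; have [] := gE (exist _ j ji).
Qed.

Lemma transfinite_lift : is_colimit L ->
  exists h : mor (cocone_ob L) X, h ∘ cocone_leg L bot = u /\ p ∘ h = v.
Proof.
move=> colim; pose g i := projT1 (cid (lift_at_spec i)).
have gE i : lift_at i = Some (g i) /\
    extends (fun l (_ : (l < i)%O) => lift_at l) (g i).
  by rewrite /g; case: cid.
have g_nat (i j : poset_category I) (ij : mor i j) : g j ∘ fmap F ij = g i.
  have [gj [_ _ gr]] := gE j; have [gi _] := gE i.
  move: (ij : (i <= j)%O) => {}ij; change (g j ∘ Fm ij = g i).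
  have [ij'|] := boolP ((i : I) < j)%O.
    by have := gr _ ij'; rewrite gi => -[->]; rewrite (Fm_irr _ ij).
  rewrite -leNgt => ji; have e : i = j :> I by apply/le_anti; rewrite ij ji.
  by case: _ / e ij {ji gr gj gi}=> ij; rewrite Fm_id mcomp_idr.
have [h [hg _]] := colim (Cocone g_nat); exists h; split.
  have [_ [_ gu _]] := gE bot.
  by rewrite hg /= -[LHS]mcomp_idr -(Fm_id (bot_le bot)) gu.
apply: (colimit_joint_epi colim) => i.
by rewrite -mcomp_assoc hg /=; have [_ [-> _ _]] := gE i.
Qed.

End TransfiniteLift.

(** A lift against a transfinite composite is built by recursion on its
    length: at a successor by the lifting property of the step, at a limit by
    the universal property of the colimit. The recursion takes its values in
    [option] because the set of lifts at a given stage could be empty before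
    the previous values are known to be compatible. *)
Lemma lifting_transfinite (S : map_class C) (X Y : C) (p : mor X Y) :
  (forall A B (i : mor A B), S _ _ i -> has_lifting i p) ->
  forall A B (i : mor A B), transfinite_composite S i -> has_lifting i p.
Proof.
move=> Sp A B i; case=> d I F L bot wo bot_le succ lim colim u v uv.
apply: (@transfinite_lift d I F L bot (well_order_wf wo) bot_le X Y p u v uv
  _ lim colim).
by move=> l j lj; apply: Sp; exact: succ.
Qed.

End Lifting.

(** * Well-orders on sets of cells *)

Section OrderedBy.
Variables (T : choiceType) (r : rel T).

Definition ordered_by of wochoice.well_order r := Choice.sort T.

Variable wo : wochoice.well_order r.

Let r_total : total r.
Proof.
move=> x y; have [|z [[zxy minz] _]] := @wo (fun t => (t == x) || (t == y)).
  by exists x; rewrite unfold_in eqxx.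
move: zxy; rewrite unfold_in => /orP[]/eqP zx; subst z.
  by rewrite minz // unfold_in eqxx orbT.
by rewrite (minz x) ?orbT // unfold_in eqxx.
Qed.

Let r_refl : reflexive r.
Proof. by move=> x; have := r_total x x; rewrite orbb. Qed.

Let r_anti : antisymmetric r.
Proof.
move=> x y /andP[rxy ryx].
have [|z [_ zU]] := @wo (fun t => (t == x) || (t == y)).
  by exists x; rewrite unfold_in eqxx.
rewrite -(zU x) ?(zU y) //; split; rewrite ?unfold_in ?eqxx ?orbT // => t;
  by rewrite unfold_in => /orP[]/eqP ->.
Qed.

Let r_trans : transitive r.
Proof.
move=> y x z rxy ryz.
have [|w [[wA minw] _]] := @wo (fun t => [|| t == x, t == y | t == z]).
  by exists x; rewrite unfold_in eqxx.
have [wx wy wz] : [/\ r w x, r w y & r w z].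
  by split; apply: minw; rewrite unfold_in eqxx ?orbT.
move: wA; rewrite unfold_in => /or3P[]/eqP e; subst w => //.
  by rewrite (r_anti (x := x) (y := y)) // rxy wx.
by rewrite (r_anti (x := y) (y := z)) ?ryz // in rxy.
Qed.

HB.instance Definition _ := Choice.on (ordered_by wo).
HB.instance Definition _ := Order.Le_isPOrder.Build (Order.Disp tt tt)
  (ordered_by wo) r_refl r_anti r_trans.
HB.instance Definition _ := Order.POrder_isTotal.Build (Order.Disp tt tt)
  (ordered_by wo) r_total.

Lemma ordered_by_wo : wochoice.well_order (<=%O : rel (ordered_by wo)).
Proof. exact: wo. Qed.

Lemma ordered_byE (x y : ordered_by wo) : (x <= y)%O = r x y.
Proof. by []. Qed.

End OrderedBy.

(** Cells are ordered by rank first, so that a cell comes after all the cells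
    of smaller rank; the added top element [None] stands for the stage at which
    all the cells have been attached. *)
Section RankedOrder.
Variables (A : choiceType) (rank : A -> nat).

Definition some_well_order : rel A :=
  projT1 (cid (ex_intro (fun r => wochoice.well_order r) _
    (svalP (wochoice.well_ordering_principle A)))).

Lemma some_well_orderP : wochoice.well_order some_well_order.
Proof. by rewrite /some_well_order; case: cid. Qed.

Definition ranked_le (o p : option A) : bool :=
  match o, p with
  | _, None => true
  | None, Some _ => false
  | Some a, Some b => (rank a < rank b)%N ||
      (rank a == rank b) && some_well_order a b
  end.

Lemma ranked_wo : wochoice.well_order ranked_le.
Proof.
have wo := some_well_orderP; have r_anti : antisymmetric some_well_order.
  by move=> a b ab; apply: (@le_anti _ (ordered_by wo)); exact: ab.
apply: wochoice.antisymmetric_well_order => [[a|] [b|] //=|B [b0 Bb0]].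
  move=> /andP[/orP[ab|/andP[/eqP ab rab]] /orP[ba|/andP[/eqP ba rba]]].
  - by move: (ltn_trans ab ba); rewrite ltnn.
  - by rewrite ba ltnn in ab.
  - by rewrite ab ltnn in ba.
  - by congr Some; apply: r_anti; rewrite rab.
have [someB|noneB] := pselect (exists a, Some a \in B); last first.
  exists b0; split=> // -[a aB|_]; first by case: noneB; exists a.
  by case: b0 Bb0.
have exm : exists m, `[< exists2 a, Some a \in B & rank a = m >].
  by case: someB => a aB; exists (rank a); apply/asboolP; exists a.
case: (ex_minnP exm) => m /asboolP[a0 a0B a0m] minm.
have [|a [[aBm mina] _]] := wo (fun a => (Some a \in B) && (rank a == m)).
  by exists a0; rewrite unfold_in a0B a0m eqxx.
move: aBm; rewrite unfold_in => /andP[aB /eqP am].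
exists (Some a); split=> // -[b bB|//] /=.
have /minm : `[< exists2 a, Some a \in B & rank a = rank b >].
  by apply/asboolP; exists b.
rewrite am leq_eqVlt => /orP[/eqP mb|->//]; rewrite mb ltnn eqxx /=.
by apply: mina; rewrite unfold_in bB mb eqxx.
Qed.

End RankedOrder.

(** * Spaces decomposed into cells are relative cell complexes *)

Section CellDecomposition.
Variables (R : realType) (k : space_kind) (X Z : Top k) (f : mor X Z).
Variables (A : choiceType) (rank dim : A -> nat).
Variable chi : forall a : A, disk R (dim a) -> sval Z.

Definition in_open_disk n (d : disk R n) : bool := sq_norm (\val d) < 1.

Lemma disk_cases n (d : disk R n) :
  in_open_disk d \/ exists s : sphere R n, d = sphere_incl s.
Proof.
have : sq_norm (\val d) <= 1 by exact: (set_valP d).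
rewrite le_eqVlt => /orP[/eqP d1|]; [right|by left].
by exists (exist _ (\val d) (mem_set (d1 : @sphere_set R n (\val d)))); exact: val_inj.
Qed.

Lemma sphere_not_open n (s : sphere R n) : in_open_disk (sphere_incl s) = false.
Proof. by rewrite /in_open_disk /= (set_valP s) ltxx. Qed.

(** A decomposition of [Z] into the image of [X] and the disjoint open cells
    [chi a], where the boundary of a cell lies in [X] and cells of smaller
    rank, and where [Z] has the topology determined by [X] and the closed
    cells. *)
Record cell_decomposition : Prop := CellDecomposition {
  cell_continuous : forall a, continuous (chi (a := a));
  cell_inj : injective (app f);
  cell_cover : forall z, (exists x, z = app f x) \/
    exists a d, in_open_disk d /\ z = chi (a := a) d;
  cell_base : forall a d x, in_open_disk d -> chi (a := a) d <> app f x;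
  cell_disjoint : forall a b d e, in_open_disk d -> in_open_disk e ->
    chi (a := a) d = chi (a := b) e ->
    existT (fun a => disk R (dim a)) a d = existT (fun a => disk R (dim a)) b e;
  cell_boundary : forall a s, (exists x, chi (a := a) (sphere_incl s) = app f x) \/
    exists b d, [/\ (rank b < rank a)%N, in_open_disk d &
                    chi (a := a) (sphere_incl s) = chi (a := b) d];
  cell_attach : forall a (B : set (sval Z)), closed (app f @^-1` B) ->
    (forall b, (rank b < rank a)%N -> closed (chi (a := b) @^-1` B)) ->
    closed ((fun s => chi (a := a) (sphere_incl s)) @^-1` B);
  cell_closed : forall B : set (sval Z), closed (app f @^-1` B) ->
    (forall a, closed (chi (a := a) @^-1` B)) -> closed B }.

Hypothesis D : cell_decomposition.

Let I := ordered_by (ranked_wo rank).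

Let cell_lt (a : A) (i : I) : bool := ((Some a : I) < i)%O.

Let cell_lt_top a : cell_lt a None.
Proof. by rewrite /cell_lt lt_neqAle ordered_byE. Qed.

Let rank_cell_lt a b : (rank a < rank b)%N -> cell_lt a (Some b).
Proof.
move=> ab; rewrite /cell_lt lt_neqAle ordered_byE /= ab andbT.
by apply/eqP => -[e]; rewrite e ltnn in ab.
Qed.

Definition stage (i : I) (z : sval Z) : Prop :=
  (exists x, z = app f x) \/
  exists a d, [/\ cell_lt a i, in_open_disk d & z = chi (a := a) d].

Lemma stage_base i x : stage i (app f x).
Proof. by left; exists x. Qed.

Lemma stage_cell i a d : cell_lt a i -> stage i (chi (a := a) d).
Proof.
move=> ai; have [od|[s ->]] := disk_cases d; first by right; exists a, d.
have [[x ->]|[b [e [ba oe ->]]]] := cell_boundary D s; first exact: stage_base.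
right; exists b, e; split=> //.
by apply: lt_trans ai; exact: rank_cell_lt.
Qed.

Lemma stage_le i j z : (i <= j)%O -> stage i z -> stage j z.
Proof.
move=> ij [[x ->]|[a [d [ai od ->]]]]; first exact: stage_base.
by apply: stage_cell; exact: lt_le_trans ai ij.
Qed.

Lemma stage_open_cell i a d :
  in_open_disk d -> stage i (chi (a := a) d) -> cell_lt a i.
Proof.
move=> od [[x /(cell_base D)]|[b [e [bi oe]]]]; first by move/(_ od).
by move=> /(cell_disjoint D od oe)/(congr1 (@projT1 _ _)) /= ->.
Qed.

Definition stage_points (i : I) : Type := {z : sval Z | stage i z}.

Inductive stage_tests (i : I) : tests (stage_points i) :=
| StageBase : @stage_tests i (sval X) (fun x => exist _ _ (stage_base i x))
| StageCell a (ai : cell_lt a i) :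
    @stage_tests i (disk R (dim a)) (fun d => exist _ _ (stage_cell d ai)).

Let stage_space (i : I) : topologicalType := final (@stage_tests i).

Lemma stage_val_continuous i : continuous (fun z : stage_space i => sval z).
Proof.
apply: final_continuous => K g [|a ai] /=; first exact: app_continuous.
exact: (cell_continuous D (a := a)).
Qed.

Lemma stage_is_space i : is_space k (stage_space i).
Proof.
apply: final_is_space => [K g [|a ai]|]; first exact: svalP.
  exact: compact_hausdorff_is_space (@disk_compact R _) (@disk_hausdorff R _).
apply: separated_inj (is_space_separated (svalP Z)) (@stage_val_continuous i) _.
by move=> z w; exact: sval_eq.
Qed.

Definition stage_ob (i : I) : Top k :=
  exist (is_space k) (stage_space i) (stage_is_space i).

Let stage_incl i j (ij : (i <= j)%O) (z : stage_space i) : stage_space j :=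
  exist _ (sval z) (stage_le ij (svalP z)).

Lemma stage_incl_continuous i j (ij : (i <= j)%O) :
  continuous (stage_incl ij).
Proof.
apply: final_continuous => K g [|a ai].
  apply: continuous_eqfun (final_test (StageBase j)) => x; exact: sval_eq.
have aj : cell_lt a j by exact: lt_le_trans ai ij.
by apply: continuous_eqfun (final_test (StageCell aj)) => d; exact: sval_eq.
Qed.

Definition stage_mor i j (ij : (i <= j)%O) : mor (stage_ob i) (stage_ob j) :=
  @mk_mor k (stage_ob i) (stage_ob j) _ (@stage_incl_continuous i j ij).

Lemma stage_mor_id i (ii : (i <= i)%O) : stage_mor ii = idm (stage_ob i).
Proof. by apply: mor_eq => z; exact: sval_eq. Qed.

Lemma stage_mor_comp i j l (jl : (j <= l)%O) (ij : (i <= j)%O)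
    (il : (i <= l)%O) : stage_mor il = stage_mor jl ∘ stage_mor ij.
Proof. by apply: mor_eq => z; exact: sval_eq. Qed.

Definition stage_functor : functor (poset_category I) (Top k) :=
  @Functor (poset_category I) (Top k) stage_ob stage_mor
    (fun i => stage_mor_id _) (fun i j l jl ij => stage_mor_comp jl ij _).

Let le_top (i : I) : (i <= (None : I))%O.
Proof. by rewrite ordered_byE; case: i. Qed.

Definition stage_cocone : cocone stage_functor :=
  @Cocone (poset_category I) (Top k) stage_functor (stage_ob None)
    (fun i => stage_mor (le_top i))
    (fun i j ij => esym (stage_mor_comp (le_top j) ij (le_top i))).

Lemma stage_cocone_colimit : is_colimit stage_cocone.
Proof.
move=> K; exists (cocone_leg K (None : I)); split=> [i|h hK].
  exact: (@cocone_natural _ _ _ K i (None : I) (le_top i)).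
rewrite -[LHS](hK (None : I)); apply: mor_eq => z.
by rewrite app_comp; congr (app h _); exact: sval_eq.
Qed.

Lemma stage_limit_colimit (i : I) :
  limit_element i -> is_colimit (initial_segment_cocone stage_functor i).
Proof.
move=> [[j0 j0i] ncov] K.
have nextP (j : I) : (j < i)%O -> exists l, (j < l < i)%O.
  move=> ji; apply: contrapT => nl; apply: (ncov j); split=> // l jli.
  by apply: nl; exists l.
pose leg (j : I) (ji : (j < i)%O) : mor (stage_ob j) (cocone_ob K) :=
  cocone_leg K (exist (@below _ I i) j ji).
have leg_nat (j l : I) (ji : (j < i)%O) (li : (l < i)%O) (jl : (j <= l)%O) z :
    app (leg l li) (stage_incl jl z) = app (leg j ji) z.
  exact: (app_eq (@cocone_natural _ _ _ K (exist (@below _ I i) j ji)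
    (exist (@below _ I i) l li) jl) z).
have cover_ (z : stage_space i) : exists j, (j < i)%O /\ stage j (sval z).
  have [[x ->]|[a [d [ai od ->]]]] := svalP z.
    by exists j0; split=> //; exact: stage_base.
  by have [l /andP[al li]] := nextP _ ai; exists l; split=> //; exact: stage_cell.
pose ix z := projT1 (cid (cover_ z)).
have ixP z : (ix z < i)%O /\ stage (ix z) (sval z) by rewrite /ix; case: cid.
pose h (z : stage_space i) : sval (cocone_ob K) :=
  app (leg (ix z) (ixP z).1) (exist _ (sval z) (ixP z).2).
have hE z zi j (ji : (j < i)%O) (zj : stage j z) :
    h (exist _ z zi) = app (leg j ji) (exist _ z zj).
  rewrite /h /=; set w := exist _ z zi; have wP := ixP w.
  have [jl|/ltW lj] := leP j (ix w).
    by rewrite -(leg_nat j (ix w) ji (ixP w).1 jl); congr (app _ _); exact: sval_eq.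
  by rewrite -(leg_nat (ix w) j (ixP w).1 ji lj); congr (app _ _); exact: sval_eq.
have ch : continuous h.
  apply: final_continuous => L g [|a ai].
    apply: continuous_eqfun (continuous_comp_fun (final_test (StageBase j0))
      (app_continuous (leg j0 j0i))) => x.
    by rewrite /= (hE _ _ _ j0i (stage_base j0 x)).
  have [l /andP[al li]] := nextP _ ai.
  apply: continuous_eqfun (continuous_comp_fun (final_test (StageCell al))
    (app_continuous (leg l li))) => d.
  by rewrite /= (hE _ _ _ li (stage_cell d al)).
exists (@mk_mor k (stage_ob i) (cocone_ob K) h ch); split=> [[j ji]|h' h'K].
  by apply: mor_eq => -[z zj]; rewrite app_comp app_mk; exact: hE.
apply: mor_eq => -[z zi]; rewrite app_mk.
set w : stage_space i := exist _ z zi.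
rewrite (hE _ _ _ (ixP w).1 (ixP w).2).
have := h'K (exist (@below _ I i) (ix w) (ixP w).1) => /app_eq.
move=> /(_ (exist (stage (ix w)) z (ixP w).2)) <-.
by rewrite app_comp; congr (app _ _); exact: sval_eq.
Qed.

Lemma stage_covers_attaches i j (ij : covers i j) :
  attaches_cell R (stage_mor (ltW ij.1)).
Proof.
have [a ia] : exists a, i = Some a.
  by case: i ij => [a|] [+ _]; [exists a | rewrite ltNge le_top].
subst i; have [aj gap] := ij.
have lt_or b : cell_lt b j -> cell_lt b (Some a) \/ b = a.
  move=> bj; have [|ab|e] := ltgtP (Some b : I) (Some a); first by left.
    by case: (gap (Some b)); rewrite ab.
  by right; case: e.
have attP s : stage (Some a) (chi (a := a) (sphere_incl s)).
  have [[x ->]|[b [e [ba oe ->]]]] := cell_boundary D s.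
    exact: stage_base.
  by apply: stage_cell; exact: rank_cell_lt.
pose phi (s : sphere R (dim a)) : stage_space (Some a) := exist _ _ (attP s).
have cphi : continuous phi.
  apply/continuous_closedP => C /final_closedE cC.
  pose B := [set z | exists za : stage (Some a) z, C (exist _ z za)].
  have BE z (za : stage (Some a) z) : B z <-> C (exist _ z za).
    split=> [[za']|]; last by exists za.
    by congr C; exact: sval_eq.
  have := @cell_attach D a B.
  rewrite (_ : _ @^-1` B = phi @^-1` C); last first.
    by apply/seteqP; split=> s /= /(BE _ (attP s)).
  apply.
    rewrite (_ : _ @^-1` B = (fun x => exist _ _ (stage_base (Some a) x)) @^-1` C).
      exact: cC (StageBase (Some a)).
    by apply/seteqP; split=> x /= /(BE _ (stage_base _ x)).
  move=> b /rank_cell_lt ba.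
  rewrite (_ : _ @^-1` B = (fun d => exist _ _ (stage_cell d ba)) @^-1` C).
    exact: cC (StageCell ba).
  by apply/seteqP; split=> d /= /(BE _ (stage_cell d ba)).
pose chi' (d : disk R (dim a)) : stage_space j := exist _ _ (stage_cell d aj).
have cchi' : continuous chi' := final_test (StageCell aj).
exists (dim a), (@mk_mor k (top_sphere R k _) (stage_ob (Some a)) phi cphi),
  (@mk_mor k (top_disk R k _) (stage_ob j) chi' cchi').
split=> [|T b x bx]; first by apply: mor_eq => s; exact: sval_eq.
have cellP (z : stage_space j) : ~ stage (Some a) (sval z) ->
    exists d, in_open_disk d /\ sval z = chi (a := a) d.
  have [[y ->]|[c [d [cj od ->]]]] := svalP z; first by case; exact: stage_base.
  by have [ca|ca] := lt_or _ cj; [case; exact: stage_cell | subst c; exists d].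
pose h (z : stage_space j) : sval T :=
  match pselect (stage (Some a) (sval z)) with
  | left za => app x (exist _ (sval z) za)
  | right za => app b (projT1 (cid (cellP z za)))
  end.
have h_old z (zj : stage j z) (za : stage (Some a) z) :
    h (exist _ z zj) = app x (exist _ z za).
  by rewrite /h; case: pselect => //= za'; congr (app x _); exact: sval_eq.
have h_new d : h (chi' d) = app b d.
  have [od|[s ->]] := disk_cases d.
    rewrite /h; case: pselect => [/= za|za].
      by have := stage_open_cell od za; rewrite /cell_lt ltxx.
    case: cid => e /= [oe] /(cell_disjoint D od oe) de; congr (app b _).
    by apply: esym; exact: (eq_from_Tagged (T_ := fun a => disk R (dim a)) de).
  rewrite (h_old _ _ (attP s)); exact: esym (app_eq bx s).
have ch : continuous h.
  apply: final_continuous => K g [|c cj].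
    apply: continuous_eqfun (continuous_comp_fun
      (final_test (StageBase (Some a))) (app_continuous x)) => y.
    by rewrite /= (h_old _ _ (stage_base _ y)).
  have [ca|ca] := lt_or _ cj.
    apply: continuous_eqfun (continuous_comp_fun
      (final_test (StageCell ca)) (app_continuous x)) => d.
    by rewrite /= (h_old _ _ (stage_cell d ca)).
  subst c; apply: continuous_eqfun (app_continuous b) => d.
  by rewrite -h_new; congr h; exact: sval_eq.
exists (@mk_mor k (stage_ob j) T h ch); split.
  split; first by apply: mor_eq => d; exact: h_new.
  by apply: mor_eq => -[z za]; exact: h_old.
move=> h' [h'b h'x]; apply: mor_eq => z; rewrite app_mk.
have [za|za] := pselect (stage (Some a) (sval z)).
  case: z za => z zj /= za; rewrite (h_old _ _ za) -(app_eq h'x).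
  by rewrite app_comp; congr (app h' _); exact: sval_eq.
have [d [od zd]] := cellP z za.
have -> : z = chi' d by exact: sval_eq.
by rewrite h_new -(app_eq h'b).
Qed.

Lemma least_stage : exists bot : I, forall i, (bot <= i)%O.
Proof.
have [|bot [[_ botP] _]] := @ordered_by_wo _ _ (ranked_wo rank) (fun=> true).
  by exists None.
by exists bot => i; exact: botP.
Qed.

(** The cells are attached one at a time along a well-order refining the rank.
    A stage is the subset of [Z] covered so far, with the final topology for
    the cells attached so far; the first and the last stage are isomorphic to
    [X] and [Z], which makes [f] a retract of a transfinite composite, as this
    composite starts at the first stage itself and not at [X]. *)
Lemma cell_decomposition_retract : exists (B E : Top k) (j : mor B E),
  relative_cell_complex R j /\ retract_of f j.
Proof.
have [bot bot_le] := least_stage.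
have bot_cell a : ~ cell_lt a bot by rewrite /cell_lt ltNge bot_le.
have bot_base (z : stage_space bot) : exists x, sval z = app f x.
  by have [[x ->]|[a [d [/bot_cell]]]] := svalP z; first by exists x.
exists (stage_ob bot), (stage_ob None), (stage_mor (le_top bot)); split.
  apply: (@TransfiniteComposite _ _ _ I stage_functor stage_cocone bot).
  - exact: ordered_by_wo.
  - exact: bot_le.
  - exact: stage_covers_attaches.
  - exact: stage_limit_colimit.
  - exact: stage_cocone_colimit.
pose s (x : sval X) : stage_space bot := exist _ _ (stage_base bot x).
pose r (z : stage_space bot) : sval X := projT1 (cid (bot_base z)).
have rE x (xs : stage bot (app f x)) : r (exist _ _ xs) = x.
  by rewrite /r; case: cid => y /= /(cell_inj D).
have cr : continuous r.
  apply: final_continuous => K g [|a /bot_cell //].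
  by apply: continuous_eqfun (@continuous_idfun _) => x; rewrite /= rE.
have top_all z : stage None z.
  have [[x ->]|[a [d [od ->]]]] := cell_cover D z; first exact: stage_base.
  by apply: stage_cell; exact: cell_lt_top.
pose t (z : sval Z) : stage_space None := exist _ z (top_all z).
have ct : continuous t.
  apply/continuous_closedP => C /final_closedE cC; apply: (cell_closed D).
    rewrite (_ : _ @^-1` _ = (fun x => exist _ _ (stage_base None x)) @^-1` C).
      exact: cC (StageBase None).
    by apply/funext => x /=; congr C; exact: sval_eq.
  move=> a; rewrite (_ : _ @^-1` _ =
      (fun d => exist _ _ (stage_cell d (cell_lt_top a))) @^-1` C).
    exact: cC (StageCell (cell_lt_top a)).
  by apply/funext => d /=; congr C; exact: sval_eq.
exists (@mk_mor k X (stage_ob bot) s (final_test (StageBase bot))),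
  (@mk_mor k (stage_ob bot) X r cr), (@mk_mor k Z (stage_ob None) t ct),
  (@mk_mor k (stage_ob None) Z _ (@stage_val_continuous None)); split.
- by apply: mor_eq => x; exact: rE.
- exact: mor_eq.
- by apply: mor_eq => x; exact: sval_eq.
- apply: mor_eq => z; rewrite !app_comp !app_mk.
  by have [x zx] := bot_base z; case: z zx => z zs /= zx; subst z; rewrite rE.
Qed.

End CellDecomposition.

(** * Attaching all cells at once *)

Lemma closed_map_compact (K T : topologicalType) (g : K -> T) (C : set K) :
  compact [set: K] -> hausdorff_space T -> continuous g -> closed C ->
  closed (g @` C).
Proof.
move=> cK hT cg cC; apply: compact_closed => //.
apply: continuous_compact; first exact: continuous_subspaceT.
exact: (subclosed_compact cC cK).
Qed.

Lemma hausdorff_closed1 (T : topologicalType) (x : T) :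
  hausdorff_space T -> closed [set x].
Proof. by move=> hT; apply: accessible_closed_set1; exact: hausdorff_accessible. Qed.

Lemma closed_subset1 (T : topologicalType) (A : set T) :
  hausdorff_space T -> (forall x y, A x -> A y -> x = y) -> closed A.
Proof.
move=> hT A1; have [[x Ax]|noA] := pselect (exists x, A x).
  rewrite (_ : A = [set x]); first exact: hausdorff_closed1.
  by apply/seteqP; split=> [y Ay|y ->] //; exact: A1.
rewrite (_ : A = set0); first exact: closed0.
by apply/seteqP; split=> // x Ax; case: noA; exists x.
Qed.

(** Compactness of a space mapped into [Z] replaces the diagonal criterion for
    weak Hausdorff spaces: it suffices that [Z] has the final topology for
    closed maps out of compact Hausdorff spaces. *)
Lemma weak_hausdorff_by_tests (Z : topologicalType) (t : tests Z) :
  (forall A : set Z, (forall (K : topologicalType) (g : K -> Z),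
     @t K g -> closed (g @^-1` A)) -> closed A) ->
  (forall (K : topologicalType) (g : K -> Z), @t K g ->
     [/\ compact [set: K], hausdorff_space K, continuous g &
         forall C, closed C -> closed (g @` C)]) ->
  (forall z : Z, closed [set z]) -> weak_hausdorff Z.
Proof.
move=> tclosed tmap Z1 L u cL hL cu; apply: tclosed => K g tg.
have [cK hK cg clg] := tmap K g tg.
rewrite -openC openE => d ud; have /compact_near_coveringP nL := cL.
suff : \forall e \near d, [set: L] `<=` [set l | u l <> g e].
  by apply: filterS => e + [l _ le]; move=> /(_ l I).
apply: nL => l _; have uld : u l <> g d by move=> ld; apply: ud; exists l.
have : nbhs d (g @^-1` ~` [set u l]).
  apply: open_nbhs_nbhs; split; last by move=> dl; apply: uld.
  rewrite -preimage_setC openC; move/continuous_closedP: cg; exact.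
have := @compact_regular K d setT hK cK filterT => /[apply] -[N nN Nul].
exists (u @^-1` ~` (g @` closure N), N).
  split=> //=; apply: open_nbhs_nbhs; split.
    rewrite -preimage_setC openC; move/continuous_closedP: cu; apply.
    by apply: clg; exact: closed_closure.
  by move=> [e /Nul].
move=> [l' e] /= [gl' Ne] le; apply: gl'; exists e; last by rewrite le.
exact: subset_closure.
Qed.

Section RadialProjection.
Variables (R : realType) (n : nat).

Lemma sphere_of_subproof (d : disk R n) :
  ~ in_open_disk d -> sphere_set (\val d).
Proof. by have [od []//|[s ->] _] := disk_cases d; exact: (set_valP s). Qed.

Definition sphere_of (d : disk R n) (nd : ~ in_open_disk d) : sphere R n :=
  exist _ (\val d) (mem_set (sphere_of_subproof nd)).

Lemma sphere_of_incl (s : sphere R n) (ns : ~ in_open_disk (sphere_incl s)) :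
  sphere_of ns = s.
Proof. exact: val_inj. Qed.

Lemma sphere_incl_closed_map (C : set (sphere R n)) :
  closed C -> closed (@sphere_incl R n @` C).
Proof.
apply: closed_map_compact; first exact: sphere_compact.
  exact: disk_hausdorff.
exact: sphere_incl_continuous.
Qed.

(** Open subsets of the boundary are thickened to open subsets of the disk in
    such a way that disjoint sets stay disjoint. *)
Definition radial_cone (V : set (sphere R n)) : set (disk R n) :=
  [set d | 0 < sq_norm (\val d) /\
     exists2 s, V s & \val s = (Num.sqrt (sq_norm (\val d)))^-1 *: \val d].

Lemma radial_cone_open (V : set (sphere R n)) :
  open V -> open (radial_cone V).
Proof.
move=> [W oW <-]; pose f (x : 'rV[R]_n) := (Num.sqrt (sq_norm x))^-1 *: x.
rewrite (_ : radial_cone _ = (fun d : disk R n => \val d) @^-1`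
    [set x | 0 < sq_norm x /\ W (f x)]).
  rewrite openE => d [d0 Wd]; apply: (@set_val_continuous _ _ d).
  have cfd : {for (\val d), continuous f}.
    apply: (@continuousZ _ _ _ (fun x => (Num.sqrt (sq_norm x))^-1) id).
      apply: (@continuous_comp _ _ _ (fun x => Num.sqrt (sq_norm x)) GRing.inv).
        apply: (@continuous_comp _ _ _ (@sq_norm R n) Num.sqrt).
          exact: sq_norm_continuous.
        exact: sqrt_continuous.
      by apply: inv_continuous; rewrite gt_eqF // sqrtr_gt0.
    exact: cvg_id.
  have pos : \forall x \near (\val d : 'rV[R]_n), 0 < sq_norm x.
    exact: (@sq_norm_continuous R n (\val d) [set y | 0 < y] (lt_nbhsr d0)).
  have fW : \forall x \near (\val d : 'rV[R]_n), W (f x).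
    by apply: cfd; exact: open_nbhs_nbhs.
  by move: pos fW; apply: filterS2.
apply/seteqP; split=> d [d0].
  by move=> [s Ws sd]; split=> //; rewrite /f -sd.
move=> Wd; split=> //; have fd : sphere_set (f (\val d)).
  rewrite /sphere_set /= /sq_norm; under eq_bigr do rewrite mxE exprMn.
  rewrite -mulr_sumr -/(sq_norm _) exprVn sqr_sqrtr ?ltW // mulVf //.
  by rewrite gt_eqF.
by pose s : sphere R n := exist _ (f (\val d)) (mem_set fd); exists s.
Qed.

Lemma radial_cone_sphere (V : set (sphere R n)) s :
  radial_cone V (sphere_incl s) <-> V s.
Proof.
have s1 : sq_norm (\val s) = 1 by exact: (set_valP s).
rewrite /radial_cone /= s1 sqrtr1 invr1 scale1r; split=> [[_ [t Vt ts]]|Vs].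
  by have -> : s = t by exact: val_inj.
by split=> //; exists s.
Qed.

Lemma radial_cone_disjoint (V W : set (sphere R n)) :
  V `&` W = set0 -> radial_cone V `&` radial_cone W = set0.
Proof.
move=> VW; apply/seteqP; split=> // d [[_ [s Vs sd]] [_ [t Wt td]]].
have st : s = t by apply: val_inj; rewrite sd td.
by subst t; have : (V `&` W) s by []; rewrite VW.
Qed.

End RadialProjection.

Lemma existT_inj (T : Type) (P : T -> Type) x (a b : P x) :
  existT P x a = existT P x b -> a = b.
Proof. exact: (@existT_inj2 {classic T} P x a b). Qed.

Record over (Y : topologicalType) := Over {
  total : topologicalType;
  proj : continuousType total Y }.

Section AttachCells.
Variables (R : realType) (Y : topologicalType) (E : over Y).

Definition square n : Type :=
  {uv : continuousType (sphere R n) (total E) * continuousType (disk R n) Y |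
    forall s, proj E (uv.1 s) = uv.2 (sphere_incl s)}.

Definition cell : Type := {n : nat & square n}.

Definition cell_dim (c : cell) : nat := projT1 c.
Definition cell_top (c : cell) : sphere R (cell_dim c) -> total E :=
  (sval (projT2 c)).1.
Definition cell_bottom (c : cell) : disk R (cell_dim c) -> Y :=
  (sval (projT2 c)).2.

Definition open_disk n : Type := {d : disk R n | in_open_disk d}.

Definition attach_points : Type :=
  (total E + {c : cell & open_disk (cell_dim c)})%type.

Definition cell_map (c : cell) (d : disk R (cell_dim c)) : attach_points :=
  match pselect (in_open_disk d) with
  | left od => inr (existT _ c (exist _ d od))
  | right nd => inl (cell_top (sphere_of nd))
  end.

Lemma cell_map_open c d (od : in_open_disk d) :
  cell_map (c := c) d = inr (existT _ c (exist _ d od)).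
Proof.
rewrite /cell_map; case: pselect => [od'|//].
by rewrite (bool_irrelevance od' od).
Qed.

Lemma cell_map_inj c d e : in_open_disk d -> in_open_disk e ->
  cell_map (c := c) d = cell_map e -> d = e.
Proof.
move=> od oe; rewrite (cell_map_open od) (cell_map_open oe); case=> de.
exact: (existT_inj de).
Qed.

Lemma cell_map_sphere c s :
  cell_map (c := c) (sphere_incl s) = inl (cell_top s).
Proof.
rewrite /cell_map; case: pselect => [os|ns]; last by rewrite sphere_of_incl.
by have := sphere_not_open s; rewrite os.
Qed.

Lemma cell_top_continuous c : continuous (@cell_top c).
Proof. exact: cts_fun. Qed.

Lemma cell_bottom_continuous c : continuous (@cell_bottom c).
Proof. exact: cts_fun. Qed.

Lemma cell_square c s : proj E (cell_top s) = cell_bottom (c := c) (sphere_incl s).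
Proof. exact: (svalP (projT2 c)). Qed.

Inductive attach_tests : tests attach_points :=
| AttachBase : @attach_tests (total E) inl
| AttachCell c : @attach_tests (disk R (cell_dim c)) (@cell_map c).

Definition attach_space : topologicalType := final attach_tests.

Definition attach_proj (z : attach_space) : Y :=
  match z with
  | inl x => proj E x
  | inr p => cell_bottom (sval (projT2 p))
  end.

Lemma attach_proj_cell c d : attach_proj (cell_map (c := c) d) = cell_bottom d.
Proof.
have [od|[s ->]] := disk_cases d; first by rewrite cell_map_open.
by rewrite cell_map_sphere /= cell_square.
Qed.

Lemma attach_proj_continuous : continuous attach_proj.
Proof.
apply: final_continuous => K g [|c]; first exact: cts_fun.
apply: continuous_eqfun (@cell_bottom_continuous c) => d.
by rewrite /= attach_proj_cell.
Qed.

Definition attach : over Y := @Over Y attach_space (mkcts attach_proj_continuous).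

Lemma attach_base_continuous : continuous (inl : total E -> attach_space).
Proof. exact: final_test AttachBase. Qed.

Lemma cell_map_continuous c : continuous (@cell_map c : _ -> attach_space).
Proof. exact: final_test (AttachCell c). Qed.

Lemma attach_base_closed_map (C : set (total E)) :
  closed C -> closed ((inl : total E -> attach_space) @` C).
Proof.
move=> cC; apply/final_closedE => K g [|c].
  rewrite (_ : _ @^-1` _ = C) //; apply/seteqP; split=> x /=; last by exists x.
  by move=> [y Cy [<-]].
rewrite (_ : _ @^-1` _ = @sphere_incl R _ @` (@cell_top c @^-1` C)).
  apply: sphere_incl_closed_map.
  by move/continuous_closedP: (@cell_top_continuous c); exact.
apply/seteqP; split=> [d|_ [s Cs <-]] /=; last first.
  by exists (cell_top s); rewrite ?cell_map_sphere.
have [od|[s ->]] := disk_cases d; first by rewrite cell_map_open => -[].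
by rewrite cell_map_sphere => -[x Cx [xs]]; exists s => //=; rewrite -xs.
Qed.

Lemma attach_cell_closed1 p : closed [set (inr p : attach_space)].
Proof.
apply/final_closedE => K g [|c].
  by rewrite (_ : _ @^-1` _ = set0); [exact: closed0 | apply/seteqP; split].
apply: closed_subset1; first exact: disk_hausdorff.
move=> d e /=.
have [od|[s ->]] := disk_cases d; last by rewrite cell_map_sphere.
have [oe|[s ->]] := disk_cases e; last by rewrite cell_map_sphere.
by move=> dp ep; apply: cell_map_inj => //; rewrite dp ep.
Qed.

Lemma attach_closed1 z :
  (forall x : total E, closed [set x]) -> closed [set z : attach_space].
Proof.
move=> E1; case: z => [x|p]; last exact: attach_cell_closed1.
rewrite (_ : [set _] = (inl : _ -> attach_space) @` [set x]).
  exact/attach_base_closed_map/E1.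
by apply/seteqP; split=> [_ ->|_ [_ -> <-]] //=; exists x.
Qed.

(** If [total E] is weak Hausdorff, the image under a cell of a closed set [C]
    meets [total E] in the image of a compact set, which is closed. *)
Lemma cell_map_closed_map c (C : set (disk R (cell_dim c))) :
  weak_hausdorff (total E) -> closed C ->
  closed ((@cell_map c : _ -> attach_space) @` C).
Proof.
move=> wE cC; pose S := @sphere_incl R (cell_dim c) @^-1` C.
have cS : closed S.
  by move/continuous_closedP: (@sphere_incl_continuous R (cell_dim c)); exact.
have cT : closed (@cell_top c @` S).
  apply: weak_hausdorff_image cS => //; first exact: sphere_compact.
    exact: sphere_hausdorff.
  exact: cell_top_continuous.
apply/final_closedE => K g [|b].
  rewrite (_ : _ @^-1` _ = @cell_top c @` S) //.
  apply/seteqP; split=> x /= [].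
    move=> d Cd; have [od|[s ds]] := disk_cases d.
      by rewrite cell_map_open.
    by rewrite ds cell_map_sphere => -[<-]; exists s => //; rewrite /S /= -ds.
  by move=> s Ss <-; exists (sphere_incl s) => //; rewrite cell_map_sphere.
have cb : closed (@sphere_incl R _ @` (@cell_top b @^-1` (@cell_top c @` S))).
  apply: sphere_incl_closed_map.
  by move/continuous_closedP: (@cell_top_continuous b); exact.
have [bc|bc] := pselect (b = c).
  subst b; rewrite (_ : _ @^-1` _ =
    C `|` @sphere_incl R _ @` (@cell_top c @^-1` (@cell_top c @` S))).
    exact: closedU.
  apply/seteqP; split=> d /=; last first.
    move=> [Cd|[s [t St ts] <-]]; first by exists d.
    by exists (sphere_incl t) => //; rewrite !cell_map_sphere ts.
  move=> [e Ce]; have [od|[s ->]] := disk_cases d.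
    have [oe|[t ->]] := disk_cases e; last first.
      by rewrite (cell_map_open od) cell_map_sphere.
    by move/(cell_map_inj oe od) <-; left.
  rewrite cell_map_sphere; have [oe|[t te]] := disk_cases e.
    by rewrite (cell_map_open oe).
  rewrite te cell_map_sphere => -[ts]; right; exists s => //=; exists t => //.
  by rewrite /S /= -te.
rewrite (_ : _ @^-1` _ =
  @sphere_incl R _ @` (@cell_top b @^-1` (@cell_top c @` S))) //.
apply/seteqP; split=> d /=.
  move=> [e Ce]; have [od|[s ->]] := disk_cases d.
    rewrite (cell_map_open od); have [oe|[t ->]] := disk_cases e.
      by rewrite (cell_map_open oe) => -[cb']; case: bc.
    by rewrite cell_map_sphere.
  rewrite cell_map_sphere; have [oe|[t te]] := disk_cases e.
    by rewrite (cell_map_open oe).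
  rewrite te cell_map_sphere => -[ts]; exists s => //=; exists t => //.
  by rewrite /S /= -te.
move=> [s [t St ts] <-]; exists (sphere_incl t) => //.
by rewrite !cell_map_sphere ts.
Qed.

Inductive compact_tests : tests attach_space :=
| CompactBase (K : topologicalType) (g : K -> total E) :
    compact [set: K] -> hausdorff_space K -> continuous g ->
    @compact_tests K (fun x => inl (g x))
| CompactCell c : @compact_tests (disk R (cell_dim c)) (@cell_map c).

Lemma attach_weak_hausdorff :
  compactly_generated (total E) -> weak_hausdorff (total E) ->
  weak_hausdorff attach_space.
Proof.
move=> cgE wE; apply: (@weak_hausdorff_by_tests _ compact_tests).
- move=> A tA; apply/final_closedE => K g [|c]; last exact: (tA _ _ (CompactCell c)).
  apply: cgE => L u cL hL cu; exact: (tA _ _ (CompactBase cL hL cu)).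
- move=> K g [L u cL hL cu|c]; split=> //.
  + exact: continuous_comp_fun cu attach_base_continuous.
  + move=> C cC; rewrite (_ : _ @` _ = (inl : _ -> attach_space) @` (u @` C)).
      exact/attach_base_closed_map/weak_hausdorff_image.
    by rewrite image_comp.
  + exact: disk_compact.
  + exact: disk_hausdorff.
  + exact: cell_map_continuous.
  + by move=> C; exact: cell_map_closed_map.
- by move=> z; apply: attach_closed1 => x; exact: weak_hausdorff_closed1.
Qed.

Definition radial_extension (U : set (total E)) : set attach_space :=
  [set z | match z with
           | inl x => U x
           | inr p => radial_cone (@cell_top (projT1 p) @^-1` U) (sval (projT2 p))
           end].

Lemma radial_extension_cell U c :
  @cell_map c @^-1` radial_extension U = radial_cone (@cell_top c @^-1` U).
Proof.
apply/seteqP; split=> d /=; have [od|[s ->]] := disk_cases d.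
- by rewrite cell_map_open.
- by rewrite cell_map_sphere => Us; apply/radial_cone_sphere.
- by rewrite cell_map_open.
- by rewrite cell_map_sphere => /radial_cone_sphere.
Qed.

Lemma radial_extension_open U : open U -> open (radial_extension U).
Proof.
move=> oU; apply/final_openE => K g [|c]; first exact: oU.
rewrite radial_extension_cell; apply: radial_cone_open.
by move/continuousP: (@cell_top_continuous c); exact.
Qed.

Lemma radial_extension_disjoint U V :
  U `&` V = set0 -> radial_extension U `&` radial_extension V = set0.
Proof.
move=> UV; apply/seteqP; split=> // -[x|[c d]] /= [Ux Vx].
  by have : (U `&` V) x by []; rewrite UV.
have := @radial_cone_disjoint R _ (@cell_top c @^-1` U) (@cell_top c @^-1` V).
rewrite -preimage_setI UV preimage_set0 => /(_ erefl) e.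
by have : set0 (sval d) by rewrite -e.
Qed.

(** A function on one disk that vanishes on its boundary extends by zero. *)
Lemma extend_by_zero c (W : topologicalType) (w0 : W)
    (psi : disk R (cell_dim c) -> W) :
  continuous psi -> (forall s, psi (sphere_incl s) = w0) ->
  exists g : attach_space -> W, [/\ continuous g,
    forall d, g (cell_map d) = psi d & forall z,
    ~ (exists2 d : disk R (cell_dim c), in_open_disk d & z = cell_map d) -> g z = w0].
Proof.
move=> cpsi psi0; pose g (z : attach_space) : W :=
  if pselect (exists2 d : disk R (cell_dim c), in_open_disk d & z = cell_map d) is left e
  then psi (projT1 (cid2 e)) else w0.
have g0 z : ~ (exists2 d : disk R (cell_dim c), in_open_disk d & z = cell_map d) -> g z = w0.
  by rewrite /g; case: pselect.
have gE d : g (cell_map d) = psi d.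
  have [od|[s ->]] := disk_cases d.
    rewrite /g; case: pselect => [e|]; last by case; exists d.
    by case: cid2 => /= e' oe' /(cell_map_inj od oe') ->.
  rewrite psi0 g0 // => -[e oe]; rewrite (cell_map_open oe).
  by rewrite cell_map_sphere.
exists g; split=> //; apply: final_continuous => K h [|b].
  apply: continuous_eqfun (@cst_continuous _ _ w0) => x /=.
  by rewrite g0 // => -[d od]; rewrite (cell_map_open od).
have [bc|bc] := pselect (b = c).
  by subst b; apply: continuous_eqfun cpsi => d; rewrite /= gE.
apply: continuous_eqfun (@cst_continuous _ _ w0) => d /=.
rewrite g0 // => -[e oe]; rewrite (cell_map_open oe).
have [od|[s ->]] := disk_cases d; last by rewrite cell_map_sphere.
by rewrite cell_map_open => -[bc' _]; apply: bc.
Qed.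

Lemma attach_hausdorff : hausdorff_space (total E) -> hausdorff_space attach_space.
Proof.
move=> hE.
(* Distinct points, one of them in an open cell, are separated by the function
   which is a coordinate scaled to vanish on the boundary. *)
have cell_sep p (w : attach_space) : (inr p : attach_space) <> w ->
    exists g : attach_space -> (R * R)%type, continuous g /\ g (inr p) <> g w.
  case: p => c [d od]; rewrite -(cell_map_open od) => pw.
  pose nu (e : disk R (cell_dim c)) : R := 1 - sq_norm (\val e).
  have cnu : continuous nu.
    move=> e; apply: (@continuousB R R^o _ (cst 1)
      (fun e : disk R (cell_dim c) => sq_norm (\val e))).
      exact: cst_continuous.
    apply: (@continuous_comp _ _ _ (fun e : disk R _ => \val e) (@sq_norm R _)).
      exact: set_val_continuous.
    exact: sq_norm_continuous.
  have nu_sphere s : nu (sphere_incl s) = 0.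
    by rewrite /nu /= (set_valP s) subrr.
  have nud : nu d != 0 by rewrite subr_eq0 gt_eqF.
  pose psi i (e : disk R (cell_dim c)) : (R * R)%type :=
    (nu e, nu e * (\val e : 'rV[R]_(cell_dim c)) ord0 i).
  have cpsi i : continuous (psi i).
    apply: pair_continuous; first exact: cnu.
    move=> e; apply: (@continuousM R _ nu
      (fun e : disk R (cell_dim c) => (\val e : 'rV[R]_(cell_dim c)) ord0 i)).
      exact: cnu.
    apply: (@continuous_comp _ _ _ (fun e : disk R _ => \val e)
      (fun M : 'rV[R]_(cell_dim c) => M ord0 i)).
      exact: set_val_continuous.
    exact: coord_continuous.
  have psi0 i s : psi i (sphere_incl s) = (0, 0).
    by rewrite /psi nu_sphere mul0r.
  have cnu0 : continuous (fun e => (nu e, 0) : (R * R)%type).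
    by apply: pair_continuous => //; exact: cst_continuous.
  have [[e oe we]|nw] := pselect (exists2 e : disk R (cell_dim c), in_open_disk e & w = cell_map e).
    have de : d <> e by move=> de; apply: pw; rewrite we de.
    have [i dei] : exists i, (\val d : 'rV[R]_(cell_dim c)) ord0 i <>
        (\val e : 'rV[R]_(cell_dim c)) ord0 i.
      apply: contra_notP de => de; apply: val_inj; apply/rowP => i.
      by apply: contrapT => dei; apply: de; exists i.
    have [g [cg gE _]] := extend_by_zero (cpsi i) (psi0 i).
    exists g; split=> //; rewrite we !gE => -[nude]; rewrite -nude.
    by move/(mulfI nud).
  have nu00 s : (nu (sphere_incl s), 0) = (0, 0) :> (R * R)%type.
    by rewrite nu_sphere.
  have [g [cg gE g0]] := extend_by_zero cnu0 nu00.
  by exists g; split=> //; rewrite gE g0 // => -[/eqP]; exact/negP.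
rewrite open_hausdorff => z w /eqP.
have sep_by (g : attach_space -> (R * R)%type) : continuous g -> g z <> g w ->
    exists2 AB, (z \in AB.1 /\ w \in AB.2) &
      [/\ open AB.1, open AB.2 & AB.1 `&` AB.2 == set0].
  move=> cg gzw; have := prod_hausdorff (@Rhausdorff R) (@Rhausdorff R).
  rewrite open_hausdorff => /(_ (g z) (g w)) [|[A B] /=]; first exact/eqP.
  move=> [/set_mem Az /set_mem Bw] [oA oB /eqP AB].
  exists (g @^-1` A, g @^-1` B); first by split; exact: mem_set.
  split.
  - by move/continuousP: cg; exact.
  - by move/continuousP: cg; exact.
  - by apply/eqP; rewrite -preimage_setI AB preimage_set0.
move: z w sep_by => [x|p] [y|q] sep_by zw; last first.
- by have [g [cg gzw]] := cell_sep p _ zw; exact: sep_by gzw.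
- by have [g [cg gzw]] := cell_sep p _ zw; exact: sep_by gzw.
- by have [g [cg gzw]] := cell_sep q _ (nesym zw); apply: sep_by cg _; exact: nesym.
have xy : x != y by apply/eqP => xy; apply: zw; rewrite xy.
have := hE; rewrite open_hausdorff => /(_ x y xy) [[U V] /=].
move=> [/set_mem Ux /set_mem Vy] [oU oV /eqP UV].
exists (radial_extension U, radial_extension V).
  by split; exact: mem_set.
split; [exact: radial_extension_open..|].
by apply/eqP; exact: radial_extension_disjoint.
Qed.

Lemma attach_is_space k : is_space k (total E) -> is_space k attach_space.
Proof.
move=> Ek; apply: final_is_space => [K g [//|c]|].
  exact: compact_hausdorff_is_space (@disk_compact R _) (@disk_hausdorff R _).
case: k Ek => //= -[cgE sE]; first exact: attach_weak_hausdorff.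
exact: attach_hausdorff.
Qed.

End AttachCells.

(** * The sequence of stages and its colimit *)

Section CellTower.
Variables (R : realType) (X Y : topologicalType) (f : continuousType X Y).

Fixpoint tower (m : nat) : over Y :=
  if m is m'.+1 then attach R (tower m') else Over f.

Definition tower_cell : Type := {m : nat & cell R (tower m)}.
Definition tower_rank (a : tower_cell) : nat := projT1 a.
Definition tower_dim (a : tower_cell) : nat := cell_dim (projT2 a).

Definition tower_points : Type :=
  (X + {a : tower_cell & open_disk R (tower_dim a)})%type.

Fixpoint tower_incl (m : nat) : total (tower m) -> tower_points :=
  match m return total (tower m) -> tower_points with
  | 0 => fun x => inl x
  | m'.+1 => fun z => match z with
      | inl x => tower_incl x
      | inr p => inr (existT (fun a => open_disk R (tower_dim a))
                        (existT _ m' (projT1 p)) (projT2 p))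
      end
  end.

Inductive tower_tests : tests tower_points :=
  TowerTest m : @tower_tests (total (tower m)) (@tower_incl m).

Definition tower_space : topologicalType := final tower_tests.

Lemma tower_incl_continuous m : continuous (@tower_incl m : _ -> tower_space).
Proof. exact: final_test (TowerTest m). Qed.

Definition tower_base (x : X) : tower_space := inl x.

Lemma tower_base_continuous : continuous tower_base.
Proof. exact: (@tower_incl_continuous 0). Qed.

Definition tower_proj (z : tower_space) : Y :=
  match z with
  | inl x => f x
  | inr p => cell_bottom (sval (projT2 p))
  end.

Lemma tower_proj_incl m z : tower_proj (@tower_incl m z) = proj (tower m) z.
Proof. by elim: m z => [//|m IH] [x|p] //=; rewrite IH. Qed.

Lemma tower_proj_continuous : continuous tower_proj.
Proof.
apply: final_continuous => K g [m].
apply: continuous_eqfun (@cts_fun _ _ (proj (tower m))) => z.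
by rewrite /= tower_proj_incl.
Qed.

Lemma tower_incl_rank m z a d :
  @tower_incl m z = inr (existT _ a d) -> (tower_rank a < m)%N.
Proof.
elim: m z => [//|m IH] [x|p] /=; first by move/IH/ltnW.
by case=> <-.
Qed.

Lemma tower_incl_inj m : injective (@tower_incl m).
Proof.
elim: m => [x y [] //|m IH] [x|[c [d od]]] [y|[b [e oe]]] /=.
- by move/IH ->.
- by move/tower_incl_rank; rewrite ltnn.
- by move/esym/tower_incl_rank; rewrite ltnn.
pose P (a : tower_cell) := open_disk R (tower_dim a).
pose q : {a & P a} := existT P (existT _ m c) (exist _ d od).
move=> /(congr1 (fun z : tower_points => if z is inr r then r else q)) /= h.
have cb : c = b := existT_inj (congr1 (@projT1 _ _) h).
by subst b; rewrite (existT_inj h).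
Qed.

Lemma tower_incl_base m : exists g, forall x, @tower_incl m (g x) = inl x.
Proof.
elim: m => [|m [g gE]]; first by exists id.
by exists (fun x => inl (g x)) => x /=; rewrite gE.
Qed.

Lemma tower_incl_cell m a d : (tower_rank a < m)%N ->
  exists z, @tower_incl m z = inr (existT _ a d).
Proof.
elim: m => // m IH; rewrite ltnS leq_eqVlt => /orP[/eqP am|/IH[z zE]]; last first.
  by exists (inl z).
by case: a d am {IH} => m' c d /= e; subst m'; exists (inr (existT _ c d)).
Qed.

Lemma tower_preimage_succ (B : set tower_points) m :
  closed (@tower_incl m.+1 @^-1` B) -> closed (@tower_incl m @^-1` B).
Proof. by move/continuous_closedP: (@attach_base_continuous R Y (tower m)); exact. Qed.

Lemma tower_incl_closed_map m (C : set (total (tower m))) :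
  closed C -> closed ((@tower_incl m : _ -> tower_space) @` C).
Proof.
move=> cC; pose B : set tower_points := @tower_incl m @` C.
have up j : closed (@tower_incl (m + j) @^-1` B).
  elim: j => [|j IH].
    rewrite addn0 (_ : _ @^-1` _ = C) //; apply/seteqP; split=> z /=.
      by move=> [w Cw /tower_incl_inj <-].
    by exists z.
  rewrite addnS (_ : _ @^-1` _ =
    (inl : _ -> attach_space R (tower (m + j))) @` (@tower_incl (m + j) @^-1` B)).
    exact: attach_base_closed_map.
  apply/seteqP; split=> [[x|p]|_ [x Bx <-]] //=; first by exists x.
  case=> w _; case: p => c d /tower_incl_rank /=.
  by rewrite /tower_rank /= ltnNge leq_addr.
apply/final_closedE => K g [l].
have [lm|/ltnW ml] := leqP m l; first by rewrite -(subnKC lm); exact: up.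
have : closed (@tower_incl (l + (m - l)) @^-1` B).
  by have := up 0%N; rewrite addn0 subnKC.
elim: (m - l)%N => [|j IH]; first by rewrite addn0.
by rewrite addnS => /tower_preimage_succ.
Qed.

Lemma tower_cell_closed1 p : closed [set (inr p : tower_space)].
Proof.
case: p => -[m c] d.
rewrite (_ : [set _] = (@tower_incl m.+1 : _ -> tower_space) @`
  [set (inr (existT _ c d) : attach_space R (tower m))]).
  apply: (@tower_incl_closed_map m.+1).
  exact: (@attach_cell_closed1 R Y (tower m) (existT _ c d)).
by apply/seteqP; split=> [_ ->|_ [_ -> <-]] //=; exists (inr (existT _ c d)).
Qed.

(** Otherwise there would be points [s j] with [u (s j)] outside the [j]th
    stage. Only finitely many of the points [u (s j)] lie in any given stage,
    and each of them, being in an open cell, is closed; so the tails of the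
    sequence are closed sets, with empty intersection, contrary to the
    compactness of [K]. *)
Lemma tower_compact_factor (K : topologicalType) (u : K -> tower_space) :
  compact [set: K] -> continuous u ->
  exists m, forall s, exists z, u s = @tower_incl m z.
Proof.
move=> cK cu; apply: contrapT => /forallNP nm.
have [s sP] : exists s : nat -> K, forall j z, u (s j) <> @tower_incl j z.
  have sj j : exists x, forall z, u x <> @tower_incl j z.
    have /existsNP[x /forallNP xP] := nm j; by exists x.
  by exists (fun j => projT1 (cid (sj j))) => j z; case: cid.
have scell j : exists p, u (s j) = inr p.
  case E : (u (s j)) => [x|p]; last by exists p.
  have [g gE] := tower_incl_base j.
  by case: (sP j (g x)); rewrite gE.
pose B j : set tower_space := [set z | exists2 i, (j <= i)%N & z = u (s i)].
have cB j : closed (B j).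
  apply/final_closedE => L h [l].
  rewrite (_ : _ @^-1` _ = \bigcup_(i in [set i | (j <= i < l)%N])
      (@tower_incl l @^-1` [set u (s i)])).
    apply: closed_bigcup.
      by apply: sub_finite_set (finite_II l) => i /= /andP[].
    move=> i _; have [p ->] := scell i.
    move/continuous_closedP: (@tower_incl_continuous l); apply.
    exact: tower_cell_closed1.
  apply/seteqP; split=> z /=; last by move=> [i /andP[ji _] zi]; exists i.
  move=> [i ji zi]; exists i => //=; rewrite ji /=.
  rewrite ltnNge; apply/negP => li; have [[a d] ip] := scell i.
  have [w wE] : exists w, @tower_incl i w = inr (existT _ a d).
    apply: tower_incl_cell; rewrite ip in zi.
    by apply: leq_trans li; exact: tower_incl_rank zi.
  by apply: (sP i w); rewrite ip wE.
have /compact_near_coveringP nK := cK.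
have [] : \forall j \near \oo, [set: K] `<=` [set x | ~ B j (u x)].
  apply: nK => x _.
  have [j0 j0P] : exists j0, ~ B j0 (u x).
    case E : (u x) => [y|[a d]].
      exists 0%N => -[i _ ui]; have [p pE] := scell i.
      by rewrite pE in ui.
    exists (tower_rank a).+1 => -[i ai ui].
    have [w wE] := @tower_incl_cell i a d ai.
    by apply: (sP i w); rewrite -ui wE.
  exists ((u @^-1` ~` B j0), [set j | (j0 <= j)%N]) => /=.
    split; last by exists j0.
    apply: open_nbhs_nbhs; split=> //.
    by rewrite -preimage_setC openC; move/continuous_closedP: cu; exact.
  move=> [y j] /= [nB j0j] [i ji ui]; apply: nB; exists i => //.
  exact: leq_trans ji.
move=> j _ /(_ j) /= jP; have := jP (leqnn j) (s j) I; apply.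
by exists j.
Qed.

Definition tower_chi (a : tower_cell) (d : disk R (tower_dim a)) : tower_space :=
  @tower_incl (tower_rank a).+1 (cell_map (c := projT2 a) d).

Lemma tower_chi_open a d (od : in_open_disk d) :
  tower_chi (a := a) d = inr (existT _ a (exist _ d od)).
Proof. by rewrite /tower_chi (cell_map_open od); case: a d od. Qed.

Lemma tower_chi_sphere a s :
  tower_chi (a := a) (sphere_incl s) =
  @tower_incl (tower_rank a) (cell_top (c := projT2 a) s).
Proof. by rewrite /tower_chi cell_map_sphere. Qed.

Lemma tower_chi_continuous a : continuous (tower_chi (a := a)).
Proof.
exact: continuous_comp_fun (cell_map_continuous (c := projT2 a))
  (@tower_incl_continuous (tower_rank a).+1).
Qed.

(** The right lifting property of the last map of the factorization: a sphere
    mapped into the colimit lies in some stage, and the next stage contains a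
    cell that fills it. *)
Lemma tower_proj_fills n (u : continuousType (sphere R n) tower_space)
    (v : continuousType (disk R n) Y) :
  (forall s, tower_proj (u s) = v (sphere_incl s)) ->
  exists h : disk R n -> tower_space, [/\ continuous h,
    forall s, h (sphere_incl s) = u s & forall d, tower_proj (h d) = v d].
Proof.
move=> uv; have [m mP] := tower_compact_factor (@sphere_compact R n) (@cts_fun _ _ u).
pose w s := projT1 (cid (mP s)).
have wE s : u s = @tower_incl m (w s) by rewrite /w; case: cid.
have cw : continuous w.
  apply/continuous_closedP => C cC.
  rewrite (_ : w @^-1` C = u @^-1` ((@tower_incl m : _ -> tower_space) @` C)).
    have /continuous_closedP := @cts_fun _ _ u; apply.
    exact: tower_incl_closed_map.
  apply/seteqP; split=> s /=; first by exists (w s); rewrite ?wE.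
  by move=> [z Cz]; rewrite wE => /tower_incl_inj <-.
have wv s : proj (tower m) (w s) = v (sphere_incl s).
  by rewrite -tower_proj_incl -wE uv.
pose c : cell R (tower m) := existT _ n
  (exist (fun uv : continuousType (sphere R n) (total (tower m)) *
                   continuousType (disk R n) Y =>
            forall s, proj (tower m) (uv.1 s) = uv.2 (sphere_incl s))
     (mkcts cw : continuousType _ _, v) wv).
exists (tower_chi (a := existT _ m c)); split.
- exact: (@tower_chi_continuous (existT _ m c)).
- by move=> s; rewrite wE; exact: (@tower_chi_sphere (existT _ m c)).
- move=> d; rewrite /tower_chi tower_proj_incl.
  exact: (@attach_proj_cell _ _ _ c).
Qed.

Lemma tower_is_space_step k m : is_space k X -> is_space k (total (tower m)).
Proof. by move=> Xk; elim: m => //= m; exact: attach_is_space. Qed.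

Inductive tower_compact_tests : tests tower_space :=
  TowerCompact m (K : topologicalType) (g : K -> total (tower m)) :
    compact [set: K] -> hausdorff_space K -> continuous g ->
    @tower_compact_tests K (fun x => tower_incl (g x)).

Lemma tower_hausdorff : hausdorff_space X -> hausdorff_space tower_space.
Proof.
move=> hX; have hT m : hausdorff_space (total (tower m)).
  by elim: m => //= m; exact: attach_hausdorff.
(* Disjoint open sets of one stage are extended through all later stages. *)
have ext m (U V : set (total (tower m))) : open U -> open V -> U `&` V = set0 ->
    exists A B : set tower_space, [/\ open A, open B, A `&` B = set0,
      U `<=` @tower_incl m @^-1` A & V `<=` @tower_incl m @^-1` B].
  move=> oU oV UV.
  pose stg (W : set (total (tower m))) := fix stg j : set (total (tower (j + m))) :=
    match j with 0 => W | j'.+1 => radial_extension (stg j') end.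
  pose A W : set tower_space := [set z | exists j, exists2 w, stg W j w &
    z = @tower_incl (j + m) w].
  have stg_up W i j w : stg W j w -> exists2 w', stg W (i + j)%N w' &
      @tower_incl (i + j + m) w' = @tower_incl (j + m) w.
    move=> Ww; elim: i => [|i [w' Ww' wE]]; first by exists w.
    by exists (inl w').
  have stg_down W i j w : stg W (i + j)%N w ->
    forall w', @tower_incl (j + m) w' = @tower_incl (i + j + m) w -> stg W j w'.
    elim: i w => [|i IH] w Ww w' ww'; first by rewrite (tower_incl_inj ww').
    case: w Ww ww' => [x|[c d]] /=; first by move/IH; exact.
    move=> _ /tower_incl_rank; rewrite /tower_rank /=.
    by rewrite ltn_add2r ltnNge leq_addl.
  have stg_eq W i j w w' : stg W i w -> @tower_incl (i + m) w = @tower_incl (j + m) w' ->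
      stg W j w'.
    move=> Ww ww'; have [w1 Ww1 w1E] := stg_up W j i w Ww.
    move: w1 Ww1 w1E; rewrite (addnC j i) => w1 Ww1 w1E.
    by apply: stg_down Ww1 _ _; rewrite w1E.
  have stg_open W j : open W -> open (stg W j).
    by move=> oW; elim: j => //= j; exact: radial_extension_open.
  have A_open W : open W -> open (A W).
    move=> oW; have step j : open (@tower_incl (j + m) @^-1` A W).
      rewrite (_ : _ @^-1` _ = stg W j); first exact: stg_open.
      apply/seteqP; split=> w /=; last by exists j, w.
      by move=> [i [w' Ww' ww']]; apply: stg_eq Ww' _.
    have down q l : open (@tower_incl (q + l) @^-1` A W) ->
        open (@tower_incl l @^-1` A W).
      elim: q => [//|q IH]; rewrite addSn => oS; apply: IH.
      have /continuousP := @attach_base_continuous R Y (tower (q + l)).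
      by move=> /(_ _ oS).
    apply/final_openE => K g [l]; apply: (down m).
    by rewrite addnC; exact: step.
  exists (A U), (A V); split; [exact: A_open|exact: A_open| | |].
  - apply/seteqP; split=> // z [[i [w Uw zw]] [j [w' Vw' zw']]].
    have Vw : stg V i w by apply: stg_eq Vw' _; rewrite -zw' zw.
    have {Uw Vw} : (stg U i `&` stg V i) w by [].
    suff -> : stg U i `&` stg V i = set0 by [].
    by elim: (i) => //= l; exact: radial_extension_disjoint.
  - by move=> w Uw; exists 0%N, w.
  - by move=> w Vw; exists 0%N, w.
rewrite open_hausdorff => z w /eqP zw.
have [m [[z' zE] [w' wE]]] : exists m, (exists z', z = @tower_incl m z') /\
    exists w', w = @tower_incl m w'.
  have lev (y : tower_space) : exists m, forall l, (m <= l)%N ->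
      exists y', y = @tower_incl l y'.
    case: y => [x|[a d]].
      by exists 0%N => l _; have [g gE] := tower_incl_base l; exists (g x).
    exists (tower_rank a).+1 => l al; have [y yE] := @tower_incl_cell l a d al.
    by exists y.
  have [mz mzP] := lev z; have [mw mwP] := lev w.
  by exists (maxn mz mw); split; [apply: mzP | apply: mwP];
    rewrite leq_max leqnn ?orbT.
have zw' : z' != w' by apply/eqP => e; apply: zw; rewrite zE wE e.
have := hT m; rewrite open_hausdorff => /(_ z' w' zw') [[U V] /=].
move=> [/set_mem Uz /set_mem Vw] [oU oV /eqP UV].
have [A [B [oA oB AB UA VB]]] := ext m U V oU oV UV.
exists (A, B); last by split=> //; apply/eqP.
by rewrite zE wE; split; apply: mem_set; [exact: UA | exact: VB].
Qed.

Lemma tower_is_space k : is_space k X -> is_space k tower_space.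
Proof.
move=> Xk; apply: final_is_space => [K g [m]|]; first exact: tower_is_space_step.
case: k Xk => //= -[cgX sX]; last exact: tower_hausdorff.
have Tm m : compactly_generated (total (tower m)) /\ weak_hausdorff (total (tower m)).
  exact: (@tower_is_space_step CGWeakHausdorff).
apply: (@weak_hausdorff_by_tests _ tower_compact_tests).
- move=> A tA; apply/final_closedE => K g [m]; apply: (Tm m).1 => L u cL hL cu.
  exact: (tA _ _ (TowerCompact cL hL cu)).
- move=> K g [m L u cL hL cu]; split=> //.
    exact: continuous_comp_fun cu (@tower_incl_continuous m).
  move=> C cC; rewrite (_ : _ @` _ = (@tower_incl m : _ -> tower_space) @` (u @` C)).
    apply: tower_incl_closed_map; apply: weak_hausdorff_image => //.
    exact: (Tm m).2.
  by rewrite image_comp.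
- case=> [x|p]; last exact: tower_cell_closed1.
  rewrite (_ : [set _] = (@tower_incl 0 : _ -> tower_space) @` [set x]).
    by apply: (@tower_incl_closed_map 0 [set x]); exact: weak_hausdorff_closed1.
  by apply/seteqP; split=> [_ ->|_ [_ -> <-]] //=; exists x.
Qed.

End CellTower.

(** * Factorization into a cell complex and a map with fillers *)

Section AttachMap.
Variables (R : realType) (Y Y' : topologicalType) (E : over Y) (E' : over Y').
Variables (b : continuousType Y Y') (g : continuousType (total E) (total E')).
Hypothesis gb : forall z, proj E' (g z) = b (proj E z).

Lemma square_map_subproof n (uv : square R E n) s :
  proj E' (g ((sval uv).1 s)) = b ((sval uv).2 (sphere_incl s)).
Proof. by rewrite gb (svalP uv). Qed.

Definition square_map n (uv : square R E n) : square R E' n :=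
  exist (fun uv : continuousType (sphere R n) (total E') *
                  continuousType (disk R n) Y' =>
           forall s, proj E' (uv.1 s) = uv.2 (sphere_incl s))
    (g \o (sval uv).1 : continuousType _ _,
     b \o (sval uv).2 : continuousType _ _) (square_map_subproof uv).

Definition push_cell (c : cell R E) : cell R E' :=
  existT _ (projT1 c) (square_map (projT2 c)).

Definition attach_map (z : attach_space R E) : attach_space R E' :=
  match z with
  | inl x => inl (g x)
  | inr p => inr (existT (fun c => open_disk R (cell_dim c))
                    (push_cell (projT1 p)) (projT2 p))
  end.

Lemma attach_map_cell c d :
  attach_map (cell_map (c := c) d) = cell_map (c := push_cell c) d.
Proof.
have [od|[s ->]] := disk_cases d.
  by rewrite (cell_map_open od) (cell_map_open (c := push_cell c) od).
by rewrite cell_map_sphere (cell_map_sphere (c := push_cell c)).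
Qed.

Lemma attach_map_continuous : continuous attach_map.
Proof.
apply: final_continuous => K h [|c].
  exact: continuous_comp_fun (@cts_fun _ _ g) (@attach_base_continuous _ _ E').
apply: continuous_eqfun (cell_map_continuous (c := push_cell c)) => d.
by rewrite /= attach_map_cell.
Qed.

Lemma attach_map_proj z :
  proj (attach R E') (attach_map z) = b (proj (attach R E) z).
Proof. by case: z => [x|p]; first exact: gb. Qed.

End AttachMap.

Lemma push_cell_id (R : realType) (Y : topologicalType) (E : over Y)
    (b : continuousType Y Y) (g : continuousType (total E) (total E))
    (gb : forall z, proj E (g z) = b (proj E z)) (c : cell R E)
    (d : open_disk R (cell_dim c)) :
  (forall y, b y = y) -> (forall z, g z = z) ->
  existT (fun c => open_disk R (cell_dim c)) (push_cell gb c) d = existT _ c d.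
Proof.
move=> b1 g1; case: c d => n uv d; rewrite /push_cell /=.
suff -> : square_map gb uv = uv by [].
apply: sval_eq; case: uv {d} => -[u v] uvP /=; congr pair; apply/continuousEP => s /=.
  exact: g1.
exact: b1.
Qed.

Lemma push_cell_comp (R : realType) (Y Y' Y'' : topologicalType)
    (E : over Y) (E' : over Y') (E'' : over Y'')
    (b : continuousType Y Y') (b' : continuousType Y' Y'')
    (b'' : continuousType Y Y'')
    (g : continuousType (total E) (total E'))
    (g' : continuousType (total E') (total E''))
    (g'' : continuousType (total E) (total E''))
    (gb : forall z, proj E' (g z) = b (proj E z))
    (gb' : forall z, proj E'' (g' z) = b' (proj E' z))
    (gb'' : forall z, proj E'' (g'' z) = b'' (proj E z))
    (c : cell R E) (d : open_disk R (cell_dim c)) :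
  (forall y, b'' y = b' (b y)) -> (forall z, g'' z = g' (g z)) ->
  existT (fun c => open_disk R (cell_dim c)) (push_cell gb'' c) d =
  existT _ (push_cell gb' (push_cell gb c)) d.
Proof.
move=> b1 g1; case: c d => n uv d; rewrite /push_cell /=.
suff -> : square_map gb'' uv = square_map gb' (square_map gb uv) by [].
apply: sval_eq; case: uv {d} => -[u v] uvP /=; congr pair; apply/continuousEP => s /=.
  exact: g1.
exact: b1.
Qed.

Section TowerMap.
Variables (R : realType) (X Y X' Y' : topologicalType).
Variables (f : continuousType X Y) (f' : continuousType X' Y').
Variables (a : continuousType X X') (b : continuousType Y Y').
Hypothesis fab : forall x, f' (a x) = b (f x).

Fixpoint tower_map (m : nat) :
    {g : continuousType (total (tower R f m)) (total (tower R f' m)) |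
      forall z, proj (tower R f' m) (g z) = b (proj (tower R f m) z)} :=
  match m with
  | 0 => exist (fun g : continuousType X X' => forall x, f' (g x) = b (f x)) a fab
  | m'.+1 =>
    exist (fun g : continuousType (total (tower R f m'.+1))
                     (total (tower R f' m'.+1)) =>
             forall z, proj (tower R f' m'.+1) (g z) =
                       b (proj (tower R f m'.+1) z))
      (mkcts (@attach_map_continuous R _ _ _ _ b _ (svalP (tower_map m'))))
      (attach_map_proj (svalP (tower_map m')))
  end.

Definition push_tower_cell (c : tower_cell R f) : tower_cell R f' :=
  existT _ (projT1 c) (push_cell (svalP (tower_map (projT1 c))) (projT2 c)).

Definition tower_space_map (z : tower_space R f) : tower_space R f' :=
  match z with
  | inl x => inl (a x)
  | inr p => inr (existT (fun c => open_disk R (tower_dim c))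
                    (push_tower_cell (projT1 p)) (projT2 p))
  end.

Lemma tower_space_map_incl m z :
  tower_space_map (tower_incl (m := m) z) =
  tower_incl (m := m) (sval (tower_map m) z).
Proof. by elim: m z => [//|m IH] [x|[c d]] /=; first exact: IH. Qed.

Lemma tower_space_map_continuous : continuous tower_space_map.
Proof.
apply: final_continuous => K g [m].
apply: continuous_eqfun (continuous_comp_fun (@cts_fun _ _ (sval (tower_map m)))
  (@tower_incl_continuous R _ _ f' m)) => z.
by rewrite /= tower_space_map_incl.
Qed.

Lemma tower_space_map_proj z :
  tower_proj (tower_space_map z) = b (tower_proj z).
Proof. by case: z => [x|[[m c] d]] /=; first exact: fab. Qed.

End TowerMap.

Lemma tower_map_id (R : realType) (X Y : topologicalType)
    (f : continuousType X Y) (a : continuousType X X) (b : continuousType Y Y)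
    (fab : forall x, f (a x) = b (f x)) m z :
  (forall x, a x = x) -> (forall y, b y = y) ->
  sval (tower_map R fab m) z = z.
Proof.
move=> a1 b1; elim: m z => [x|m IH [x|[c d]]]; first exact: a1.
  by congr inl; exact: IH.
by congr inr; exact: push_cell_id.
Qed.

Lemma tower_map_comp (R : realType) (X Y X' Y' X'' Y'' : topologicalType)
    (f : continuousType X Y) (f' : continuousType X' Y')
    (f'' : continuousType X'' Y'')
    (a : continuousType X X') (b : continuousType Y Y')
    (a' : continuousType X' X'') (b' : continuousType Y' Y'')
    (a'' : continuousType X X'') (b'' : continuousType Y Y'')
    (fab : forall x, f' (a x) = b (f x)) (fab' : forall x, f'' (a' x) = b' (f' x))
    (fab'' : forall x, f'' (a'' x) = b'' (f x)) m z :
  (forall x, a'' x = a' (a x)) -> (forall y, b'' y = b' (b y)) ->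
  sval (tower_map R fab'' m) z = sval (tower_map R fab' m) (sval (tower_map R fab m) z).
Proof.
move=> a1 b1; elim: m z => [x|m IH [x|[c d]]]; first exact: a1.
  by congr inl; exact: IH.
by congr inr; exact: push_cell_comp.
Qed.

Lemma tower_cell_eq (R : realType) (X Y : topologicalType)
    (f : continuousType X Y) m (c c' : cell R (tower R f m))
    (d : open_disk R (cell_dim c)) (d' : open_disk R (cell_dim c')) :
  existT (fun c => open_disk R (cell_dim c)) c d = existT _ c' d' ->
  existT (fun a : tower_cell R f => open_disk R (tower_dim a)) (existT _ m c) d =
  existT _ (existT _ m c') d'.
Proof.
exact: (congr1 (fun p : {c : cell R (tower R f m) & open_disk R (cell_dim c)} =>
  existT (fun a : tower_cell R f => open_disk R (tower_dim a))
    (existT _ m (projT1 p)) (projT2 p))).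
Qed.

Section CellFactorization.
Variables (R : realType) (k : space_kind).

Definition cell_mid (X Y : Top k) (f : mor X Y) : Top k :=
  exist (is_space k) (tower_space R (f : continuousType (sval X) (sval Y)))
    (@tower_is_space R (sval X) (sval Y) f k (svalP X)).

Definition cell_left (X Y : Top k) (f : mor X Y) : mor X (cell_mid f) :=
  @mk_mor k X (cell_mid f) _ (@tower_base_continuous R _ _ f).

Definition cell_right (X Y : Top k) (f : mor X Y) : mor (cell_mid f) Y :=
  @mk_mor k (cell_mid f) Y _ (@tower_proj_continuous R _ _ f).

Section MidMap.
Variables (X Y X' Y' : Top k) (f : mor X Y) (f' : mor X' Y').
Variables (a : mor X X') (b : mor Y Y').

Definition cell_mid_map (e : b ∘ f = f' ∘ a) : mor (cell_mid f) (cell_mid f') :=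
  @mk_mor k (cell_mid f) (cell_mid f') _
    (@tower_space_map_continuous R _ _ _ _ _ _ _ _ (app_eq (esym e))).
End MidMap.

Lemma cell_mid_map_id (X Y : Top k) (f : mor X Y)
    (e : idm Y ∘ f = f ∘ idm X) : cell_mid_map e = idm (cell_mid f).
Proof.
apply: mor_eq => -[x|[[m c] d]] //; congr inr.
apply: tower_cell_eq.
apply: (@push_cell_id R _ _ _ _ (svalP (tower_map R (app_eq (esym e)) m)) c d) => //.
by move=> z; exact: tower_map_id.
Qed.

Lemma cell_mid_map_comp (X Y X' Y' X'' Y'' : Top k)
    (f : mor X Y) (f' : mor X' Y') (f'' : mor X'' Y'')
    (a : mor X X') (b : mor Y Y') (a' : mor X' X'') (b' : mor Y' Y'')
    (e : b ∘ f = f' ∘ a) (e' : b' ∘ f' = f'' ∘ a')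
    (e'' : (b' ∘ b) ∘ f = f'' ∘ (a' ∘ a)) :
  cell_mid_map e'' = cell_mid_map e' ∘ cell_mid_map e.
Proof.
apply: mor_eq => -[x|[[m c] d]] //; congr inr.
apply: tower_cell_eq.
apply: (@push_cell_comp R _ _ _ _ _ _ _ _ _ _ _ _
  (svalP (tower_map R (app_eq (esym e)) m))
  (svalP (tower_map R (app_eq (esym e')) m))
  (svalP (tower_map R (app_eq (esym e'')) m)) c d) => //.
by move=> z; exact: tower_map_comp.
Qed.

Lemma cell_factorE (X Y : Top k) (f : mor X Y) :
  cell_right f ∘ cell_left f = f.
Proof. exact: mor_eq. Qed.

Lemma cell_mid_map_left (X Y X' Y' : Top k) (f : mor X Y) (f' : mor X' Y')
    (a : mor X X') (b : mor Y Y') (e : b ∘ f = f' ∘ a) :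
  cell_mid_map e ∘ cell_left f = cell_left f' ∘ a.
Proof. exact: mor_eq. Qed.

Lemma cell_mid_map_right (X Y X' Y' : Top k) (f : mor X Y) (f' : mor X' Y')
    (a : mor X X') (b : mor Y Y') (e : b ∘ f = f' ∘ a) :
  cell_right f' ∘ cell_mid_map e = b ∘ cell_right f.
Proof. by apply: mor_eq => z; exact: tower_space_map_proj. Qed.

Definition cell_factorization : functorial_factorization (Top k) :=
  FunctorialFactorization cell_factorE cell_mid_map_left cell_mid_map_right
    cell_mid_map_id cell_mid_map_comp.

Lemma cell_right_fills (X Y : Top k) (f : mor X Y) n :
  has_lifting (top_sphere_incl R k n) (cell_right f).
Proof.
move=> u v uv.
have [h [ch hu hv]] := @tower_proj_fills R _ _ f n u v (app_eq uv).
exists (@mk_mor k (top_disk R k n) (cell_mid f) h ch).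
by split; apply: mor_eq.
Qed.

(** The cells of all the stages, ranked by the stage to which they are attached. *)
Lemma cell_left_decomposition (X Y : Top k) (f : mor X Y) :
  @cell_decomposition R k X (cell_mid f) (cell_left f)
    {classic tower_cell R (f : continuousType (sval X) (sval Y))}
    (@tower_rank R _ _ f) (@tower_dim R _ _ f) (@tower_chi R _ _ f).
Proof.
have preim m (B : set (tower_space R (f : continuousType (sval X) (sval Y)))) :
    closed (app (cell_left f) @^-1` B) ->
    (forall c, (tower_rank c < m)%N -> closed (tower_chi (a := c) @^-1` B)) ->
    closed (tower_incl (m := m) @^-1` B).
  elim: m => [//|m IH] cX cB; apply/final_closedE => K g [|c].
    by apply: IH => // c cm; apply: cB; exact: ltnW.
  exact: (cB (existT _ m c) (leqnn _)).
split.
- exact: tower_chi_continuous.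
- by move=> x y [].
- move=> [x|[c [d od]]]; first by left; exists x.
  by right; exists c, d; split=> //; rewrite tower_chi_open.
- by move=> c d x od; rewrite (tower_chi_open od).
- move=> c c' d e od oe; rewrite (tower_chi_open od) (tower_chi_open oe).
  pose q := existT (fun a => open_disk R (tower_dim a)) c (exist _ d od).
  move=> /(congr1 (fun z : tower_points R _ => if z is inr r then r else q)) /=.
  exact: (congr1 (fun p : {a & open_disk R (tower_dim a)} =>
    existT (fun a => disk R (tower_dim a)) (projT1 p) (sval (projT2 p)))).
- move=> c s; rewrite tower_chi_sphere; set z := tower_incl _.
  case E : z => [x|[c' [d od]]]; first by left; exists x.
  right; exists c', d; split=> //; last by rewrite (tower_chi_open od).
  exact: tower_incl_rank E.
- move=> c B cX cB; have := preim (tower_rank c) B cX cB.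
  move/continuous_closedP: (@cell_top_continuous R _ _ (projT2 c)) => cc /cc.
  by congr closed; apply/funext => s /=; rewrite tower_chi_sphere.
- move=> B cX cB; apply/final_closedE => K g [m].
  by apply: preim => // c _; exact: cB.
Qed.

Lemma cell_left_retract (X Y : Top k) (f : mor X Y) :
  exists (B E : Top k) (j : mor B E),
    relative_cell_complex R j /\ retract_of (cell_left f) j.
Proof. exact: cell_decomposition_retract (cell_left_decomposition f). Qed.

End CellFactorization.

(** * Maps defined on closed subsets *)

(** A partial map is represented by a total function that is only required to
    be continuous on a closed set [A]; for closed [A] the following is
    continuity of the restriction to [A]. Gluing along closed sets is then
    immediate. *)
Definition continuous_on (T X : topologicalType) (A : set T) (g : T -> X) : Prop :=
  forall C, closed C -> closed (A `&` g @^-1` C).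

Section ContinuousOn.
Variables (T X : topologicalType).
Implicit Types (A B : set T) (g : T -> X).

Lemma continuous_on_closed A g : closed A -> continuous g -> continuous_on A g.
Proof.
move=> cA /continuous_closedP cg C cC; apply: closedI => //; exact: cg.
Qed.

Lemma continuous_onU A B g :
  continuous_on A g -> continuous_on B g -> continuous_on (A `|` B) g.
Proof.
by move=> gA gB C cC; rewrite setIUl; apply: closedU; [exact: gA | exact: gB].
Qed.

Lemma continuous_on_eq A g g' : (forall t, A t -> g t = g' t) ->
  continuous_on A g -> continuous_on A g'.
Proof.
move=> gg' gA C cC; have := gA C cC; congr closed.
by apply/seteqP; split=> t /= [At] /=; rewrite gg'.
Qed.

Lemma continuous_on_subset A B g : closed B -> B `<=` A ->
  continuous_on A g -> continuous_on B g.
Proof.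
move=> cB BA gA C cC; have -> : B `&` g @^-1` C = B `&` (A `&` g @^-1` C).
  by rewrite setIA (setIidl BA).
by apply: closedI => //; exact: gA.
Qed.

Lemma continuous_on_comp (S : topologicalType) A (q : S -> T) g :
  continuous q -> (forall s, A (q s)) -> continuous_on A g ->
  continuous (fun s => g (q s)).
Proof.
move=> /continuous_closedP cq qA gA; apply/continuous_closedP => C cC.
have := cq _ (gA C cC); congr closed.
by apply/seteqP; split=> s /= => [[]|].
Qed.

Lemma continuous_on_comp_on (S : topologicalType) (B : set S) A (q : S -> T) g :
  continuous q -> closed B -> (forall s, B s -> A (q s)) -> continuous_on A g ->
  continuous_on B (fun s => g (q s)).
Proof.
move=> /continuous_closedP cq cB qA gA C cC.
have := closedI cB (cq _ (gA C cC)); congr closed.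
by apply/seteqP; split=> s /= [Bs]; [case | split=> //; split=> //; exact: qA].
Qed.

Lemma continuous_on_post (Y : topologicalType) A g (h : X -> Y) :
  continuous h -> continuous_on A g -> continuous_on A (fun t => h (g t)).
Proof. by move=> /continuous_closedP ch gA C cC; exact: gA _ (ch _ cC). Qed.

End ContinuousOn.

Lemma compact_hausdorff_prod (S T : topologicalType) :
  compact [set: S] /\ hausdorff_space S -> compact [set: T] /\ hausdorff_space T ->
  compact [set: (S * T)%type] /\ hausdorff_space (S * T)%type.
Proof.
move=> [cS hS] [cT hT]; split; last exact: prod_hausdorff.
by rewrite -setXTT; exact: compact_setX.
Qed.

Lemma fst_continuous (S T : topologicalType) : continuous (@fst S T).
Proof. by move=> p; exact: cvg_fst. Qed.

Lemma snd_continuous (S T : topologicalType) : continuous (@snd S T).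
Proof. by move=> p; exact: cvg_snd. Qed.

(** The product of a closed subset with [T] is a compact subspace, and its
    inclusion is a closed map: this gets from continuity on the subspace, where
    results about compactly generated spaces apply, to [continuous_on]. *)
Lemma continuous_on_cylinder (S T Z : topologicalType) (A : set S)
    (w : (S * T)%type -> Z) :
  compact [set: S] /\ hausdorff_space S -> compact [set: T] /\ hausdorff_space T ->
  closed A -> continuous (fun p : (A * T)%type => w (\val p.1, p.2)) ->
  continuous_on [set p : (S * T)%type | A p.1] w.
Proof.
move=> chS chT cA cw C cC; pose k (p : (A * T)%type) : (S * T)%type := (\val p.1, p.2).
have ck : continuous k.
  apply: pair_continuous; last exact: snd_continuous.
  exact: continuous_comp_fun (@fst_continuous _ _) (@set_val_continuous _ _).
have [cAT _] := compact_hausdorff_prod (closed_compact_subspace chS.1 chS.2 cA) chT.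
rewrite (_ : _ `&` _ = k @` ((fun p : (A * T)%type => w (\val p.1, p.2)) @^-1` C)).
  apply: closed_map_compact => //.
    exact: prod_hausdorff chS.2 chT.2.
  by move/continuous_closedP: cw; exact.
apply/seteqP; split=> [[s t] /= [As Cst]|_ [[s t] /= Cst <-]] /=.
  by exists (exist _ s (mem_set As), t).
by split=> //; exact: set_valP.
Qed.

Lemma continuous_on_val (T X : topologicalType) (A : set T) (u : T -> X) :
  continuous_on A u -> continuous (fun a : A => u (\val a)).
Proof.
apply: (continuous_on_comp (q := fun a : A => \val a)); last by move=> a; exact: set_valP.
exact: set_val_continuous.
Qed.

Definition retraction (T : topologicalType) (A : set T) (r : T -> T) : Prop :=
  [/\ continuous r, forall t, A (r t) & forall t, A t -> r t = t].

(** The right lifting property of [p] against the inclusion of [A] in [T]. *)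
Definition fills (X Y : topologicalType) (p : X -> Y) (T : topologicalType)
    (A : set T) : Prop :=
  forall (u : T -> X) (v : T -> Y), continuous_on A u -> continuous v ->
  (forall t, A t -> p (u t) = v t) ->
  exists h : T -> X, [/\ continuous h, forall t, A t -> h t = u t &
                         forall t, p (h t) = v t].

Section Homeomorphism.
Variables (S T : topologicalType) (alpha : S -> T) (beta : T -> S).
Hypotheses (calpha : continuous alpha) (cbeta : continuous beta).
Hypotheses (alphaK : cancel alpha beta) (betaK : cancel beta alpha).
Variables (A : set S) (B : set T).
Hypothesis AB : forall s, A s <-> B (alpha s).

Lemma retraction_homeo r : retraction B r -> retraction A (beta \o r \o alpha).
Proof.
move=> [cr rB rid]; split.
- exact: continuous_comp_fun calpha (continuous_comp_fun cr cbeta).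
- by move=> s; apply/AB; rewrite /= betaK.
- by move=> s /AB /rid /= ->.
Qed.

Lemma fills_homeo (X Y : topologicalType) (p : X -> Y) :
  closed B -> fills p A -> fills p B.
Proof.
move=> cB pA u v uB cv puv.
have cA : closed A.
  rewrite (_ : A = alpha @^-1` B); first by move/continuous_closedP: calpha; exact.
  by apply/seteqP; split=> s /AB.
have [||s /AB/puv //|h [ch hu hv]] := pA (u \o alpha) (v \o alpha).
- by apply: continuous_on_comp_on uB => // s /AB.
- exact: continuous_comp_fun calpha cv.
exists (h \o beta); split.
- exact: continuous_comp_fun cbeta ch.
- by move=> t Bt /=; rewrite hu /= ?betaK //; apply/AB; rewrite betaK.
- by move=> t /=; rewrite hv /= betaK.
Qed.

End Homeomorphism.

(** * Cubes, disks and prisms *)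

Section RealFunctions.
Variables (R : realType) (T : topologicalType).
Implicit Types f g : T -> R.

Lemma add_cont f g : continuous f -> continuous g -> continuous (fun t => f t + g t).
Proof. by move=> cf cg t; apply: (@continuousD R R^o _ f g); [exact: cf | exact: cg]. Qed.

Lemma sub_cont f g : continuous f -> continuous g -> continuous (fun t => f t - g t).
Proof. by move=> cf cg t; apply: (@continuousB R R^o _ f g); [exact: cf | exact: cg]. Qed.

Lemma mul_cont f g : continuous f -> continuous g -> continuous (fun t => f t * g t).
Proof. by move=> cf cg t; apply: (@continuousM R _ f g); [exact: cf | exact: cg]. Qed.

Lemma max_cont f g :
  continuous f -> continuous g -> continuous (fun t => Num.max (f t) (g t)).
Proof.
by move=> cf cg t; apply: (@continuous_max R _ f g); [exact: cf | exact: cg].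
Qed.

Lemma min_cont f g :
  continuous f -> continuous g -> continuous (fun t => Num.min (f t) (g t)).
Proof.
by move=> cf cg t; apply: (@continuous_min R _ f g); [exact: cf | exact: cg].
Qed.

Lemma inv_cont f : continuous f -> (forall t, f t != 0) ->
  continuous (fun t => (f t)^-1).
Proof.
move=> cf f0 t; apply: (@continuous_comp _ _ _ f GRing.inv); first exact: cf.
exact: inv_continuous.
Qed.

Lemma cst_cont (c : R) : continuous (fun _ : T => c).
Proof. exact: cst_continuous. Qed.

Lemma row_cont n (f : T -> 'rV[R]_n) :
  (forall i, continuous (fun t => f t ord0 i)) -> continuous f.
Proof.
move=> cf t U [P nP PU].
apply: (@filterS _ _ (nbhs_filter t) (fun t' : T => forall i j, P i j (f t' i j))).
  by move=> t' Pt'; exact: PU.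
apply: (@filter_forall _ _ (fun i t' => forall j, P i j (f t' i j)) _ (nbhs_filter t)).
move=> i; apply: (@filter_forall _ _ (fun j t' => P i j (f t' i j)) _ (nbhs_filter t)).
by move=> j; have := nP i j; rewrite (ord1 i); exact: cf.
Qed.

Lemma scale_cont n (a : T -> R) (f : T -> 'rV[R]_n) :
  continuous a -> continuous f -> continuous (fun t => a t *: f t).
Proof. by move=> ca cf t; apply: continuousZ; [exact: ca | exact: cf]. Qed.

End RealFunctions.

Section RowNorm.
Variables (R : realType) (n : nat).
Implicit Types x : 'rV[R]_n.

Lemma row_normE x :
  `|x| = \big[Num.max/0]_(ij : 'I_1 * 'I_n) `|x ij.1 ij.2|.
Proof. exact: mx_normrE. Qed.

Lemma coord_le_norm x i : `|x ord0 i| <= `|x|.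
Proof.
rewrite row_normE.
exact: (le_bigmax 0 (fun ij : 'I_1 * 'I_n => `|x ij.1 ij.2|) (ord0, i)).
Qed.

Lemma row_norm_le x c : 0 <= c -> (forall i, `|x ord0 i| <= c) -> `|x| <= c.
Proof.
move=> c0 xc; rewrite row_normE; apply/bigmax_leP; split=> //.
by move=> [i j] _ /=; rewrite (ord1 i).
Qed.

Lemma row_norm_attained x : `|x| != 0 -> exists i, `|x| = `|x ord0 i|.
Proof.
by move=> /mx_norm_neq0[[i j] /= xij]; exists j; rewrite (ord1 i) in xij.
Qed.

Definition euclid_norm x : R := Num.sqrt (sq_norm x).

Lemma sq_norm_ge0 x : 0 <= sq_norm x.
Proof. by apply: sumr_ge0 => i _; exact: sqr_ge0. Qed.

Lemma sq_normZ a x : sq_norm (a *: x) = a ^+ 2 * sq_norm x.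
Proof. by rewrite /sq_norm mulr_sumr; apply: eq_bigr => i _; rewrite mxE exprMn. Qed.

Lemma euclid_normZ a x : 0 <= a -> euclid_norm (a *: x) = a * euclid_norm x.
Proof. by move=> a0; rewrite /euclid_norm sq_normZ sqrtrM ?sqr_ge0 // sqrtr_sqr ger0_norm. Qed.

Lemma euclid_norm_continuous : continuous euclid_norm.
Proof. exact: continuous_comp_fun (@sq_norm_continuous R n) (@sqrt_continuous R). Qed.

Lemma sup_le_euclid x : `|x| <= euclid_norm x.
Proof.
apply: row_norm_le => [|i]; first exact: sqrtr_ge0.
rewrite -sqrtr_sqr; apply: ler_wsqrtr; rewrite /sq_norm (bigD1 i) //= lerDl.
by apply: sumr_ge0 => j _; exact: sqr_ge0.
Qed.

Lemma euclid_le_sup : exists2 c, 0 <= c & forall x, euclid_norm x <= c * `|x|.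
Proof.
exists (Num.sqrt n%:R) => [|x]; first exact: sqrtr_ge0.
rewrite -[`|x|]ger0_norm // -sqrtr_sqr -sqrtrM ?ler0n //; apply: ler_wsqrtr.
rewrite /sq_norm mulrC.
have -> : `|x| ^+ 2 * n%:R = \sum_(i < n) `|x| ^+ 2.
  by rewrite sumr_const card_ord mulr_natr.
apply: ler_sum => i _; rewrite -(real_normK (num_real (x ord0 i))).
by rewrite lerXn2r ?nnegrE // coord_le_norm.
Qed.

Lemma euclid_norm_eq0 x : euclid_norm x = 0 -> x = 0.
Proof.
by move=> x0; apply/eqP; rewrite -normr_le0 -x0 sup_le_euclid.
Qed.

Lemma euclid_norm0 : euclid_norm 0 = 0.
Proof. by rewrite -(scale0r 0) euclid_normZ // mul0r. Qed.

(** This maps the unit ball of the norm [N] to that of [M] along the rays. *)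
Definition rescale (N M : 'rV[R]_n -> R) x := (N x / M x) *: x.

Lemma rescale_continuous (N M : 'rV[R]_n -> R) c : continuous N -> continuous M ->
  (forall x, M x = 0 -> x = 0) -> (forall x, 0 <= N x / M x <= c) ->
  continuous (rescale N M).
Proof.
move=> cN cM M0 NM x; have [->|x0] := eqVneq x 0; last first.
  have Mx : M x != 0 by apply/eqP => /M0 /eqP; exact/negP.
  apply: (@continuousZ _ _ _ (fun x => N x / M x) id); last exact: cvg_id.
  apply: (@continuousM R _ N (fun x => (M x)^-1)); first exact: cN.
  apply: (@continuous_comp _ _ _ M GRing.inv); first exact: cM.
  exact: inv_continuous.
have c0 : 0 <= c by have /andP[] := NM 0; exact: le_trans.
have bound y : `|rescale N M y| <= c * `|y|.
  have /andP[nm0 nmc] := NM y.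
  by rewrite /rescale normrZ ger0_norm // ler_wpM2r.
rewrite /continuous_at {2}/rescale scaler0.
apply/(@cvgr0Pnorm_lt _ _ _ _ (nbhs_filter (0 : 'rV[R]_n))) => e e0.
have d0 : 0 < e / (c + 1) by rewrite divr_gt0 // ltr_wpDl.
apply: filterS (@nbhs0_lt _ _ _ d0) => y /= yd.
apply: le_lt_trans (bound y) _; apply: (@le_lt_trans _ _ ((c + 1) * `|y|)).
  by rewrite ler_wpM2r // lerDl.
by rewrite mulrC -ltr_pdivlMr // ltr_wpDl.
Qed.

Lemma rescaleK (N M : 'rV[R]_n -> R) : (forall a x, 0 <= a -> N (a *: x) = a * N x) ->
  (forall a x, 0 <= a -> M (a *: x) = a * M x) ->
  (forall x, 0 <= N x) -> (forall x, 0 <= M x) ->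
  (forall x, N x = 0 -> x = 0) -> (forall x, M x = 0 -> x = 0) ->
  cancel (rescale N M) (rescale M N).
Proof.
move=> NZ MZ N0 M0 Nx Mx x; have [->|x0] := eqVneq x 0.
  by rewrite /rescale !scaler0.
have Nn : N x != 0 by apply/eqP => /Nx /eqP; exact/negP.
have Mn : M x != 0 by apply/eqP => /Mx /eqP; exact/negP.
have nm : 0 <= N x / M x by rewrite divr_ge0.
rewrite /rescale NZ // MZ // scalerA; rewrite -[RHS]scale1r; congr (_ *: _).
by field; rewrite Nn Mn.
Qed.

End RowNorm.

Section Cubes.
Variable R : realType.

Local Notation I := (unit_interval R).

Definition unit0 : I := clamp 0.
Definition unit1 : I := clamp 1.

Lemma val_clamp (a : R) : \val (clamp a) = clamp_val a.
Proof. by []. Qed.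

Lemma val_unit0 : \val unit0 = 0 :> R.
Proof. by rewrite /= clamp_valE // lexx ler01. Qed.

Lemma val_unit1 : \val unit1 = 1 :> R.
Proof. by rewrite /= clamp_valE // ler01 lexx. Qed.

Lemma unit_eq0 (s : I) : \val s = 0 -> s = unit0.
Proof. by move=> s0; apply: val_inj; rewrite s0 val_unit0. Qed.

Lemma unit_eq1 (s : I) : \val s = 1 -> s = unit1.
Proof. by move=> s1; apply: val_inj; rewrite s1 val_unit1. Qed.

Lemma unit_itv (s : I) : 0 <= \val s <= 1.
Proof. exact: (set_valP s). Qed.

Lemma clamp_val_id (s : I) : clamp (\val s) = s.
Proof. by apply: val_inj; rewrite /= clamp_valE // unit_itv. Qed.

Lemma unit_val_continuous : continuous (fun s : I => \val s : R).
Proof. exact: set_val_continuous. Qed.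

Lemma unit_compact_hausdorff : compact [set: I] /\ hausdorff_space I.
Proof. by split; [exact: unit_interval_compact | exact: unit_interval_hausdorff]. Qed.

Lemma clamp_cont (T : topologicalType) (f : T -> R) :
  continuous f -> continuous (fun t => clamp (f t)).
Proof. by move=> cf; exact: continuous_comp_fun cf (@clamp_continuous R). Qed.

Definition flip (s : I) : I := clamp (1 - \val s).

Lemma flip_continuous : continuous flip.
Proof.
by apply: clamp_cont; apply: sub_cont; [exact: cst_cont | exact: unit_val_continuous].
Qed.

Lemma val_flip s : \val (flip s) = 1 - \val s :> R.
Proof.
have /andP[s0 s1] := unit_itv s.
by rewrite /flip val_clamp clamp_valE //; apply/andP; split; lra.
Qed.

Lemma flip0 : flip unit0 = unit1.
Proof. by apply: unit_eq1; rewrite val_flip val_unit0 subr0. Qed.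

Lemma flip1 : flip unit1 = unit0.
Proof. by apply: unit_eq0; rewrite val_flip val_unit1 subrr. Qed.

(** The cube in coordinates centred at its midpoint: the closed unit ball of
    the sup norm. *)
Definition centred n (t : cube R n) : 'rV[R]_n :=
  \row_i (2 * (\val t : 'rV[R]_n) ord0 i - 1).

Lemma to_cube_subproof n (x : 'rV[R]_n) :
  cube_set (\row_i clamp_val ((x ord0 i + 1) / 2)).
Proof. by move=> i; rewrite mxE clamp_val_itv. Qed.

Definition to_cube n (x : 'rV[R]_n) : cube R n :=
  exist _ (\row_i clamp_val ((x ord0 i + 1) / 2)) (mem_set (to_cube_subproof x)).

Lemma cube_itv n (t : cube R n) i : 0 <= (\val t : 'rV[R]_n) ord0 i <= 1.
Proof. exact: (set_valP t). Qed.

Lemma cube_coord_cont n i : continuous (fun t : cube R n => (\val t : 'rV[R]_n) ord0 i).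
Proof.
apply: (@continuous_comp_fun (cube R n) 'rV[R]_n R (fun t => \val t)
  (fun M : 'rV[R]_n => M ord0 i)).
  exact: set_val_continuous.
exact: coord_continuous.
Qed.

Lemma centredK n (t : cube R n) : to_cube (centred t) = t.
Proof.
apply: val_inj; apply/rowP => i; rewrite /= !mxE subrK (mulrC 2) mulfK ?pnatr_eq0 //.
by rewrite clamp_valE // cube_itv.
Qed.

Lemma to_cubeK n (x : 'rV[R]_n) : `|x| <= 1 -> centred (to_cube x) = x.
Proof.
move=> x1; apply/rowP => i; rewrite !mxE.
have := le_trans (coord_le_norm x i) x1; rewrite ler_norml => /andP[a b].
by rewrite clamp_valE; [lra | apply/andP; split; lra].
Qed.

Lemma centred_continuous n : continuous (@centred n).
Proof.
apply: row_cont => i; apply: (@continuous_eqfun _ _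
  (fun t : cube R n => 2 * (\val t : 'rV[R]_n) ord0 i - 1)).
  by move=> t; rewrite mxE.
apply: sub_cont; last exact: cst_cont.
by apply: mul_cont; [exact: cst_cont | exact: cube_coord_cont].
Qed.

Lemma to_cube_continuous n : continuous (@to_cube n).
Proof.
apply: continuous_set_val_inj; apply: row_cont => i.
apply: (@continuous_eqfun _ _ (fun x : 'rV[R]_n => clamp_val ((x ord0 i + 1) / 2))).
  by move=> x; rewrite /= mxE.
apply: continuous_comp_fun (@clamp_val_continuous R).
apply: mul_cont; last exact: cst_cont.
by apply: add_cont; [exact: coord_continuous | exact: cst_cont].
Qed.

Lemma centred_norm n (t : cube R n) : `|centred t| <= 1.
Proof.
apply: row_norm_le => // i; rewrite mxE ler_norml.
by have /andP[t0 t1] := cube_itv t i; apply/andP; split; lra.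
Qed.

Lemma cube_boundaryE n (t : cube R n) : cube_boundary t <-> `|centred t| = 1.
Proof.
split=> [[i ti]|t1].
  apply/le_anti; rewrite centred_norm /=; apply: le_trans (coord_le_norm _ i).
  by rewrite mxE; case: ti => ->; rewrite ?mulr0 ?sub0r ?normrN ?normr1 // mulr1
    (natrD R 1 1) addrK normr1.
have [|i ti] := @row_norm_attained _ _ (centred t); first by rewrite t1 oner_eq0.
exists i; move: ti; rewrite t1 mxE => /esym/eqP.
by rewrite eqr_norml ler01 andbT => /orP[]/eqP ti; [right|left]; lra.
Qed.

Lemma cube_norm_continuous n : continuous (fun t : cube R n => `|centred t|).
Proof.
exact: continuous_comp_fun (@centred_continuous n) (@norm_continuous _ 'rV[R]_n).
Qed.

Lemma cube_boundary_closed n : closed (@cube_boundary R n).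
Proof.
rewrite (_ : @cube_boundary R n = (fun t : cube R n => `|centred t|) @^-1` [set 1]).
  have /continuous_closedP := @cube_norm_continuous n; apply.
  exact: (@closed_eq R 1).
by apply/seteqP; split=> t /cube_boundaryE.
Qed.

Lemma cube_compact_hausdorff n : compact [set: cube R n] /\ hausdorff_space (cube R n).
Proof.
split; last exact/set_type_hausdorff/norm_hausdorff.
have -> : [set: cube R n] = @to_cube n @` [set x | `|x| <= 1].
  apply/seteqP; split=> t // _; exists (centred t); last exact: centredK.
  exact: centred_norm.
apply: continuous_compact.
  by apply: continuous_subspaceT; exact: to_cube_continuous.
apply: bounded_closed_compact.
  by exists 1; split=> // M /ltW M1 x /= x1; exact: le_trans M1.
apply: (@preimage_closed _ _ (@Num.norm _ 'rV[R]_n) [set y | y <= 1]).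
  by move=> x _; exact: norm_continuous.
exact: closed_le.
Qed.

(** For [A] in [T], the part of the cylinder over [T] on which a homotopy
    starting from a given map and prescribed on [A] is defined. *)
Definition cyl (T : topologicalType) (A : set T) : set (T * I) :=
  [set p | A p.1 \/ \val p.2 = 0 :> R].

Definition box n : set (cube R n * I) := cyl (@cube_boundary R n).
Arguments box n : clear implicits.

Lemma side_closed (T : topologicalType) (A : set T) :
  closed A -> closed [set e : T * I | A e.1].
Proof. by move=> cA; have /continuous_closedP := @fst_continuous T I; exact. Qed.

Lemma bottom_closed (T : topologicalType) : closed [set e : T * I | \val e.2 = 0 :> R].
Proof.
have /continuous_closedP := continuous_comp_fun (@snd_continuous T I) unit_val_continuous.
by move=> /(_ [set y | y = 0] (@closed_eq R 0)).
Qed.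

Lemma top_closed (T : topologicalType) : closed [set e : T * I | \val e.2 = 1 :> R].
Proof.
have /continuous_closedP := continuous_comp_fun (@snd_continuous T I) unit_val_continuous.
by move=> /(_ [set y | y = 1] (@closed_eq R 1)).
Qed.

Lemma cyl_closed (T : topologicalType) (A : set T) : closed A -> closed (cyl A).
Proof. by move=> cA; apply: closedU; [exact: side_closed | exact: bottom_closed]. Qed.

Lemma box_closed n : closed (box n).
Proof. exact/cyl_closed/cube_boundary_closed. Qed.

Section Flow.
Variable n : nat.
Let E : topologicalType := (cube R n * I)%type.

(* The factor by which the point (0, 2) above the prism must be pushed away
   from [e] for it to reach the box. *)
Definition stretch (e : E) : R :=
  (Num.max ((2 - \val e.2) / 2) `|centred e.1|)^-1.

Definition flow (p : E * I) : E :=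
  let mu := Num.max 1 (stretch p.1 - \val p.2) in
  (to_cube (mu *: centred p.1.1), clamp (2 + mu * (\val p.1.2 - 2))).

Definition flow_time (e : E) : I := clamp (stretch e - 1).

Let depth (e : E) : R := Num.max ((2 - \val e.2) / 2) `|centred e.1|.

Let depth_itv e : 2^-1 <= depth e <= 1.
Proof.
have /andP[s0 s1] := unit_itv e.2; have t1 := centred_norm e.1.
apply/andP; split; first by rewrite le_max; apply/orP; left; lra.
by rewrite ge_max t1 andbT; lra.
Qed.

Let stretch_itv e : 1 <= stretch e <= 2.
Proof.
have /andP[d2 d1] := depth_itv e; have d0 : 0 < depth e by lra.
rewrite /stretch -/(depth e) invr_ge1 ?unitf_gt0 // d1 /=.
by rewrite -[leRHS]invrK lef_pV2 ?posrE // invr_gt0.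
Qed.

Lemma stretch_continuous : continuous stretch.
Proof.
apply: (@inv_cont R E depth) => [|e]; last first.
  by have /andP[d2 _] := depth_itv e; apply/eqP => d0; rewrite d0 in d2; lra.
apply: max_cont.
  apply: mul_cont; last exact: cst_cont.
  apply: sub_cont; first exact: cst_cont.
  exact: continuous_comp_fun (@snd_continuous _ _) unit_val_continuous.
exact: continuous_comp_fun (@fst_continuous _ _) (@cube_norm_continuous n).
Qed.

Lemma flow_time_continuous : continuous flow_time.
Proof.
by apply: clamp_cont; apply: sub_cont; [exact: stretch_continuous | exact: cst_cont].
Qed.

Lemma flow_continuous : continuous flow.
Proof.
have cmu : continuous (fun p : E * I => Num.max 1 (stretch p.1 - \val p.2)).
  apply: max_cont; first exact: cst_cont.
  apply: sub_cont.
    exact: continuous_comp_fun (@fst_continuous _ _) stretch_continuous.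
  exact: continuous_comp_fun (@snd_continuous _ _) unit_val_continuous.
have ce : continuous (fun p : E * I => p.1) by exact: fst_continuous.
apply: pair_continuous.
  apply: (continuous_comp_fun _ (@to_cube_continuous n)); apply: scale_cont => //.
  apply: continuous_comp_fun (@centred_continuous n).
  exact: continuous_comp_fun ce (@fst_continuous _ _).
apply: clamp_cont; apply: add_cont; first exact: cst_cont.
apply: mul_cont => //; apply: sub_cont; last exact: cst_cont.
apply: continuous_comp_fun unit_val_continuous.
exact: continuous_comp_fun ce (@snd_continuous _ _).
Qed.

Lemma flow_end e : flow (e, flow_time e) = e.
Proof.
have /andP[s1 s2] := stretch_itv e; rewrite /flow /flow_time /=.
rewrite clamp_valE; last by apply/andP; split; lra.
rewrite opprB addrC subrK maxxx scale1r centredK mul1r addrC subrK clamp_val_id.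
by case: e {s1 s2}.
Qed.

Lemma flow_start e : box n (flow (e, unit0)).
Proof.
have /andP[s1 s2] := stretch_itv e; have /andP[d2 d1] := depth_itv e.
have d0 : 0 < depth e by lra.
have -> : flow (e, unit0) = (to_cube (stretch e *: centred e.1),
    clamp (2 + stretch e * (\val e.2 - 2))).
  by rewrite /flow [X in _ - X]val_unit0 subr0 max_r.
have [h|h] := leP ((2 - \val e.2) / 2) `|centred e.1|.
  left; apply/cube_boundaryE => /=.
  have de : depth e = `|centred e.1| by rewrite /depth max_r.
  have ne : `|stretch e *: centred e.1| = 1.
    rewrite normrZ ger0_norm; last lra.
    by rewrite /stretch -/(depth e) de mulVf // -de gt_eqF.
  by rewrite to_cubeK // ne.
right; rewrite /=; have de : depth e = (2 - \val e.2) / 2 by rewrite /depth max_l // ltW.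
have key (s : R) : 2 - s != 0 -> 2 + ((2 - s) / 2)^-1 * (s - 2) = 0.
  move=> z; by rewrite invf_div -(opprB 2 s) mulrN divfK // subrr.
rewrite /stretch -/(depth e) de key ?clamp_valE ?lexx ?ler01 //.
by apply/eqP => z; rewrite de z mul0r ltxx in d0.
Qed.

Lemma flow_time_box e : box n e -> flow_time e = unit0.
Proof.
have /andP[s0 s1] := unit_itv e.2; have t1 := centred_norm e.1.
move=> eb; suff -> : flow_time e = clamp 0 by [].
rewrite /flow_time /stretch; congr clamp.
suff -> : Num.max ((2 - \val e.2) / 2) `|centred e.1| = 1 :> R.
  by rewrite invr1 subrr.
case: eb => [/cube_boundaryE ->|->]; first by rewrite max_r //; lra.
by rewrite subr0 divff ?pnatr_eq0 // max_l.
Qed.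

Lemma box_retraction : exists r, retraction (box n) r.
Proof.
exists (fun e => flow (e, unit0)); split.
- apply: (@continuous_comp_fun _ _ _ (fun e : E => (e, unit0))).
    by apply: pair_continuous; [exact: continuous_idfun | exact: cst_continuous].
  exact: flow_continuous.
- exact: flow_start.
- by move=> e /flow_time_box e0; rewrite -{1}e0 flow_end.
Qed.

End Flow.

Section Prism.
Variable n : nat.

Definition prism_row (p : cube R n * I) : 'rV[R]_n.+1 :=
  \row_i (if unlift ord0 i is Some j
          then (\val p.1 : 'rV[R]_n) ord0 j else \val p.2).

Lemma prism_row_cube (p : cube R n * I) : cube_set (prism_row p).
Proof.
move=> i; rewrite mxE; case: unliftP => [j _|_]; first exact: cube_itv.
exact: unit_itv.
Qed.

(** The zeroth coordinate is the one along which homotopy classes are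
    multiplied; it becomes the parameter of a homotopy. *)
Definition prism_to_cube (p : cube R n * I) : cube R n.+1 :=
  exist _ (prism_row p) (mem_set (prism_row_cube p)).

Definition cube_tail (t : cube R n.+1) : 'rV[R]_n :=
  \row_j (\val t : 'rV[R]_n.+1) ord0 (lift ord0 j).

Lemma cube_tail_cube (t : cube R n.+1) : cube_set (cube_tail t).
Proof. by move=> j; rewrite mxE; exact: cube_itv. Qed.

Definition cube_to_prism (t : cube R n.+1) : cube R n * I :=
  (exist _ (cube_tail t) (mem_set (cube_tail_cube t)), clamp (coord0 t)).

Lemma prism_to_cubeK : cancel prism_to_cube cube_to_prism.
Proof.
move=> [t s]; congr pair; apply: val_inj.
  by apply/rowP => j; rewrite /= !mxE liftK.
by rewrite /= /coord0 /= mxE unlift_none clamp_valE // unit_itv.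
Qed.

Lemma cube_to_prismK : cancel cube_to_prism prism_to_cube.
Proof.
move=> t; apply: val_inj; apply/rowP => i; rewrite /= mxE.
case: unliftP => [j ->|->] /=; first by rewrite mxE.
by rewrite clamp_valE // coord0_itv.
Qed.

Lemma prism_to_cube_continuous : continuous prism_to_cube.
Proof.
apply: continuous_set_val_inj; apply: row_cont => i.
apply: (@continuous_eqfun _ _ (fun p : cube R n * I => if unlift ord0 i is Some j
  then (\val p.1 : 'rV[R]_n) ord0 j else \val p.2)).
  by move=> p; rewrite /= mxE.
case: unlift => [j|].
  exact: continuous_comp_fun (@fst_continuous _ _) (@cube_coord_cont n j).
exact: continuous_comp_fun (@snd_continuous _ _) unit_val_continuous.
Qed.

Lemma cube_to_prism_continuous : continuous cube_to_prism.
Proof.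
apply: pair_continuous; last exact: clamp_cont (@coord0_continuous R n).
apply: continuous_set_val_inj; apply: row_cont => j.
apply: (@continuous_eqfun _ _
  (fun t : cube R n.+1 => (\val t : 'rV[R]_n.+1) ord0 (lift ord0 j))).
  by move=> t; rewrite /= mxE.
exact: cube_coord_cont.
Qed.

Definition prism_boundary : set (cube R n * I) :=
  [set p | box n p \/ \val p.2 = 1 :> R].

Lemma prism_boundaryE p : prism_boundary p <-> cube_boundary (prism_to_cube p).
Proof.
have coordj t s j : (\val (prism_to_cube (t, s)) : 'rV[R]_n.+1) ord0 (lift ord0 j) =
    (\val t : 'rV[R]_n) ord0 j by rewrite /= mxE liftK.
have coord00 t s : (\val (prism_to_cube (t, s)) : 'rV[R]_n.+1) ord0 ord0 = \val s.
  by rewrite /= mxE unlift_none.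
case: p => t s; split.
  move=> [[[i /= ti]|/= s0]|/= s1].
  - by exists (lift ord0 i); rewrite coordj.
  - by exists ord0; rewrite coord00; left.
  - by exists ord0; rewrite coord00; right.
move=> [i]; have [j ->|->] := unliftP ord0 i.
  by rewrite coordj => tj; left; left; exists j.
by rewrite coord00 => -[s0|s1]; [left; right | right].
Qed.

Lemma prism_boundary_closed : closed prism_boundary.
Proof.
by apply: closedU; [exact: box_closed | exact: top_closed].
Qed.

Lemma prism_cyl_retraction : exists r, retraction (cyl prism_boundary) r.
Proof.
have [r br] := box_retraction n.+1.
have cpair (S T : topologicalType) (g : S -> T) : continuous g ->
    continuous (fun p : S * I => (g p.1, p.2)).
  move=> cg; apply: pair_continuous; last exact: snd_continuous.
  exact: continuous_comp_fun (@fst_continuous _ _) cg.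
exists ((fun p : cube R n.+1 * I => (cube_to_prism p.1, p.2)) \o r \o
  (fun p : (cube R n * I) * I => (prism_to_cube p.1, p.2))).
apply: retraction_homeo br.
- exact: cpair prism_to_cube_continuous.
- exact: cpair cube_to_prism_continuous.
- by move=> [e s] /=; rewrite prism_to_cubeK.
- by move=> [t s] /=; rewrite cube_to_prismK.
- move=> [e s]; split=> [[/= /prism_boundaryE eb|/= s0]|[/= /prism_boundaryE eb|/= s0]];
    by [left|right].
Qed.

Lemma fills_prism (X Y : topologicalType) (p : X -> Y) :
  fills p (@cube_boundary R n.+1) <-> fills p prism_boundary.
Proof.
split; apply: fills_homeo.
- exact: cube_to_prism_continuous.
- exact: prism_to_cube_continuous.
- exact: prism_to_cubeK.
- by move=> t; rewrite prism_boundaryE cube_to_prismK.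
- exact: prism_boundary_closed.
- exact: prism_to_cube_continuous.
- exact: cube_to_prism_continuous.
- exact: cube_to_prismK.
- exact: prism_boundaryE.
- exact: cube_boundary_closed.
Qed.

End Prism.

Section DiskCube.
Variable n : nat.

Let to_disk_subproof (x : 'rV[R]_n) :
  disk_set ((Num.max 1 (euclid_norm x))^-1 *: x).
Proof.
have m0 : 0 < Num.max 1 (euclid_norm x) by rewrite lt_max ltr01.
rewrite /disk_set /= sq_normZ -[sq_norm x]sqr_sqrtr ?sq_norm_ge0 // -exprMn.
apply: exprn_ile1; first by rewrite mulr_ge0 ?sqrtr_ge0 // invr_ge0 ltW.
by rewrite mulrC ler_pdivrMr // mul1r le_max lexx orbT.
Qed.

Definition to_disk (x : 'rV[R]_n) : disk R n :=
  exist _ ((Num.max 1 (euclid_norm x))^-1 *: x) (mem_set (to_disk_subproof x)).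

Lemma to_disk_continuous : continuous to_disk.
Proof.
apply: continuous_set_val_inj; apply: scale_cont; last exact: continuous_idfun.
apply: inv_cont => [|x]; last by rewrite gt_eqF // lt_max ltr01.
by apply: max_cont; [exact: cst_cont | exact: euclid_norm_continuous].
Qed.

Lemma disk_norm (d : disk R n) : euclid_norm (\val d : 'rV[R]_n) <= 1.
Proof. by rewrite -[leRHS]sqrtr1; apply: ler_wsqrtr; exact: (set_valP d). Qed.

Lemma to_diskK (x : 'rV[R]_n) : euclid_norm x <= 1 -> \val (to_disk x) = x.
Proof. by move=> x1; rewrite /= max_l // invr1 scale1r. Qed.

Lemma val_diskK (d : disk R n) : to_disk (\val d) = d.
Proof. by apply: val_inj; rewrite to_diskK // disk_norm. Qed.

Definition disk_to_cube (d : disk R n) : cube R n :=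
  to_cube (rescale (@euclid_norm R n) (fun x => `|x|) (\val d)).

Definition cube_to_disk (t : cube R n) : disk R n :=
  to_disk (rescale (fun x => `|x|) (@euclid_norm R n) (centred t)).

Let supZ a (x : 'rV[R]_n) : 0 <= a -> `|a *: x| = a * `|x|.
Proof. by move=> a0; rewrite normrZ ger0_norm. Qed.

Let sup0 (x : 'rV[R]_n) : `|x| = 0 -> x = 0.
Proof. by move/eqP; rewrite normr_eq0 => /eqP. Qed.

Let rescale_norm (N M : 'rV[R]_n -> R) x :
  (forall a x, 0 <= a -> M (a *: x) = a * M x) -> (forall x, 0 <= N x) ->
  (forall x, 0 <= M x) -> (forall x, M x = 0 -> x = 0) -> N 0 = 0 ->
  M (rescale N M x) = N x.
Proof.
move=> MZ N0 M0 Mx N00; rewrite /rescale MZ ?divr_ge0 //.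
have [x0|x0] := eqVneq (M x) 0; last by rewrite divfK.
by rewrite x0 mulr0 (Mx _ x0) N00.
Qed.

Let eZ a (x : 'rV[R]_n) : 0 <= a -> euclid_norm (a *: x) = a * euclid_norm x.
Proof. exact: euclid_normZ. Qed.

Let e0 (x : 'rV[R]_n) : 0 <= euclid_norm x.
Proof. exact: sqrtr_ge0. Qed.

Let rescaled_disk_norm (d : disk R n) :
  `|rescale (@euclid_norm R n) (fun x => `|x|) (\val d)| = euclid_norm (\val d).
Proof. by apply: (@rescale_norm _ (fun x => `|x|)) => //; exact: euclid_norm0. Qed.

Lemma disk_to_cube_norm d : `|centred (disk_to_cube d)| = euclid_norm (\val d).
Proof. by rewrite to_cubeK rescaled_disk_norm // disk_norm. Qed.

Lemma disk_to_cubeK : cancel disk_to_cube cube_to_disk.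
Proof.
move=> d; rewrite /cube_to_disk to_cubeK; last first.
  by rewrite rescaled_disk_norm disk_norm.
rewrite (@rescaleK _ _ (@euclid_norm R n) (fun x => `|x|)) ?val_diskK //.
exact: euclid_norm_eq0.
Qed.

Lemma cube_to_diskK : cancel cube_to_disk disk_to_cube.
Proof.
move=> t; rewrite /disk_to_cube to_diskK; last first.
  rewrite (@rescale_norm (fun x => `|x|)) ?normr0 ?centred_norm //.
  exact: euclid_norm_eq0.
rewrite (@rescaleK _ _ (fun x => `|x|) (@euclid_norm R n)) ?centredK //.
exact: euclid_norm_eq0.
Qed.

Lemma disk_to_cube_continuous : continuous disk_to_cube.
Proof.
have [c c0 cP] := @euclid_le_sup R n.
have := @rescale_continuous R n (@euclid_norm R n) (fun x => `|x|) c.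
move=> /(_ (@euclid_norm_continuous R n) (@norm_continuous _ _) sup0) cr.
apply: (continuous_comp_fun _ (@to_cube_continuous n)).
apply: continuous_comp_fun (@set_val_continuous _ _) (cr _) => x.
rewrite divr_ge0 //=; have [->|x0] := eqVneq `|x| 0; first by rewrite invr0 mulr0.
by rewrite ler_pdivrMr // lt_neqAle eq_sym x0 /=.
Qed.

Lemma cube_to_disk_continuous : continuous cube_to_disk.
Proof.
have := @rescale_continuous R n (fun x => `|x|) (@euclid_norm R n) 1.
move=> /(_ (@norm_continuous _ _) (@euclid_norm_continuous R n) (@euclid_norm_eq0 R n)) cr.
apply: (continuous_comp_fun _ to_disk_continuous).
apply: continuous_comp_fun (@centred_continuous n) (cr _) => x.
rewrite divr_ge0 //=; have [->|x0] := eqVneq (euclid_norm x) 0.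
  by rewrite invr0 mulr0.
by rewrite ler_pdivrMr ?mul1r ?sup_le_euclid // lt_neqAle eq_sym x0 /=.
Qed.

Definition disk_boundary : set (disk R n) := [set d | ~ in_open_disk d].

Lemma disk_boundaryE (d : disk R n) :
  disk_boundary d <-> cube_boundary (disk_to_cube d).
Proof.
rewrite cube_boundaryE disk_to_cube_norm; split.
  by have [od []//|[s ->] _] := disk_cases d; rewrite /euclid_norm /= (set_valP s) sqrtr1.
move=> d1; rewrite /disk_boundary /= /in_open_disk.
rewrite -[sq_norm _]sqr_sqrtr ?sq_norm_ge0 // -/(euclid_norm _) d1 expr1n.
by rewrite ltxx.
Qed.

Lemma disk_boundary_closed : closed disk_boundary.
Proof.
rewrite (_ : disk_boundary = disk_to_cube @^-1` @cube_boundary R n).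
  move/continuous_closedP: disk_to_cube_continuous; apply.
  exact: cube_boundary_closed.
by apply/seteqP; split=> d /disk_boundaryE.
Qed.

End DiskCube.

End Cubes.

(** * Serre fibrations and acyclic fibrations in terms of cubes *)

Section Glue.
Variables (T X : topologicalType) (A B : set T) (f g : T -> X).

Definition glue (t : T) : X := if pselect (A t) then f t else g t.

Lemma glue_l t : A t -> glue t = f t.
Proof. by rewrite /glue; case: pselect. Qed.

Hypothesis fg : forall t, A t -> B t -> f t = g t.

Lemma glue_r t : B t -> glue t = g t.
Proof. by rewrite /glue; case: pselect => // At Bt; exact: fg. Qed.

Lemma continuous_on_glue :
  continuous_on A f -> continuous_on B g -> continuous_on (A `|` B) glue.
Proof.
move=> fA gB; apply: continuous_onU.
  by apply: continuous_on_eq fA => t At; rewrite glue_l.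
by apply: continuous_on_eq gB => t Bt; rewrite glue_r.
Qed.

End Glue.

Lemma pairl_continuous (S T : topologicalType) (t : T) :
  continuous (fun s : S => (s, t)).
Proof. by apply: pair_continuous; [exact: continuous_idfun | exact: cst_continuous]. Qed.

Section FunctionLifting.
Variable R : realType.
Local Notation I := (unit_interval R).

(** The homotopy on [A] and the map [g] together are defined on the part [cyl A]
    of the cylinder, to which the whole cylinder retracts. *)
Lemma homotopy_extension (T Z : topologicalType) (A : set T)
    (w : T * I -> Z) (g : T -> Z) :
  (exists r, retraction (@cyl R T A) r) -> closed A ->
  continuous_on [set e : T * I | A e.1] w -> continuous g ->
  (forall t, A t -> w (t, unit0 R) = g t) ->
  exists G : T * I -> Z, [/\ continuous G, forall t, G (t, unit0 R) = g t &
                             forall t s, A t -> G (t, s) = w (t, s)].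
Proof.
move=> [r [cr rc rid]] cA wA cg wg.
pose B : set (T * I) := [set e | \val e.2 = 0 :> R].
have agree e : A e.1 -> B e -> w e = g e.1.
  by case: e => t s /= At /= s0; rewrite (unit_eq0 s0 : s = unit0 R) wg.
exists (fun e => glue [set e : T * I | A e.1] w (fun e => g e.1) (r e)); split.
- apply: (continuous_on_comp cr rc); apply: continuous_on_glue => //.
  apply: continuous_on_closed; first exact: bottom_closed.
  exact: continuous_comp_fun (@fst_continuous _ _) cg.
- move=> t; have t0 : \val (t, unit0 R).2 = 0 :> R := val_unit0 R.
  by rewrite rid ?(glue_r agree) //; right.
- by move=> t s At; rewrite rid ?glue_l //; left.
Qed.

Definition path_lift (X Y : topologicalType) (p : X -> Y) (T : topologicalType) :
    Prop :=
  forall (g : T -> X) (H : T * I -> Y), continuous g -> continuous H ->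
  (forall t, p (g t) = H (t, unit0 R)) ->
  exists L : T * I -> X, [/\ continuous L, forall t, L (t, unit0 R) = g t &
                             forall q, p (L q) = H q].

Definition has_path_lifts (X Y : topologicalType) (p : X -> Y) : Prop :=
  forall n, path_lift p (disk R n).

Definition fills_boxes (X Y : topologicalType) (p : X -> Y) : Prop :=
  forall n, fills p (@box R n).

(** The second condition says nothing about the empty boundary of the
    0-dimensional cube when [X] is empty, since it speaks of functions on the
    whole cube; the first one makes up for this. *)
Definition acyclic (X Y : topologicalType) (p : X -> Y) : Prop :=
  (inhabited Y -> inhabited X) /\ forall n, fills p (@cube_boundary R n).

Section OneMap.
Variables (X Y : topologicalType) (p : X -> Y).

Lemma path_lift_retract (T T' : topologicalType) (sigma : T -> T')
    (rho : T' -> T) : continuous sigma -> continuous rho ->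
  cancel sigma rho -> path_lift p T' -> path_lift p T.
Proof.
move=> cs cr rs lift g H cg cH gH.
have cpair (S S' : topologicalType) (k : S -> S') : continuous k ->
    continuous (fun q : S * I => (k q.1, q.2)).
  move=> ck; apply: pair_continuous; last exact: snd_continuous.
  exact: continuous_comp_fun (@fst_continuous _ _) ck.
have [||t|L [cL L0 pL]] := lift (g \o rho) (fun q => H (rho q.1, q.2)).
- exact: continuous_comp_fun cr cg.
- exact: continuous_comp_fun (cpair _ _ _ cr) cH.
- exact: gH.
exists (fun q => L (sigma q.1, q.2)); split.
- exact: continuous_comp_fun (cpair _ _ _ cs) cL.
- by move=> t; rewrite L0 /= rs.
- by move=> [t s]; rewrite pL /= rs.
Qed.

(** The box is reached from any point of the prism along the flow, and the flow
    takes time zero exactly on the box: so a lift of paths starting on the box,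
    evaluated at the arrival time, fills the box. *)
Lemma has_path_lifts_fills_boxes : has_path_lifts p -> fills_boxes p.
Proof.
move=> lift n u v ub cv puv.
have liftE : path_lift p (cube R n * I)%type.
  apply: (@path_lift_retract _ (cube R n.+1) (@prism_to_cube R n)
    (@cube_to_prism R n)).
  - exact: prism_to_cube_continuous.
  - exact: cube_to_prism_continuous.
  - exact: prism_to_cubeK.
  apply: (path_lift_retract (@cube_to_disk_continuous R n.+1)
    (@disk_to_cube_continuous R n.+1)); first exact: cube_to_diskK.
  exact: lift.
have cf0 : continuous (fun e : cube R n * I => flow (e, unit0 R)).
  exact: continuous_comp_fun (@pairl_continuous _ _ _) (@flow_continuous R n).
have [||e|L [cL L0 pL]] := liftE (fun e => u (flow (e, unit0 R))) (v \o @flow R n).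
- by apply: continuous_on_comp ub => // e; exact: flow_start.
- exact: continuous_comp_fun (@flow_continuous R n) cv.
- by apply: puv; exact: flow_start.
exists (fun e => L (e, flow_time e)); split.
- apply: continuous_comp_fun cL; apply: pair_continuous; first exact: continuous_idfun.
  exact: flow_time_continuous.
- by move=> e eb; rewrite flow_time_box // L0 -{1}(flow_time_box eb) flow_end.
- by move=> e; rewrite pL /= flow_end.
Qed.

Lemma fills_boxes_has_path_lifts : fills_boxes p -> has_path_lifts p.
Proof.
move=> lift n; apply: (path_lift_retract (@disk_to_cube_continuous R n)
  (@cube_to_disk_continuous R n)); first exact: disk_to_cubeK.
move=> g H cg cH gH.
(* The prism is a retract of itself by a map that collapses the box to the
   bottom. *)
pose q (e : cube R n * I) : cube R n * I := (to_cube (2 *: centred e.1),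
  clamp (\val e.2 * Num.min 1 (2 * (1 - `|centred e.1|)))).
pose mid (t : cube R n) : cube R n := to_cube (2^-1 *: centred t).
have cctr : continuous (fun e : cube R n * I => centred e.1).
  exact: continuous_comp_fun (@fst_continuous _ _) (@centred_continuous R n).
have cq : continuous q.
  apply: pair_continuous.
    apply: (continuous_comp_fun _ (@to_cube_continuous R n)).
    by apply: scale_cont => //; exact: cst_cont.
  apply: clamp_cont; apply: mul_cont.
    exact: continuous_comp_fun (@snd_continuous _ _) (@unit_val_continuous R).
  apply: min_cont; first exact: cst_cont.
  apply: mul_cont; first exact: cst_cont.
  apply: sub_cont; first exact: cst_cont.
  exact: continuous_comp_fun (@fst_continuous _ _) (@cube_norm_continuous R n).
have qb e : box e -> (q e).2 = unit0 R.
  rewrite /q /unit0 => -[/cube_boundaryE ->|->] /=; last by rewrite mul0r.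
  by rewrite subrr mulr0 min_r // mulr0.
have [||e eb|L [cL Lb pL]] := lift n (fun e => g (q e).1) (H \o q).
- apply: continuous_on_closed; first exact: box_closed.
  exact: continuous_comp_fun (continuous_comp_fun cq (@fst_continuous _ _)) cg.
- exact: continuous_comp_fun cq cH.
- by rewrite gH -(qb e eb).
have midE (t : cube R n) : centred (mid t) = 2^-1 *: centred t.
  have t1 := centred_norm t.
  by rewrite to_cubeK // normrZ ger0_norm ?invr_ge0 //; lra.
have qmid t s : q (mid t, s) = (t, s).
  have t1 := centred_norm t; have t0 := normr_ge0 (centred t).
  rewrite /q /= midE scalerA divff ?pnatr_eq0 // scale1r centredK.
  rewrite normrZ ger0_norm ?invr_ge0 // min_l; last by lra.
  by rewrite mulr1 clamp_val_id.
exists (fun e => L (mid e.1, e.2)); split.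
- apply: continuous_comp_fun cL; apply: pair_continuous; last exact: snd_continuous.
  apply: continuous_comp_fun (@to_cube_continuous R n).
  by apply: scale_cont => //; exact: cst_cont.
- by move=> t; rewrite Lb ?qmid //; right; exact: val_unit0.
- by move=> [t s]; rewrite pL /= qmid.
Qed.

(** A box is filled by filling first its missing face and then the interior. *)
Lemma acyclic_fills_boxes : acyclic p -> fills_boxes p.
Proof.
move=> [_ pf] n u v ub cv puv.
have top t : @cube_boundary R n t -> box (t, unit1 R) by left.
have [||t tb|m [cm mu pm]] := pf n (fun t => u (t, unit1 R)) (fun t => v (t, unit1 R)).
- apply: continuous_on_comp_on ub => //; first exact: pairl_continuous.
  exact: cube_boundary_closed.
- exact: continuous_comp_fun (@pairl_continuous _ _ _) cv.
- by apply: puv; exact: top.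
pose B : set (cube R n * I) := [set e | \val e.2 = 1 :> R].
have um e : box e -> B e -> u e = m e.1.
  case: e => t s [/= tb|/= s0] /= s1; last first.
    by case: (elimN eqP (oner_neq0 R) (etrans (esym s1) s0)).
  by rewrite mu // (unit_eq1 s1 : s = unit1 R).
have cB : closed B by exact: top_closed.
have [||e eb|h [ch hw ph]] :=
    (@fills_prism R n X Y p).1 (pf n.+1) (glue (@box R n) u (fun e => m e.1)) v.
- apply: continuous_on_glue => //.
  apply: continuous_on_closed => //.
  exact: continuous_comp_fun (@fst_continuous _ _) cm.
- by [].
- have [be|nbe] := pselect (box e); first by rewrite glue_l // puv.
  case: eb => // e1; rewrite (glue_r um) // pm; case: e e1 {nbe} => t s /= s1.
  by rewrite (unit_eq1 s1 : s = unit1 R).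
exists h; split=> // e eb; rewrite hw; last by left.
by rewrite glue_l.
Qed.

(** Whether the boundary values [u] extend to a lift of [v] depends only on the
    homotopy class of the pair: the homotopy of the boundary values is extended
    to one of [v], and its reverse is lifted, starting with the lift at the
    other end. *)
Lemma fills_transport n (u : cube R n * I -> X) (v : cube R n -> Y) :
  continuous p -> fills_boxes p ->
  continuous_on [set e | cube_boundary e.1] u -> continuous v ->
  (forall t, cube_boundary t -> p (u (t, unit0 R)) = v t) ->
  (forall v' : cube R n -> Y, continuous v' ->
    (forall t, cube_boundary t -> p (u (t, unit1 R)) = v' t) ->
    exists h, [/\ continuous h, forall t, cube_boundary t -> h t = u (t, unit1 R) &
                  forall t, p (h t) = v' t]) ->
  exists h, [/\ continuous h, forall t, cube_boundary t -> h t = u (t, unit0 R) &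
                forall t, p (h t) = v t].
Proof.
move=> cp pb ub cv pu0 sol1.
pose A : set (cube R n * I) := [set e | cube_boundary e.1].
pose B : set (cube R n * I) := [set e | \val e.2 = 0 :> R].
have cA : closed A := side_closed (@cube_boundary_closed R n).
have cB : closed B by exact: bottom_closed.
have [V [cV V0 VA]] := homotopy_extension (box_retraction R n)
  (@cube_boundary_closed R n) (continuous_on_post cp ub) cv pu0.
have [||h1 [ch1 h1u ph1]] := sol1 (fun t => V (t, unit1 R)).
- exact: continuous_comp_fun (@pairl_continuous _ _ _) cV.
- by move=> t tb; rewrite VA.
have cflip : continuous (fun e : cube R n * I => (e.1, flip e.2)).
  apply: pair_continuous; first exact: fst_continuous.
  exact: continuous_comp_fun (@snd_continuous _ _) (@flip_continuous R).
pose u' e := u (e.1, flip e.2).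
have u'h1 e : A e -> B e -> u' e = h1 e.1.
  by case: e => t s /= tb /= s0; rewrite /u' /= (unit_eq0 s0 : s = unit0 R) flip0 h1u.
have [||e eb|L [cL LU pL]] := pb n (glue A u' (fun e => h1 e.1))
    (fun e => V (e.1, flip e.2)).
- apply: continuous_on_glue => //; first exact: continuous_on_comp_on cflip cA _ ub.
  apply: continuous_on_closed => //.
  exact: continuous_comp_fun (@fst_continuous _ _) ch1.
- exact: continuous_comp_fun cflip cV.
- case: eb => [tb|s0]; first by rewrite glue_l // VA.
  rewrite (glue_r u'h1) // ph1; case: e s0 => t s /= s0.
  by rewrite (unit_eq0 s0 : s = unit0 R) flip0.
exists (fun t => L (t, unit1 R)); split.
- exact: continuous_comp_fun (@pairl_continuous _ _ _) cL.
- move=> t tb; rewrite LU; last by left.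
  by rewrite glue_l // /u' /= flip1.
- by move=> t; rewrite pL /= flip1 V0.
Qed.

End OneMap.
End FunctionLifting.

(** * The mapping path space *)

Section PathSpace.
Variables (R : realType) (k : space_kind).
Local Notation I := (unit_interval R).

Section OnePathSpace.
Variables (X Y : Top k) (f : mor X Y).

Definition path_points : Type :=
  {z : sval X * (I -> sval Y) | continuous z.2 /\ z.2 (unit0 R) = app f z.1}.

Definition path_start_fun (z : path_points) : sval X := (sval z).1.
Definition path_eval (z : path_points) (s : I) : sval Y := (sval z).2 s.

Lemma path_eq z w : path_start_fun z = path_start_fun w ->
  path_eval z =1 path_eval w -> z = w.
Proof.
move=> zw /funext zw'; apply: sval_eq; move: zw zw'.
rewrite /path_start_fun /path_eval; move: (sval z) (sval w) => [x g] [y h] /= -> eq_gh.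
by congr pair; exact: eq_gh.
Qed.

(** The compact-open topology, or its compactly generated modification, as the
    finest one for which a homotopy parametrized by a probe gives a map from
    this probe. *)
Definition path_tests : tests path_points := fun K g =>
  [/\ probe k K, continuous (fun t => path_start_fun (g t)) &
      continuous (fun q : (K * I)%type => path_eval (g q.1) q.2)].

Definition path_space : topologicalType := final path_tests.

Lemma path_start_continuous : continuous (path_start_fun : path_space -> _).
Proof. by apply: final_continuous => K g []. Qed.

Lemma path_eval_continuous1 (z : path_space) : continuous (path_eval z).
Proof. exact: (svalP z).1. Qed.

Lemma path_eval0 (z : path_space) : path_eval z (unit0 R) = app f (path_start_fun z).
Proof. exact: (svalP z).2. Qed.

(** The paths sending a compact set [J] of times into an open set [U] form an
    open set, by the tube lemma for each probe. *)
Lemma path_compact_open (J : set I) (U : set (sval Y)) :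
  compact J -> open U ->
  open [set z : path_space | forall s, J s -> U (path_eval z s)].
Proof.
move=> cJ oU; apply/final_openE => K g [_ _ cg].
rewrite openE => t0 Jt0; move: cJ => /compact_near_coveringP cJ.
apply: (cJ _ (nbhs t0) (fun t s => U (path_eval (g t) s))) => s Js.
have := cg (t0, s) U (open_nbhs_nbhs (conj oU (Jt0 s Js))).
move=> [[A B] /= [nA nB] AB]; exists (B, A) => //= -[s' t'] /= [Bs At].
exact: (AB (t', s')).
Qed.

Lemma path_eval_continuous :
  continuous (fun q : (path_space * I)%type => path_eval q.1 q.2).
Proof.
move=> [z0 s0] U0 /=; rewrite nbhsE => -[U [oU Uz0] UU0].
have [cI hI] := unit_compact_hausdorff R.
have : nbhs s0 (path_eval z0 @^-1` U).
  by apply: path_eval_continuous1; apply: open_nbhs_nbhs.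
have := @compact_regular I s0 setT hI cI filterT => /[apply] -[N nN NU].
exists ([set z | forall s, closure N s -> U (path_eval z s)], closure N).
  split=> /=.
    apply: open_nbhs_nbhs; split; last by move=> s /NU.
    apply: path_compact_open => //.
    by apply: (subclosed_compact _ cI) => //; exact: closed_closure.
  by apply: filterS nN; exact: subset_closure.
by move=> [z s] /= [zN Ns]; apply: UU0; exact: zN.
Qed.

Lemma path_eval_cont (S : topologicalType) (z : S -> path_space) (s : S -> I) :
  continuous z -> continuous s -> continuous (fun t => path_eval (z t) (s t)).
Proof.
move=> cz cs; apply: (@continuous_comp_fun _ _ _ (fun t => (z t, s t))
  (fun q : (path_space * I)%type => path_eval q.1 q.2)).
  exact: pair_continuous.
exact: path_eval_continuous.
Qed.

Lemma path_is_space : is_space k path_space.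
Proof.
apply: final_is_space => [K g [pK _ _]|]; first exact: probe_is_space.
apply: separated_by_maps => z w zw.
have [xx|xx] := pselect (path_start_fun z = path_start_fun w); last first.
  exists (sval X), path_start_fun; split=> //.
    exact: is_space_separated (svalP X).
  exact: path_start_continuous.
have [s zws] : exists s, path_eval z s <> path_eval w s.
  apply: contra_notP zw => zw; apply: path_eq xx _ => s.
  by apply: contrapT => zws; apply: zw; exists s.
exists (sval Y), (fun z => path_eval z s); split=> //.
  exact: is_space_separated (svalP Y).
exact: continuous_comp_fun (@pairl_continuous _ _ s) path_eval_continuous.
Qed.

Definition path_ob : Top k := exist (is_space k) path_space path_is_space.

Section Transpose.
Variables (T : topologicalType) (a : T -> sval X) (H : (T * I)%type -> sval Y).
Hypotheses (ca : continuous a) (cH : continuous H).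
Hypothesis aH : forall t, H (t, unit0 R) = app f (a t).

Lemma transpose_subproof t :
  continuous (fun s => H (t, s)) /\ H (t, unit0 R) = app f (a t).
Proof.
split=> //; apply: (continuous_comp_fun _ cH).
by apply: pair_continuous; [exact: cst_continuous | exact: continuous_idfun].
Qed.

Definition transpose (t : T) : path_space :=
  exist (fun z : sval X * (I -> sval Y) =>
           continuous z.2 /\ z.2 (unit0 R) = app f z.1)
    (a t, fun s => H (t, s)) (transpose_subproof t).

Lemma transpose_continuous : is_space k T -> continuous transpose.
Proof.
move=> Tk; apply: (probe_continuous Tk) => K g pK cg; apply: final_test; split=> //.
  exact: continuous_comp_fun cg ca.
apply: (continuous_comp_fun _ cH); apply: pair_continuous; last exact: snd_continuous.
exact: continuous_comp_fun (@fst_continuous _ _) cg.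
Qed.

End Transpose.

Definition path_start : mor path_ob X :=
  @mk_mor k path_ob X _ path_start_continuous.

Lemma path_end_continuous :
  continuous (fun z : path_space => path_eval z (unit1 R)).
Proof. exact: continuous_comp_fun (@pairl_continuous _ _ _) path_eval_continuous. Qed.

Definition path_end : mor path_ob Y := @mk_mor k path_ob Y _ path_end_continuous.

Lemma path_const_subproof :
  continuous (fun q : (sval X * I)%type => app f q.1).
Proof. exact: continuous_comp_fun (@fst_continuous _ _) (app_continuous f). Qed.

Definition path_const : mor X path_ob :=
  @mk_mor k X path_ob
    (transpose (a := id) (H := fun q => app f q.1) path_const_subproof (fun _ => erefl))
    (transpose_continuous (@continuous_idfun _) (svalP X)).

Lemma path_const_eval x s : path_eval (app path_const x) s = app f x.
Proof. by []. Qed.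

Lemma path_const_end : path_end ∘ path_const = f.
Proof. exact: mor_eq. Qed.

(** Stopping a path at time [s], and running it at reduced speed. *)
Lemma slow_subproof (z : path_points) (s : I) :
  continuous (fun r : I => path_eval z (clamp (\val r * \val s))) /\
  path_eval z (clamp (\val (unit0 R) * \val s)) = app f (path_start_fun z).
Proof.
split; last by rewrite val_unit0 mul0r -/(unit0 R); exact: path_eval0.
apply: (continuous_comp_fun _ (@path_eval_continuous1 z)); apply: clamp_cont.
by apply: mul_cont; [exact: unit_val_continuous | exact: cst_cont].
Qed.

Definition slow (z : path_points) (s : I) : path_points :=
  exist (fun z : sval X * (I -> sval Y) =>
           continuous z.2 /\ z.2 (unit0 R) = app f z.1)
    (path_start_fun z, fun r => path_eval z (clamp (\val r * \val s)))
    (slow_subproof z s).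

Lemma slow_eval z s r : path_eval (slow z s) r = path_eval z (clamp (\val r * \val s)).
Proof. by []. Qed.

Lemma slow1 z : slow z (unit1 R) = z.
Proof.
by apply: path_eq => // r; rewrite slow_eval val_unit1 mulr1 clamp_val_id.
Qed.

Lemma slow0 z : slow z (unit0 R) = app path_const (path_start_fun z).
Proof.
apply: path_eq => // r; rewrite slow_eval val_unit0 mulr0 path_const_eval.
exact: path_eval0.
Qed.

Lemma slow_const x s : slow (app path_const x) s = app path_const x.
Proof. exact: path_eq. Qed.

Lemma slow_continuous (T : topologicalType) (u : T -> path_space) (s : T -> I) :
  is_space k T -> continuous u -> continuous s ->
  continuous (fun t => slow (u t) (s t) : path_space).
Proof.
move=> Tk cu cs.
have ca : continuous (fun t => path_start_fun (u t)).
  exact: continuous_comp_fun cu path_start_continuous.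
pose H (q : (T * I)%type) := path_eval (u q.1) (clamp (\val q.2 * \val (s q.1))).
have cH : continuous H.
  apply: path_eval_cont.
    exact: continuous_comp_fun (@fst_continuous _ _) cu.
  apply: clamp_cont; apply: mul_cont.
    exact: continuous_comp_fun (@snd_continuous _ _) (@unit_val_continuous R).
  apply: continuous_comp_fun (@unit_val_continuous R).
  exact: continuous_comp_fun (@fst_continuous _ _) cs.
have aH t : H (t, unit0 R) = app f (path_start_fun (u t)).
  exact: (slow_subproof (u t) (s t)).2.
apply: continuous_eqfun (transpose_continuous (cH := cH) (aH := aH) ca Tk) => t.
exact: path_eq.
Qed.

(** A homotopy of end points is appended to the paths. *)
Lemma path_end_path_lifts : has_path_lifts R (app path_end).
Proof.
move=> n g H cg cH gH; pose T := (disk R n * I)%type.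
have chT : compact [set: T] /\ hausdorff_space T.
  apply: compact_hausdorff_prod (unit_compact_hausdorff R).
  by split; [exact: disk_compact | exact: disk_hausdorff].
have Tk : is_space k T by exact: compact_hausdorff_is_space chT.1 chT.2.
(* The path g d followed by H (d, -) up to time t, at speed 1 + t. *)
pose tau (q : (T * I)%type) : R := \val q.2 * (1 + \val q.1.2).
have tauE t s : tau (t, s) = \val s * (1 + \val t.2) by [].
have cq1 : continuous (fun q : (T * I)%type => q.1.1).
  exact: continuous_comp_fun (@fst_continuous _ _) (@fst_continuous _ _).
have ctau : continuous tau.
  apply: mul_cont.
    exact: continuous_comp_fun (@snd_continuous _ _) (@unit_val_continuous R).
  apply: add_cont; first exact: cst_cont.
  apply: continuous_comp_fun (@unit_val_continuous R).
  exact: continuous_comp_fun (@fst_continuous _ _) (@snd_continuous _ _).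
pose P (q : (T * I)%type) : sval Y := if tau q <= 1
  then path_eval (g q.1.1) (clamp (tau q)) else H (q.1.1, clamp (tau q - 1)).
have cP : continuous P.
  apply: (glue_continuous ctau).
  - apply: path_eval_cont.
      exact: continuous_comp_fun cq1 cg.
    exact: clamp_cont.
  - apply: (@continuous_comp_fun _ _ _ (fun q : (T * I)%type =>
      (q.1.1, clamp (tau q - 1))) H) => //; apply: pair_continuous => //.
    by apply: clamp_cont; apply: sub_cont => //; exact: cst_cont.
  - by move=> q ->; rewrite subrr -/(unit0 R) -/(unit1 R) -gH.
have ca : continuous (fun t : T => path_start_fun (g t.1)).
  apply: continuous_comp_fun path_start_continuous.
  exact: continuous_comp_fun (@fst_continuous _ _) cg.
have aP t : P (t, unit0 R) = app f (path_start_fun (g t.1)).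
  by rewrite /P tauE val_unit0 mul0r ler01; exact: path_eval0.
exists (transpose cP aP); split.
- exact: transpose_continuous.
- move=> d; apply: path_eq => //= s.
  have /andP[s0 s1] := unit_itv s.
  change (P ((d, unit0 R), s) = path_eval (g d) s).
  by rewrite /P tauE [X in 1 + X]val_unit0 addr0 mulr1 s1 clamp_val_id.
- move=> [d t]; change (P ((d, t), unit1 R) = H (d, t)).
  have /andP[t0 t1] := unit_itv t.
  rewrite /P tauE val_unit1 mul1r; case: ifPn => [h|_].
    have t00 : \val t = 0 :> R.
      by apply/le_anti; rewrite t0 andbT -(lerD2l 1) addr0.
    by rewrite (unit_eq0 t00) val_unit0 addr0 -gH.
  by rewrite addrC addKr clamp_val_id.
Qed.

End OnePathSpace.

Section PathMap.
Variables (X Y X' Y' : Top k) (f : mor X Y) (f' : mor X' Y').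
Variables (a : mor X X') (b : mor Y Y').
Hypothesis e : b ∘ f = f' ∘ a.

Lemma path_map_subproof1 :
  continuous (fun z : path_space f => app a (path_start_fun z)).
Proof. exact: continuous_comp_fun (@path_start_continuous _ _ f) (app_continuous a). Qed.

Lemma path_map_subproof2 :
  continuous (fun q : (path_space f * I)%type => app b (path_eval q.1 q.2)).
Proof. exact: continuous_comp_fun (@path_eval_continuous _ _ f) (app_continuous b). Qed.

Lemma path_map_subproof3 (z : path_space f) :
  app b (path_eval z (unit0 R)) = app f' (app a (path_start_fun z)).
Proof. by rewrite path_eval0; exact: (app_eq e). Qed.

Definition path_map : mor (path_ob f) (path_ob f') :=
  @mk_mor k (path_ob f) (path_ob f')
    (transpose path_map_subproof2 path_map_subproof3)
    (transpose_continuous path_map_subproof1 (@path_is_space _ _ f)).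

Lemma path_map_eval z s : path_eval (app path_map z) s = app b (path_eval z s).
Proof. by []. Qed.

Lemma path_map_const : path_map ∘ path_const f = path_const f' ∘ a.
Proof. by apply: mor_eq => x; apply: path_eq => // s; exact: (app_eq e). Qed.

Lemma path_map_end : path_end f' ∘ path_map = b ∘ path_end f.
Proof. exact: mor_eq. Qed.

End PathMap.
End PathSpace.

(** * Compression of cubes and acyclic fibrations *)

Section Compression.
Variable R : realType.
Local Notation I := (unit_interval R).

(** Every cube in [Y] with boundary lifted to [X] is homotopic, relative to the
    boundary, to the image of a cube in [X]. This makes no mention of base
    points, and characterizes the weak homotopy equivalences. *)
Definition compressible (X Y : topologicalType) (f : X -> Y) : Prop :=
  (inhabited Y -> inhabited X) /\
  forall n (u : cube R n -> X) (v : cube R n -> Y),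
    continuous_on (@cube_boundary R n) u -> continuous v ->
    (forall t, cube_boundary t -> f (u t) = v t) ->
    exists (h : cube R n -> X) (K : cube R n * I -> Y),
      [/\ continuous h, continuous K, forall t, cube_boundary t -> h t = u t,
          forall t, K (t, unit0 R) = f (h t) /\ K (t, unit1 R) = v t &
          forall t s, cube_boundary t -> K (t, s) = v t].

Lemma acyclic_compressible (X Y : topologicalType) (f : X -> Y) :
  acyclic R f -> compressible f.
Proof.
move=> [ne ff]; split=> // n u v ub cv fuv.
have [h [ch hu fh]] := ff n u v ub cv fuv.
exists h, (fun e => v e.1); split=> //.
exact: continuous_comp_fun (@fst_continuous _ _) cv.
Qed.

(** A compression gives a filler up to a homotopy, relative to the boundary, of
    its image; lifting this homotopy corrects the filler. *)
Lemma fibration_compressible (X Y : topologicalType) (p : X -> Y) :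
  fills_boxes R p -> compressible p -> acyclic R p.
Proof.
move=> pb [ne pc]; split=> // n u v ub cv puv.
have [h [K [ch cK hu K01 Kb]]] := pc n u v ub cv puv.
pose A : set (cube R n * I) := [set e | cube_boundary e.1].
pose B : set (cube R n * I) := [set e | \val e.2 = 0 :> R].
have cA : closed A := side_closed (@cube_boundary_closed R n).
have cB : closed B by exact: bottom_closed.
have uh e : A e -> B e -> u e.1 = h e.1 by move=> Ae _; rewrite hu.
have [||e eb|L [cL LU pL]] := pb n (glue A (fun e => u e.1) (fun e => h e.1)) K.
- apply: continuous_on_glue => //.
    by apply: continuous_on_comp_on ub => //; exact: fst_continuous.
  apply: continuous_on_closed => //.
  exact: continuous_comp_fun (@fst_continuous _ _) ch.
- by [].
- case: e eb => t s [/= tb|/= s0]; first by rewrite glue_l //= puv // Kb.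
  rewrite (glue_r uh) //= -(K01 t).1.
  by rewrite (unit_eq0 s0 : s = unit0 R).
exists (fun t => L (t, unit1 R)); split.
- exact: continuous_comp_fun (@pairl_continuous _ _ _) cL.
- by move=> t tb; rewrite LU ?glue_l //; left.
- by move=> t; rewrite pL (K01 t).2.
Qed.

Variable k : space_kind.

Lemma cube_is_space n : is_space k (cube R n).
Proof.
have [cc hc] := cube_compact_hausdorff R n.
exact: compact_hausdorff_is_space.
Qed.

(** A compression of [v] for the boundary values [u] is a filler for [path_end f]
    with constant paths on the boundary. *)
Lemma lifts_compressible (X Y : Top k) (f : mor X Y) :
  (inhabited (sval Y) -> inhabited (sval X)) ->
  (forall n (u : cube R n -> sval X) (v : cube R n -> sval Y),
    continuous_on (@cube_boundary R n) u -> continuous v ->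
    (forall t, cube_boundary t -> app f (u t) = v t) ->
    exists h : cube R n -> path_space R f,
      [/\ continuous h, forall t, cube_boundary t -> h t = app (path_const R f) (u t) &
          forall t, app (path_end R f) (h t) = v t]) ->
  compressible (app f).
Proof.
move=> ne lift; split=> // n u v ub cv fuv.
have [h [ch hu ph]] := lift n u v ub cv fuv.
exists (fun t => path_start_fun (h t)), (fun e => path_eval (h e.1) e.2); split.
- exact: continuous_comp_fun ch (app_continuous (path_start R f)).
- apply: path_eval_cont; last exact: snd_continuous.
  exact: continuous_comp_fun (@fst_continuous _ _) ch.
- by move=> t /hu ->.
- by move=> t; rewrite path_eval0 -ph.
- by move=> t s tb; rewrite hu // path_const_eval fuv.
Qed.

(** A filler for [path_end f] is a compression for [f] whose homotopy need not
    be constant on the boundary, but follows the given paths there. Shrinking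
    these paths to constant ones reduces the former to the latter. *)
Lemma path_end_acyclic (X Y : Top k) (f : mor X Y) :
  acyclic R (app (path_end R f)) <-> compressible (app f).
Proof.
split=> [[ne fp]|[ne fc]].
  apply: lifts_compressible => [/ne[z]|n u v ub cv fuv].
    exact: inhabits (app (path_start R f) z).
  have [||t tb|h [ch hu ph]] := fp n (fun t => app (path_const R f) (u t)) v.
  - exact: continuous_on_post (app_continuous _) ub.
  - by [].
  - by rewrite -fuv.
  by exists h.
split=> [/ne[x]|n u v ub cv fuv]; first exact: inhabits (app (path_const R f) x).
(* Run the boundary paths for a shorter and shorter time. *)
pose w (e : cube R n * I) : path_space R f := slow (u e.1) (flip e.2).
have wb : continuous_on [set e : cube R n * I | cube_boundary e.1] w.
  have ch := cube_compact_hausdorff R n.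
  apply: continuous_on_cylinder => //.
  - exact: unit_compact_hausdorff.
  - exact: cube_boundary_closed.
  have [cA hA] := compact_hausdorff_prod
    (closed_compact_subspace ch.1 ch.2 (@cube_boundary_closed R n))
    (unit_compact_hausdorff R).
  apply: slow_continuous.
  - exact: compact_hausdorff_is_space.
  - exact: continuous_comp_fun (@fst_continuous _ _) (continuous_on_val ub).
  - exact: continuous_comp_fun (@snd_continuous _ _) (@flip_continuous R).
have w0 t : w (t, unit0 R) = u t by rewrite /w /= flip0 slow1.
have w1 t : w (t, unit1 R) = app (path_const R f) (path_start_fun (u t)).
  by rewrite /w /= flip1 slow0.
have := @fills_transport R _ _ (app (path_end R f)) n w v.
case=> //.
- exact: app_continuous.
- exact/has_path_lifts_fills_boxes/path_end_path_lifts.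
- by move=> t tb; rewrite w0 fuv.
- move=> v' cv' wv'.
  have [||t tb|h [K [ch cK hu K01 Kb]]] := fc n (fun t => path_start_fun (u t)) v'.
  + exact: continuous_on_post (app_continuous (path_start R f)) ub.
  + by [].
  + by have := wv' t tb; rewrite w1.
  have Kh t : K (t, unit0 R) = app f (h t) := (K01 t).1.
  exists (transpose cK Kh); split.
  + exact: transpose_continuous (cube_is_space n).
  + move=> t tb; rewrite w1; apply: path_eq => [|s]; first exact: hu.
    rewrite path_const_eval; change (K (t, s) = app f (path_start_fun (u t))).
    by rewrite Kb // -(wv' t tb) w1.
  + by move=> t; exact: (K01 t).2.
- by move=> h [ch hw ph]; exists h; split=> // t tb; rewrite hw // w0.
Qed.

Section PathOfFibration.
Variables (X Y : Top k) (p : mor X Y).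

Lemma path_square : p ∘ idm X = p ∘ idm X.
Proof. by []. Qed.

Definition path_push : mor (path_ob R (idm X)) (path_ob R p) :=
  @path_map R k X X X Y (idm X) p (idm X) p path_square.

(** The map of path spaces induced by a fibration [p] is an acyclic fibration:
    to fill a cube in the target is to fill a box in the total space of [p]. *)
Lemma path_push_acyclic : fills_boxes R (app p) -> acyclic R (app path_push).
Proof.
move=> pb; split=> [[z]|n u v ub cv puv].
  exact: inhabits (app (path_const R (idm X)) (app (path_start R p) z)).
pose A : set (cube R n * I) := [set e | cube_boundary e.1].
pose B : set (cube R n * I) := [set e | \val e.2 = 0 :> R].
have cA : closed A := side_closed (@cube_boundary_closed R n).
have cB : closed B by exact: bottom_closed.
have ustart t : cube_boundary t -> path_start_fun (v t) = path_start_fun (u t).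
  by move=> tb; rewrite -puv.
have ueval t s : cube_boundary t -> path_eval (v t) s = app p (path_eval (u t) s).
  by move=> tb; rewrite -puv.
have agree e : A e -> B e -> path_eval (u e.1) e.2 = path_start_fun (v e.1).
  case: e => t s /= tb /= s0; rewrite (unit_eq0 s0 : s = unit0 R) path_eval0.
  by rewrite app_id ustart.
have [||e eb|L [cL LU pL]] := pb n
    (glue A (fun e => path_eval (u e.1) e.2) (fun e => path_start_fun (v e.1)))
    (fun e => path_eval (v e.1) e.2).
- apply: continuous_on_glue => //.
    have ch := cube_compact_hausdorff R n.
    apply: continuous_on_cylinder => //.
      exact: unit_compact_hausdorff.
      exact: cube_boundary_closed.
    apply: (path_eval_cont (z := fun q : (@cube_boundary R n * I)%type => u (\val q.1)));
      last exact: snd_continuous.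
    exact: continuous_comp_fun (@fst_continuous _ _) (continuous_on_val ub).
  apply: continuous_on_closed => //.
  apply: continuous_comp_fun (app_continuous (path_start R p)).
  exact: continuous_comp_fun (@fst_continuous _ _) cv.
- apply: path_eval_cont; last exact: snd_continuous.
  exact: continuous_comp_fun (@fst_continuous _ _) cv.
- case: e eb => t s [/= tb|/= s0]; first by rewrite glue_l //= ueval.
  by rewrite (glue_r agree) //= (unit_eq0 s0 : s = unit0 R) path_eval0.
have L0 t : L (t, unit0 R) = path_start_fun (v t).
  have b0 : B (t, unit0 R) by exact: val_unit0.
  by rewrite LU ?(glue_r agree) //; right.
have cst : continuous (fun t => path_start_fun (v t)).
  exact: continuous_comp_fun cv (app_continuous (path_start R p)).
exists (transpose (f := idm X) cL L0); split.
- exact: transpose_continuous (cube_is_space n).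
- move=> t tb; apply: path_eq => [|s]; first exact: ustart.
  change (L (t, s) = path_eval (u t) s).
  by rewrite LU ?glue_l //; left.
- by move=> t; apply: path_eq => // s; exact: pL.
Qed.

End PathOfFibration.

Lemma serre_fibrationE (X Y : Top k) (p : mor X Y) :
  serre_fibration R p <-> fills_boxes R (app p).
Proof.
split=> [sp|/fills_boxes_has_path_lifts lift n u v uv].
  apply: has_path_lifts_fills_boxes => n g H cg cH gH.
  have cg' : continuous (fun z : cylinder_bottom R n => g (cylinder_bottom_incl z).1).
    apply: (continuous_comp_fun _ cg).
    exact: continuous_comp_fun (@cylinder_bottom_incl_continuous R n)
      (@fst_continuous _ _).
  have [|L [Lg pL]] := sp n (@mk_mor k (top_cylinder_bottom R k n) X _ cg')
      (@mk_mor k (top_cylinder R k n) Y _ cH).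
    apply: mor_eq => z; rewrite !app_comp !app_mk gH; congr H.
    have z0 : \val (\val z).2 = 0 :> R by exact: (set_valP z).
    by rewrite -(unit_eq0 z0); exact: esym (surjective_pairing (\val z)).
  exists (app L); split; first exact: (app_continuous L).
    move=> d; have zb : @cylinder_bottom_set R n (d, unit0 R) by exact: val_unit0.
    pose z : cylinder_bottom R n := exist _ (d, unit0 R) (mem_set zb).
    exact: (app_eq Lg z).
  exact: (app_eq pL).
pose bot (d : disk R n) : cylinder_bottom R n := exist _ (d, unit0 R)
  (mem_set (val_unit0 R : @cylinder_bottom_set R n (d, unit0 R))).
have cbot : continuous bot.
  by apply: continuous_set_val_inj; exact: pairl_continuous.
have [||d|L [cL L0 pL]] := lift n (app u \o bot) (app v).
- exact: continuous_comp_fun cbot (app_continuous u).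
- exact: (app_continuous v).
- exact: (app_eq uv (bot d)).
exists (@mk_mor k (top_cylinder R k n) X L cL); split; last exact: mor_eq.
apply: mor_eq => z; rewrite app_comp app_mk.
have z0 : \val (\val z).2 = 0 :> R by exact: (set_valP z).
have zE : z = bot (\val z).1.
  apply: val_inj; rewrite -[RHS]/((\val z).1, unit0 R) -(unit_eq0 z0).
  exact: surjective_pairing.
by rewrite [in RHS]zE -[RHS](L0 (\val z).1) -(unit_eq0 z0) -surjective_pairing.
Qed.

Lemma acyclic_liftingE (X Y : Top k) (p : mor X Y) :
  acyclic R (app p) <-> forall n, has_lifting (top_sphere_incl R k n) p.
Proof.
have fills_disk n : fills (app p) (@cube_boundary R n) <->
    fills (app p) (@disk_boundary R n).
  split; apply: fills_homeo.
  - exact: cube_to_disk_continuous.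
  - exact: disk_to_cube_continuous.
  - exact: disk_to_cubeK.
  - by move=> t; rewrite disk_boundaryE cube_to_diskK.
  - exact: disk_boundary_closed.
  - exact: disk_to_cube_continuous.
  - exact: cube_to_disk_continuous.
  - exact: cube_to_diskK.
  - exact: disk_boundaryE.
  - exact: cube_boundary_closed.
have in_boundary n (s : sphere R n) : disk_boundary (sphere_incl s).
  by rewrite /disk_boundary /= sphere_not_open.
split=> [[ne pf] n u v uv|lift].
  have [x0] : inhabited (sval X).
    by apply: ne; exact: inhabits (app v (to_disk 0)).
  pose u' (d : disk R n) : sval X :=
    if pselect (in_open_disk d) is right nd then app u (sphere_of nd) else x0.
  have u'E s : u' (sphere_incl s) = app u s.
    rewrite /u'; case: pselect => [os|ns]; last by rewrite sphere_of_incl.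
    by have := sphere_not_open s; rewrite os.
  have [||d db|h [ch hu ph]] := (fills_disk n).1 (pf n) u' (app v).
  - move=> C cC; rewrite (_ : _ `&` _ = @sphere_incl R n @` (app u @^-1` C)).
      apply: sphere_incl_closed_map.
      by move/continuous_closedP: (app_continuous u); exact.
    apply/seteqP; split=> [d /= [nd]|_ [s /= Cs <-]]; last by rewrite u'E.
    have [od|[s ->]] := disk_cases d; first by case: (nd od).
    by rewrite u'E => Cs; exists s.
  - exact: (app_continuous v).
  - have [od|[s ->]] := disk_cases d; first by case: (db od).
    by rewrite u'E; exact: (app_eq uv s).
  exists (@mk_mor k (top_disk R k n) X h ch); split; last exact: mor_eq.
  apply: mor_eq => s; rewrite app_comp app_mk -u'E.
  exact: hu (in_boundary n s).
have sphere0 (s : sphere R 0) : False.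
  have := set_valP s; rewrite /sphere_set /= /sq_norm big_ord0.
  by move/esym/eqP; rewrite oner_eq0.
split=> [[y]|n]; last first.
  apply/fills_disk => u v ub cv puv.
  have cu : continuous (u \o @sphere_incl R n).
    apply: (continuous_on_comp (@sphere_incl_continuous R n) (A := @disk_boundary R n)) => //.
  have [|h [hu ph]] := lift n (@mk_mor k (top_sphere R k n) X _ cu)
      (@mk_mor k (top_disk R k n) Y v cv).
    by apply: mor_eq => s; exact: puv (in_boundary n s).
  exists (app h); split; [exact: (app_continuous h) | | exact: (app_eq ph)].
  move=> d; have [od []//|[s ->] _] := disk_cases d; exact: (app_eq hu s).
have cu : continuous (fun s : sphere R 0 => False_rect (sval X) (sphere0 s)).
  by move=> s; case: (sphere0 s).
have [|h _] := lift 0%N (@mk_mor k (top_sphere R k 0) X _ cu)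
    (@mk_mor k (top_disk R k 0) Y _ (@cst_continuous (disk R 0) (sval Y) y)).
  by apply: mor_eq => s; case: (sphere0 s).
exact: inhabits (app h (to_disk 0)).
Qed.

End Compression.

(** * Weak homotopy equivalences are the compressible maps *)

Section HomotopyGroupMaps.
Variable R : realType.
Local Notation I := (unit_interval R).

Lemma inj_surj_bijective (S T : Type) (g : S -> T) :
  injective g -> (forall y, exists x, g x = y) -> bijective g.
Proof.
move=> gi gs; exists (fun y => projT1 (cid (gs y))) => [x|y]; case: cid => //=.
by move=> z /gi.
Qed.

Lemma homotopy_map_morph n (X Y : topologicalType) (f : continuousType X Y) (x : X) :
  {morph homotopy_map R n.+1 f x : p q / (p * q)%g}.
Proof.
have mulE (Z : topologicalType) (z : Z) (a b : nloop R n.+1 z) :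
    (homotopy_class a * homotopy_class b)%g = homotopy_class (nloop_concat a b).
  exact: homotopy_mul_class.
have classP (p : homotopy_group R n.+1 x) : exists a, homotopy_class a = p.
  by exists (repr p); exact: reprK.
move=> p q; have [a <-] := classP p; have [b <-] := classP q.
rewrite mulE !homotopy_map_class mulE; apply/homotopy_classP/homotopic_eqfun => t.
change (f (nloop_concat a b t) = nloop_concat (nloop_map f a) (nloop_map f b) t).
by rewrite !nloop_concatE; case: ifP.
Qed.

Lemma homotopy_map_inj n (X Y : topologicalType) (f : continuousType X Y) (x : X) :
  injective (homotopy_map R n f x) <-> forall a b : nloop R n x,
    homotopic (nloop_map f a) (nloop_map f b) -> homotopic a b.
Proof.
have classP (p : homotopy_group R n x) : exists a, homotopy_class a = p.
  by exists (repr p); exact: reprK.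
split=> [fi a b /homotopy_classP fab|fi p q].
  by apply/homotopy_classP/fi; rewrite !homotopy_map_class.
have [a <-] := classP p; have [b <-] := classP q.
by rewrite !homotopy_map_class => /homotopy_classP/fi/homotopy_classP.
Qed.

Lemma homotopy_map_surj n (X Y : topologicalType) (f : continuousType X Y) (x : X) :
  (forall q, exists p, homotopy_map R n f x p = q) <-> forall b : nloop R n (f x),
    exists a : nloop R n x, homotopic (nloop_map f a) b.
Proof.
split=> fs => [b|q].
  by have [p pb] := fs (homotopy_class b); exists (repr p); exact/homotopy_classP.
have [b <-] : exists b, homotopy_class b = q by exists (repr q); exact: reprK.
have [a /homotopy_classP ab] := fs b; exists (homotopy_class a).
by rewrite homotopy_map_class.
Qed.

Definition cube_corner n : cube R n := to_cube (const_mx (-1)).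

(** Maps on the prism that are prescribed on its boundary are the homotopies of
    the definition of homotopy groups. *)
Lemma compress_prism (X Y : topologicalType) (f : X -> Y) n
    (u : cube R n * I -> X) (v : cube R n * I -> Y) :
  compressible R f -> continuous_on (@prism_boundary R n) u -> continuous v ->
  (forall e, prism_boundary e -> f (u e) = v e) ->
  exists h : cube R n * I -> X, continuous h /\
    forall e, prism_boundary e -> h e = u e.
Proof.
move=> [_ fc] ub cv fuv.
have pbE t : @cube_boundary R n.+1 t -> prism_boundary (cube_to_prism t).
  by move=> tb; apply/prism_boundaryE; rewrite cube_to_prismK.
have [||t tb|h [K [ch _ hu _ _]]] := fc n.+1 (u \o @cube_to_prism R n)
    (v \o @cube_to_prism R n).
- apply: (continuous_on_comp_on _ _ pbE ub); first exact: cube_to_prism_continuous.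
  exact: cube_boundary_closed.
- exact: continuous_comp_fun (@cube_to_prism_continuous R n) cv.
- exact/fuv/pbE.
exists (h \o @prism_to_cube R n); split.
  exact: continuous_comp_fun (@prism_to_cube_continuous R n) ch.
by move=> e /prism_boundaryE/hu /= ->; rewrite prism_to_cubeK.
Qed.

Lemma compressible_homotopic n (X Y : topologicalType) (f : continuousType X Y)
    (x : X) (a b : nloop R n x) :
  compressible R f -> homotopic (nloop_map f a) (nloop_map f b) -> homotopic a b.
Proof.
move=> fc [H [cH H0 H1 Hb]].
pose A : set (cube R n * I) := [set e | cube_boundary e.1].
pose B0 : set (cube R n * I) := [set e | \val e.2 = 0 :> R].
pose B1 : set (cube R n * I) := [set e | \val e.2 = 1 :> R].
pose a' (e : cube R n * I) := a e.1; pose b' (e : cube R n * I) := b e.1.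
have neq01 e : B0 e -> B1 e -> False.
  by move=> e0 e1; case: (elimN eqP (oner_neq0 R) (etrans (esym e1) e0)).
have ab e : B0 e -> B1 e -> a' e = b' e by move=> e0 /(neq01 e e0).
have xab e : A e -> (B0 `|` B1) e -> x = glue B0 a' b' e.
  move=> Ae [e0|e1]; first by rewrite glue_l // /a' nloop_boundary.
  by rewrite (glue_r ab) // /b' nloop_boundary.
have pbE : @prism_boundary R n = A `|` (B0 `|` B1).
  by rewrite setUA.
have [||e|h [ch hE]] := @compress_prism X Y f n (glue A (fun=> x) (glue B0 a' b')) H fc.
- rewrite pbE; apply: continuous_on_glue => //.
    apply: continuous_on_closed; last exact: cst_continuous.
    exact: side_closed (@cube_boundary_closed R n).
  apply: continuous_on_glue => //; apply: continuous_on_closed.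
  + exact: bottom_closed.
  + exact: continuous_comp_fun (@fst_continuous _ _) (@cts_fun _ _ a).
  + exact: top_closed.
  + exact: continuous_comp_fun (@fst_continuous _ _) (@cts_fun _ _ b).
- exact: cH.
- rewrite pbE; case: e => t s [tb|[s0|s1]].
  + by rewrite glue_l // Hb.
  + by rewrite (glue_r xab) ?glue_l ?H0 //; left.
  + by rewrite (glue_r xab) ?(glue_r ab) ?H1 //; right.
exists h; split=> //.
- move=> t s s0; rewrite hE; last by rewrite pbE; right; left.
  by rewrite (glue_r xab) ?glue_l //; left.
- move=> t s s1; rewrite hE; last by rewrite pbE; right; right.
  by rewrite (glue_r xab) ?(glue_r ab) //; right.
- by move=> t s tb; rewrite hE ?glue_l // pbE; left.
Qed.

Lemma compressible_surj n (X Y : topologicalType) (f : continuousType X Y)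
    (x : X) (b : nloop R n (f x)) :
  compressible R f -> exists a : nloop R n x, homotopic (nloop_map f a) b.
Proof.
move=> [_ fc]; have [||t tb|h [K [ch cK hx K01 Kb]]] := fc n (fun=> x) b.
- apply: continuous_on_closed; first exact: cube_boundary_closed.
  exact: cst_continuous.
- exact: cts_fun.
- by rewrite nloop_boundary.
exists (@NLoop R n X x (mkcts ch : continuousType _ _) hx), K; split=> //.
- by move=> t s /unit_eq0 ->; rewrite (K01 t).1.
- by move=> t s /unit_eq1 ->; rewrite (K01 t).2.
- by move=> t s tb; rewrite Kb // nloop_boundary.
Qed.

Lemma weq_bijective (X Y : topologicalType) (f : continuousType X Y) :
  weak_homotopy_equivalence R f <->
  (inhabited Y -> inhabited X) /\ forall n x, bijective (homotopy_map R n f x).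
Proof.
split=> [[[nX nY]|[inhX inhY fiso]]|[YX fbij]].
- by split=> // n x; case: nX; exact: inhabits x.
- by split=> // -[|n] x; [exact: (fiso x).1 | exact: ((fiso x).2 n).2].
have [[x0]|nX] := pselect (inhabited X); last by left; split=> // /YX.
right; split; [by []|exact: inhabits (f x0)|] => x; split=> // n.
by split; [exact: homotopy_map_morph | exact: fbij].
Qed.

Lemma compressible_weq (X Y : topologicalType) (f : continuousType X Y) :
  compressible R f -> weak_homotopy_equivalence R f.
Proof.
move=> fc; apply/weq_bijective; split; first exact: fc.1.
move=> n x; apply: inj_surj_bijective.
  by apply/homotopy_map_inj => a b; exact: compressible_homotopic.
by apply/homotopy_map_surj => b; exact: compressible_surj.
Qed.

Definition cube_scale n (p : cube R n * I) : cube R n :=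
  to_cube (\val p.2 *: (centred p.1 + const_mx 1) - const_mx 1).

Lemma cube_scale_continuous n : continuous (@cube_scale n).
Proof.
apply: (continuous_comp_fun _ (@to_cube_continuous R n)); apply: row_cont => i.
apply: (@continuous_eqfun _ _ (fun p : cube R n * I =>
  \val p.2 * (centred p.1 ord0 i + 1) - 1)); first by move=> p; rewrite !mxE.
apply: sub_cont; last exact: cst_cont; apply: mul_cont.
  exact: continuous_comp_fun (@snd_continuous _ _) (@unit_val_continuous R).
apply: add_cont; last exact: cst_cont.
apply: continuous_comp_fun (@coord_continuous _ _ _ _ _).
exact: continuous_comp_fun (@fst_continuous _ _) (@centred_continuous R n).
Qed.

Lemma cube_scale1 n (t : cube R n) : cube_scale (t, unit1 R) = t.
Proof. by rewrite /cube_scale [X in X *: _]val_unit1 scale1r addrK centredK. Qed.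

Lemma cube_scale0 n (t : cube R n) : cube_scale (t, unit0 R) = cube_corner n.
Proof.
rewrite /cube_scale [X in X *: _]val_unit0 scale0r sub0r /cube_corner.
by congr to_cube; apply/rowP => i; rewrite !mxE.
Qed.

Definition nloop_cst n (X : topologicalType) (x : X) : nloop R n x :=
  @NLoop R n X x (cst x : continuousType _ _) (fun _ _ => erefl).

(** The boundary map [u] of the prism is deformed to one that is constant on
    the box, since the box is contractible; what remains of it is a map [a] of
    the top face, and the deformation of [v] is a nullhomotopy of the image of
    [a]. By injectivity on homotopy groups [a] has a nullhomotopy, which is
    deformed back. *)
Lemma extend_prism (X Y : topologicalType) (f : continuousType X Y) n
    (u : cube R n * I -> X) (v : cube R n * I -> Y) :
  (forall x (a b : nloop R n x),
     homotopic (nloop_map f a) (nloop_map f b) -> homotopic a b) ->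
  continuous_on (@prism_boundary R n) u -> continuous v ->
  (forall e, prism_boundary e -> f (u e) = v e) ->
  exists h : cube R n * I -> X, continuous h /\
    forall e, prism_boundary e -> h e = u e.
Proof.
move=> finj ub cv fuv; pose E : topologicalType := (cube R n * I)%type.
have [r [cr rb rid]] := box_retraction R n.
pose A : set E := @box R n; pose B : set E := [set e | \val e.2 = 1 :> R].
have ubox : continuous (fun e => u (r e)).
  apply: (continuous_on_comp cr rb); apply: continuous_on_subset ub.
    exact: box_closed.
  by move=> e eb; left.
pose shrink (q : E * I) : E :=
  (cube_scale (q.1.1, flip q.2), clamp (\val (flip q.2) * \val q.1.2)).
have cshrink : continuous shrink.
  have cflip : continuous (fun q : E * I => flip q.2).
    exact: continuous_comp_fun (@snd_continuous _ _) (@flip_continuous R).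
  apply: pair_continuous.
    apply: (continuous_comp_fun _ (@cube_scale_continuous n)).
    apply: pair_continuous => //.
    exact: continuous_comp_fun (@fst_continuous _ _) (@fst_continuous _ _).
  apply: clamp_cont; apply: mul_cont.
    exact: continuous_comp_fun cflip (@unit_val_continuous R).
  apply: continuous_comp_fun (@unit_val_continuous R).
  exact: continuous_comp_fun (@fst_continuous _ _) (@snd_continuous _ _).
pose c q := u (r (shrink q)); pose x0 := u (r (cube_corner n, unit0 R)).
have cc : continuous c by exact: continuous_comp_fun cshrink ubox.
have c0 e : A e -> c (e, unit0 R) = u e.
  move=> eb; rewrite /c /shrink flip0 cube_scale1 val_unit1 mul1r clamp_val_id.
  by rewrite -surjective_pairing rid.
have c1 e : c (e, unit1 R) = x0.
  by rewrite /c /shrink flip1 cube_scale0 val_unit0 mul0r.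
have side t s : cube_boundary t -> A (t, s) by left.
have utop : continuous (fun t => u (t, unit1 R)).
  apply: (continuous_on_comp (@pairl_continuous _ _ _) _ ub) => t.
  by right; exact: val_unit1.
have [||t tb|M [cM M0 Mb]] := @homotopy_extension R (cube R n) X
    (@cube_boundary R n) (fun q => c ((q.1, unit1 R), q.2))
    (fun t => u (t, unit1 R)) (box_retraction R n) (@cube_boundary_closed R n).
- apply: continuous_on_closed; first exact: side_closed (@cube_boundary_closed R n).
  apply: (continuous_comp_fun _ cc); apply: pair_continuous; last exact: snd_continuous.
  exact: continuous_comp_fun (@fst_continuous _ _) (@pairl_continuous _ _ _).
- exact: utop.
- by rewrite c0 //; exact: side.
have a_bd t : cube_boundary t -> M (t, unit1 R) = x0 by move=> tb; rewrite Mb // c1.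
have ca : continuous (fun t => M (t, unit1 R)).
  exact: continuous_comp_fun (@pairl_continuous _ _ _) cM.
pose a : nloop R n x0 := @NLoop R n X x0 (mkcts ca : continuousType _ _) a_bd.
have AB_bd t s : A (t, s) -> B (t, s) -> cube_boundary t.
  move=> [//|s0] s1.
  by case: (elimN eqP (oner_neq0 R) (etrans (esym s1) s0)).
pose w := glue [set q : E * I | A q.1] c (fun q => M (q.1.1, q.2)).
have cM_agree q : A q.1 -> B q.1 -> c q = M (q.1.1, q.2).
  case: q => -[t s] tau /= eb e1; rewrite Mb; last exact: AB_bd eb e1.
  by rewrite (unit_eq1 e1 : s = unit1 R).
have wb : continuous_on [set q : E * I | prism_boundary q.1] w.
  apply: continuous_on_glue => //; apply: continuous_on_closed => //.
  - exact: side_closed (@box_closed R n).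
  - exact: side_closed (@top_closed R _).
  apply: (continuous_comp_fun _ cM); apply: pair_continuous; last exact: snd_continuous.
  exact: continuous_comp_fun (@fst_continuous _ _) (@fst_continuous _ _).
have w0 e : prism_boundary e -> w (e, unit0 R) = u e.
  case: e => t s [eb|e1]; first by rewrite /w glue_l // c0.
  rewrite /w (glue_r (B := [set q | B q.1]) cM_agree) // M0.
  by rewrite (unit_eq1 e1 : s = unit1 R).
have w1A e : A e -> w (e, unit1 R) = x0 by move=> eb; rewrite /w glue_l // c1.
have w1B t : w ((t, unit1 R), unit1 R) = a t.
  by rewrite /w (glue_r (B := [set q | B q.1]) cM_agree) //; exact: val_unit1.
have [||e eb|V [cV V0 Vb]] := @homotopy_extension R E Y (@prism_boundary R n)
    (fun q => f (w q)) v (prism_cyl_retraction R n) (@prism_boundary_closed R n).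
- exact: continuous_on_post (@cts_fun _ _ f) wb.
- exact: cv.
- by rewrite w0 // fuv.
have [N [cN N0 N1 Nb]] : homotopic (nloop_cst n x0) a.
  apply: finj; exists (fun e => V (e, unit1 R)); split.
  - exact: continuous_comp_fun (@pairl_continuous _ _ _) cV.
  - move=> t s s0; have tb : A (t, s) by right.
    by rewrite Vb ?w1A //; left.
  - move=> t s s1; rewrite (unit_eq1 s1) Vb ?w1B //.
    by right; exact: val_unit1.
  - by move=> t s tb; rewrite Vb ?w1A //; [exact: side | left; exact: side].
have cflip : continuous (fun q : E * I => (q.1, flip q.2)).
  apply: pair_continuous; first exact: fst_continuous.
  exact: continuous_comp_fun (@snd_continuous _ _) (@flip_continuous R).
have [||e eb|G [cG _ Gb]] := @homotopy_extension R E X (@prism_boundary R n)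
    (fun q => w (q.1, flip q.2)) N (prism_cyl_retraction R n)
    (@prism_boundary_closed R n).
- apply: (continuous_on_comp_on cflip _ _ wb) => //.
  exact: side_closed (@prism_boundary_closed R n).
- exact: cN.
- rewrite flip0; case: e eb => t s [eb|e1].
    by rewrite w1A //; case: eb => [tb|s0]; [rewrite Nb | rewrite N0].
  by rewrite (unit_eq1 e1 : s = unit1 R) w1B N1 // val_unit1.
exists (fun e => G (e, unit1 R)); split.
  exact: continuous_comp_fun (@pairl_continuous _ _ _) cG.
by move=> e eb; rewrite Gb //= flip1 w0.
Qed.

(** Once the boundary values extend to a cube [h0], they are deformed along the
    contraction of [h0] to a constant, and [v] becomes a map representing an
    element of a homotopy group, which is in the image of [f]. *)
Lemma weq_compressible k (X Y : Top k) (f : mor X Y) :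
  weak_homotopy_equivalence R (f : continuousType (sval X) (sval Y)) ->
  compressible R (app f).
Proof.
move=> /weq_bijective[YX fbij].
have finj n x : forall a b : nloop R n x,
    homotopic (nloop_map f a) (nloop_map f b) -> homotopic a b.
  by apply/homotopy_map_inj; exact: bij_inj.
have fsurj n x : forall b : nloop R n (app f x),
    exists a : nloop R n x, homotopic (nloop_map f a) b.
  apply/homotopy_map_surj => q; have [g _ gK] := fbij n x.
  by exists (g q).
apply: lifts_compressible => // n u v ub cv fuv.
have [h0 [ch0 h0u]] : exists h0 : cube R n -> sval X,
    continuous h0 /\ forall t, cube_boundary t -> h0 t = u t.
  case: n u v ub cv fuv => [u v _ _ _|n u v ub cv fuv].
    have [x] := YX (inhabits (v (to_cube 0))).
    exists (fun=> x); split; first exact: cst_continuous.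
    by move=> t [[]].
  have [||e /prism_boundaryE eb|h [ch hu]] := @extend_prism _ _ f n
      (u \o @prism_to_cube R n) (v \o @prism_to_cube R n) (finj n).
  - apply: continuous_on_comp_on ub.
    + exact: prism_to_cube_continuous.
    + exact: prism_boundary_closed.
    + by move=> e /prism_boundaryE.
  - exact: continuous_comp_fun (@prism_to_cube_continuous R n) cv.
  - exact: fuv.
  exists (h \o @cube_to_prism R n); split.
    exact: continuous_comp_fun (@cube_to_prism_continuous R n) ch.
  move=> t tb /=; rewrite hu /= ?cube_to_prismK //.
  by apply/prism_boundaryE; rewrite cube_to_prismK.
pose w (e : cube R n * I) := app (path_const R f) (h0 (cube_scale (e.1, flip e.2))).
have cw : continuous w.
  apply: continuous_comp_fun (app_continuous (path_const R f)).
  apply: (continuous_comp_fun _ ch0); apply: (continuous_comp_fun _ (@cube_scale_continuous n)).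
  apply: pair_continuous; first exact: fst_continuous.
  exact: continuous_comp_fun (@snd_continuous _ _) (@flip_continuous R).
have w0 t : w (t, unit0 R) = app (path_const R f) (h0 t).
  by rewrite /w /= flip0 cube_scale1.
pose x0 := h0 (cube_corner n).
have w1 t : w (t, unit1 R) = app (path_const R f) x0.
  by rewrite /w /= flip1 cube_scale0.
have := @fills_transport R _ _ (app (path_end R f)) n w v.
case=> //.
- exact: app_continuous.
- exact/has_path_lifts_fills_boxes/path_end_path_lifts.
- apply: continuous_on_closed => //; exact: side_closed (@cube_boundary_closed R n).
- by move=> t tb; rewrite w0 -fuv // h0u.
- move=> v' cv' wv'.
  have v'b t : cube_boundary t -> v' t = app f x0 by move=> tb; rewrite -wv' // w1.
  pose b : nloop R n (app f x0) :=
    @NLoop R n (sval Y) (app f x0) (mkcts cv' : continuousType _ _) v'b.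
  have [a [K [cK K0 K1 Kb]]] := fsurj n x0 b.
  have Ka t : K (t, unit0 R) = app f (a t) by apply: K0; exact: val_unit0.
  exists (transpose cK Ka); split.
  + apply: transpose_continuous; first exact: (@cts_fun _ _ a).
    exact: cube_is_space.
  + move=> t tb; rewrite w1; apply: path_eq => [|s]; first exact: nloop_boundary.
    exact: Kb.
  + by move=> t; apply: K1; exact: val_unit1.
move=> h [ch hw ph]; exists h; split=> // t tb.
by rewrite hw // w0 h0u.
Qed.

(** The path space deforms to the constant paths by running paths slowly. *)
Lemma path_const_compressible k (X Y : Top k) (f : mor X Y) :
  compressible R (app (path_const R f)).
Proof.
split=> [[z]|n u v ub cv fuv]; first exact: inhabits (app (path_start R f) z).
exists (fun t => path_start_fun (v t)), (fun e => slow (v e.1) e.2); split.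
- exact: continuous_comp_fun cv (app_continuous (path_start R f)).
- apply: slow_continuous; last exact: snd_continuous.
    have [c h] := compact_hausdorff_prod (cube_compact_hausdorff R n)
      (unit_compact_hausdorff R).
    exact: compact_hausdorff_is_space.
  exact: continuous_comp_fun (@fst_continuous _ _) cv.
- by move=> t tb; rewrite -fuv.
- by move=> t; rewrite slow0 slow1.
- by move=> t s tb; rewrite -fuv // slow_const.
Qed.

End HomotopyGroupMaps.

(** * Two out of three *)

Section TwoOfThree.
Variable R : realType.
Local Notation I := (unit_interval R).

Section BoundaryLift.
Variables (E Y : topologicalType) (p : E -> Y).
Hypothesis pac : acyclic R p.

Lemma acyclic_lift n (v : cube R n -> Y) : continuous v ->
  exists L : cube R n -> E, continuous L /\ forall t, p (L t) = v t.
Proof.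
move=> cv; have [e0 pe0] : exists e, p e = v (cube_corner R n).
  have [e] := pac.1 (inhabits (v (cube_corner R n))).
  have [||t [[]]//|h [_ _ ph]] := pac.2 0%N (fun=> e) (fun=> v (cube_corner R n)).
  - apply: continuous_on_closed; first exact: cube_boundary_closed.
    exact: cst_continuous.
  - exact: cst_continuous.
  by exists (h (to_cube 0)).
have lift : path_lift R p (cube R n).
  apply: (path_lift_retract (@cube_to_disk_continuous R n)
    (@disk_to_cube_continuous R n)); first exact: cube_to_diskK.
  exact/fills_boxes_has_path_lifts/acyclic_fills_boxes/pac.
have [||t|L [cL _ pL]] := lift (fun=> e0) (v \o @cube_scale R n).
- exact: cst_continuous.
- exact: continuous_comp_fun (@cube_scale_continuous R n) cv.
- by rewrite /= cube_scale0.
exists (fun t => L (t, unit1 R)); split.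
  exact: continuous_comp_fun (@pairl_continuous _ _ _) cL.
by move=> t; rewrite pL /= cube_scale1.
Qed.

(** The boundary of a prism is a box, over which there is a lift because the
    box is a retract of the prism, together with the top face, over which the
    lift is extended from the boundary of this face. *)
Lemma acyclic_lift_boundary n (u : cube R n -> Y) :
  continuous_on (@cube_boundary R n) u ->
  exists L : cube R n -> E, continuous_on (@cube_boundary R n) L /\
    forall t, cube_boundary t -> p (L t) = u t.
Proof.
case: n u => [u _|n u ub].
  have [e] := pac.1 (inhabits (u (to_cube 0))).
  exists (fun=> e); split; last by move=> t [[]].
  apply: continuous_on_closed; first exact: cube_boundary_closed.
  exact: cst_continuous.
pose w e := u (prism_to_cube e).
have wb : continuous_on (@prism_boundary R n) w.
  apply: continuous_on_comp_on ub.
  - exact: prism_to_cube_continuous.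
  - exact: prism_boundary_closed.
  - by move=> e /prism_boundaryE.
have [r [cr rb rid]] := box_retraction R n.
have cw : continuous (fun e => w (r e)).
  apply: (continuous_on_comp cr rb); apply: continuous_on_subset wb.
    exact: box_closed.
  by move=> e; left.
have [|L [cL pL]] := @acyclic_lift n.+1 (fun t => w (r (cube_to_prism t))).
  exact: continuous_comp_fun (@cube_to_prism_continuous R n) cw.
pose L' e := L (prism_to_cube e).
have cL' : continuous L'.
  exact: continuous_comp_fun (@prism_to_cube_continuous R n) cL.
have pL' e : p (L' e) = w (r e) by rewrite /L' pL prism_to_cubeK.
have [||t tb|m [cm mL pm]] := pac.2 n (fun t => L' (t, unit1 R))
    (fun t => w (t, unit1 R)).
- apply: continuous_on_closed; first exact: cube_boundary_closed.
  exact: continuous_comp_fun (@pairl_continuous _ _ _) cL'.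
- apply: (continuous_on_comp (@pairl_continuous _ _ _) _ wb) => t.
  by right; exact: val_unit1.
- by rewrite pL' rid //; left.
have agree e : @box R n e -> \val e.2 = 1 :> R -> L' e = m e.1.
  case: e => t s [/= tb|/= s0] /= s1; last first.
    by case: (elimN eqP (oner_neq0 R) (etrans (esym s1) s0)).
  by rewrite mL // (unit_eq1 s1 : s = unit1 R).
have pbE t : @cube_boundary R n.+1 t -> prism_boundary (cube_to_prism t).
  by move=> tb; apply/prism_boundaryE; rewrite cube_to_prismK.
exists (fun t => glue (@box R n) L' (fun e => m e.1) (cube_to_prism t)); split.
  apply: (continuous_on_comp_on _ _ pbE).
  - exact: cube_to_prism_continuous.
  - exact: cube_boundary_closed.
  apply: (continuous_on_glue agree).
    apply: continuous_on_closed; last exact: cL'.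
    exact: box_closed.
  apply: continuous_on_closed; first exact: top_closed.
  exact: continuous_comp_fun (@fst_continuous _ _) cm.
move=> t /pbE; rewrite -[in RHS](cube_to_prismK t) -/(w _).
case: (cube_to_prism t) => {}t s [eb|/= s1]; first by rewrite glue_l // pL' rid.
by rewrite (glue_r agree) // pm (unit_eq1 s1 : s = unit1 R).
Qed.

End BoundaryLift.

Variable k : space_kind.

(** The boundary values in [Y] are joined by paths to boundary values that come
    from [X]; after transport along these paths, [g ∘ f] compresses the cube. *)
Lemma compressible_cancel (X Y Z : Top k) (f : mor X Y) (g : mor Y Z) :
  compressible R (app f) -> compressible R (app (g ∘ f)) -> compressible R (app g).
Proof.
move=> fc gfc; apply: lifts_compressible => [/gfc.1[x]|n u v ub cv guv].
  exact: inhabits (app f x).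
have [z [zb zu]] := acyclic_lift_boundary ((path_end_acyclic R f).2 fc) ub.
pose w (e : cube R n * I) : path_space R g :=
  app (path_const R g) (path_eval (z e.1) (flip e.2)).
have wb : continuous_on [set e : cube R n * I | cube_boundary e.1] w.
  apply: (continuous_on_post (app_continuous (path_const R g))).
  have ch := cube_compact_hausdorff R n.
  apply: continuous_on_cylinder => //.
  - exact: unit_compact_hausdorff.
  - exact: cube_boundary_closed.
  apply: (path_eval_cont (z := fun q : (@cube_boundary R n * I)%type => z (\val q.1))).
    exact: continuous_comp_fun (@fst_continuous _ _) (continuous_on_val zb).
  exact: continuous_comp_fun (@snd_continuous _ _) (@flip_continuous R).
have w0 t : cube_boundary t -> w (t, unit0 R) = app (path_const R g) (u t).
  by move=> tb; rewrite /w /= flip0 -zu.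
have w1 t : w (t, unit1 R) =
    app (path_const R g) (app f (path_start_fun (z t))).
  by rewrite /w /= flip1 path_eval0.
have := @fills_transport R _ _ (app (path_end R g)) n w v.
case=> //.
- exact: app_continuous.
- exact/has_path_lifts_fills_boxes/path_end_path_lifts.
- by move=> t tb; rewrite w0 // -guv.
- move=> v' cv' wv'.
  have [||t tb|h [K [ch cK hu K01 Kb]]] := gfc.2 n (fun t => path_start_fun (z t)) v'.
  + exact: continuous_on_post (app_continuous (path_start R f)) zb.
  + by [].
  + by rewrite -(wv' t tb) w1 app_comp.
  have Kh t : K (t, unit0 R) = app g (app f (h t)) by rewrite (K01 t).1 app_comp.
  exists (transpose cK Kh); split.
  + apply: transpose_continuous; last exact: cube_is_space.
    exact: continuous_comp_fun ch (app_continuous f).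
  + move=> t tb; rewrite w1; apply: path_eq => [|s].
      by change (app f (h t) = app f (path_start_fun (z t))); rewrite hu.
    change (K (t, s) = app g (app f (path_start_fun (z t)))).
    by rewrite Kb // -(wv' t tb) w1.
  + by move=> t; exact: (K01 t).2.
- by move=> h [ch hw ph]; exists h; split=> // t tb; rewrite hw // w0.
Qed.

Lemma compressible_retract (A B D E : Top k) (f : mor A B) (g : mor D E) :
  retract_of f g -> compressible R (app g) -> compressible R (app f).
Proof.
move=> [s [r [t [q [rs qt ts qg]]]]] [ne gc]; split=> [[b]|n u v ub cv fuv].
  by have [d] := ne (inhabits (app t b)); exact: inhabits (app r d).
have [||x xb|h [K [ch cK hu K01 Kb]]] := gc n (app s \o u) (app t \o v).
- exact: continuous_on_post (app_continuous s) ub.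
- exact: continuous_comp_fun cv (app_continuous t).
- by rewrite /= -fuv //; exact: esym (app_eq ts (u x)).
have rsE x : app r (app s x) = x by rewrite -app_comp rs app_id.
have qtE x : app q (app t x) = x by rewrite -app_comp qt app_id.
exists (app r \o h), (app q \o K); split.
- exact: continuous_comp_fun ch (app_continuous r).
- exact: continuous_comp_fun cK (app_continuous q).
- by move=> x xb; rewrite /= hu //= rsE.
- move=> x; rewrite /= (K01 x).1 (K01 x).2 /= qtE; split=> //.
  by rewrite -!app_comp qg.
- by move=> x x' xb; rewrite /= Kb //= qtE.
Qed.

Lemma homotopy_map_comp n (X Y Z : topologicalType) (f : continuousType X Y)
    (g : continuousType Y Z) (x : X) (p : homotopy_group R n x) :
  homotopy_map R n (g \o f : continuousType X Z) x p =
  homotopy_map R n g (f x) (homotopy_map R n f x p).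
Proof.
have [a <-] : exists a, homotopy_class a = p by exists (repr p); exact: reprK.
rewrite !homotopy_map_class; apply/homotopy_classP.
have [H [cH H0 H1 Hb]] :=
  homotopic_refl (nloop_map (g \o f : continuousType X Z) a).
by exists H.
Qed.

(** In the second case the homotopy groups of [Y] are only known at the base
    points that come from [X], which do not suffice for [g] to be a weak
    equivalence; compressions are used there instead. *)
Lemma weq_two_of_three (X Y Z : Top k) (f : mor X Y) (g : mor Y Z) :
  [/\ weak_homotopy_equivalence R f -> weak_homotopy_equivalence R g ->
        weak_homotopy_equivalence R (g ∘ f : continuousType _ _),
      weak_homotopy_equivalence R f ->
        weak_homotopy_equivalence R (g ∘ f : continuousType _ _) ->
        weak_homotopy_equivalence R g &
      weak_homotopy_equivalence R g ->
        weak_homotopy_equivalence R (g ∘ f : continuousType _ _) ->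
        weak_homotopy_equivalence R f].
Proof.
split.
- move=> /weq_bijective[YX fb] /weq_bijective[ZY gb]; apply/weq_bijective.
  split=> [/ZY/YX //|n x]; apply: (eq_bij (bij_comp (gb n (app f x)) (fb n x))) => a.
  exact: esym (homotopy_map_comp f g a).
- move=> /weq_compressible fc /weq_compressible gfc.
  exact/compressible_weq/(compressible_cancel fc gfc).
- move=> /weq_bijective[ZY gb] /weq_bijective[ZX gfb]; apply/weq_bijective.
  split=> [[y]|n x]; first exact: ZX (inhabits (app g y)).
  have gc := gb n (app f x); have gfE := homotopy_map_comp f g (n := n) (x := x).
  have [g' gK g'K] := gc; have [h hK h'K] := gfb n x.
  exists (fun b => h (homotopy_map R n g (app f x) b)) => [a|b].
    by rewrite -gfE hK.
  by apply: (can_inj gK); rewrite -gfE h'K.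
Qed.

End TwoOfThree.

(** * The model structure *)

Section ModelStructure.
Variables (R : realType) (k : space_kind).
Local Notation I := (unit_interval R).
Local Notation Spaces := (Top k).

Definition cofibration : map_class Spaces := fun X Y f =>
  relative_cell_complex R f \/
  (exists (A B : Spaces) (j : mor A B), relative_cell_complex R j /\ retract_of f j).

Definition equivalence : map_class Spaces := fun X Y f =>
  weak_homotopy_equivalence R f.

Lemma compressibleE (X Y : Spaces) (f : mor X Y) :
  equivalence f <-> compressible R (app f).
Proof. by split; [exact: weq_compressible | exact: compressible_weq]. Qed.

Lemma acyclicE (X Y : Spaces) (p : mor X Y) :
  acyclic R (app p) <-> serre_fibration R p /\ equivalence p.
Proof.
split=> [pa|[/serre_fibrationE pb /compressibleE pc]].
  split; first exact/serre_fibrationE/acyclic_fills_boxes.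
  exact/compressibleE/acyclic_compressible.
exact: fibration_compressible.
Qed.

Lemma equivalence_retract : retract_closed equivalence.
Proof.
move=> A B D E f g fg /compressibleE gc.
exact/compressibleE/(compressible_retract fg gc).
Qed.

Lemma fibration_retract : retract_closed (@serre_fibration R k).
Proof. by move=> A B D E f g fg gfib n; exact: lifting_retractr fg (gfib n). Qed.

Lemma cofibration_retract : retract_closed cofibration.
Proof.
move=> A B D E f g fg [gc|[A' [B' [j [jc gj]]]]]; right.
  by exists D, E, g.
by exists A', B', j; split=> //; exact: retract_trans fg gj.
Qed.

(** Lifting against sphere inclusions passes to pushouts, transfinite composites
    and retracts. *)
Lemma cofibration_lifting (A B X Y : Spaces) (i : mor A B) (p : mor X Y) :
  cofibration i -> acyclic R (app p) -> has_lifting i p.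
Proof.
move=> ci /acyclic_liftingE pa.
have cell_lifting D E (j : mor D E) : relative_cell_complex R j -> has_lifting j p.
  apply: lifting_transfinite => {}D {}E {}j [n [phi [chi po]]].
  exact: lifting_pushout po (pa n).
case: ci => [/cell_lifting //|[D [E [j [/cell_lifting jp ij]]]]].
exact: lifting_retract ij jp.
Qed.

(** As [i] is a weak equivalence, [path_end i] is acyclic, and lifting [i]
    against it gives [rho : B -> path_ob i]: this is a retraction
    [r = path_start i ∘ rho] of [i] together with a homotopy from [i ∘ r] to the
    identity that is constant on [A]. Now [u ∘ r] is a lift of [v ∘ i ∘ r], and
    [v] applied to the homotopy leads from there to [v]. These data form a map
    from [B] to the path space of [p]; it lifts against the acyclic fibration
    [path_push p] to a homotopy in [X], the end of which is the required map. *)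
Lemma trivial_cofibration_lifting (A B X Y : Spaces) (i : mor A B) (p : mor X Y) :
  cofibration i -> equivalence i -> serre_fibration R p -> has_lifting i p.
Proof.
move=> ci /compressibleE wi /serre_fibrationE fp u v uv.
have [|rho [rho_i rho_end]] := cofibration_lifting ci
    ((path_end_acyclic R i).2 wi) (u := path_const R i) (v := idm B).
  by rewrite path_const_end mcomp_idl.
pose rhof : sval B -> path_space R i := app rho.
have ca : continuous (fun b => app u (path_start_fun (rhof b))).
  apply: (continuous_comp_fun _ (app_continuous u)).
  exact: continuous_comp_fun (app_continuous rho) (app_continuous (path_start R i)).
have cH : continuous (fun q : (sval B * I)%type => app v (path_eval (rhof q.1) q.2)).
  apply: (continuous_comp_fun _ (app_continuous v)).
  apply: path_eval_cont; last exact: snd_continuous.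
  exact: continuous_comp_fun (@fst_continuous _ _) (app_continuous rho).
have aH b : app v (path_eval (rhof b) (unit0 R)) =
    app p (app u (path_start_fun (rhof b))).
  by rewrite path_eval0; exact: esym (app_eq uv _).
pose V := @mk_mor k B (path_ob R p) (transpose cH aH)
  (transpose_continuous ca (svalP B)).
have rhoE x : rhof (app i x) = app (path_const R i) x := app_eq rho_i x.
have [|L [Li pL]] := cofibration_lifting ci (path_push_acyclic fp)
    (u := path_const R (idm X) ∘ u) (v := V).
  apply: mor_eq => x; rewrite !app_comp; apply: path_eq => [|s].
    by change (app u x = app u (path_start_fun (rhof (app i x)))); rewrite rhoE.
  change (app p (app u x) = app v (path_eval (rhof (app i x)) s)).
  by rewrite rhoE path_const_eval; exact: (app_eq uv x).
exists (path_end R (idm X) ∘ L); split.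
  by rewrite -mcomp_assoc Li mcomp_assoc path_const_end mcomp_idl.
rewrite mcomp_assoc -(path_map_end R (path_square p)) -mcomp_assoc.
rewrite -[path_map _ _]/(path_push R p) pL; apply: mor_eq => b.
by have := congr1 (app v) (app_eq rho_end b).
Qed.

Lemma cell_left_cofibration (X Y : Spaces) (f : mor X Y) :
  cofibration (cell_left R f).
Proof. by right; exact: cell_left_retract. Qed.

Lemma cell_right_acyclic (X Y : Spaces) (f : mor X Y) :
  acyclic R (app (cell_right R f)).
Proof. by apply/acyclic_liftingE => n; exact: cell_right_fills. Qed.

Lemma path_end_fibration (X Y : Spaces) (f : mor X Y) :
  serre_fibration R (path_end R f).
Proof.
exact/serre_fibrationE/has_path_lifts_fills_boxes/path_end_path_lifts.
Qed.

(** A map is the inclusion of constant paths, which is a weak equivalence,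
    followed by the end point map, which is a fibration; the factorization into
    a cell complex and an acyclic fibration, applied to the former, makes it a
    cofibration. *)
Section PathFactorization.

Definition path_mid (X Y : Spaces) (f : mor X Y) : Spaces :=
  cell_mid R (path_const R f).

Definition path_left (X Y : Spaces) (f : mor X Y) : mor X (path_mid f) :=
  cell_left R (path_const R f).

Definition path_right (X Y : Spaces) (f : mor X Y) : mor (path_mid f) Y :=
  path_end R f ∘ cell_right R (path_const R f).

Lemma path_factorE (X Y : Spaces) (f : mor X Y) : path_right f ∘ path_left f = f.
Proof. by rewrite -mcomp_assoc cell_factorE path_const_end. Qed.

Section MidMap.
Variables (X Y X' Y' : Spaces) (f : mor X Y) (f' : mor X' Y').
Variables (a : mor X X') (b : mor Y Y') (e : b ∘ f = f' ∘ a).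

Definition path_mid_map : mor (path_mid f) (path_mid f') :=
  cell_mid_map R (path_map_const R e).

Lemma path_mid_map_left : path_mid_map ∘ path_left f = path_left f' ∘ a.
Proof. exact: cell_mid_map_left. Qed.

Lemma path_mid_map_right : path_right f' ∘ path_mid_map = b ∘ path_right f.
Proof.
by rewrite -mcomp_assoc cell_mid_map_right !mcomp_assoc path_map_end.
Qed.

End MidMap.

Lemma path_mid_map_id (X Y : Spaces) (f : mor X Y) (e : idm Y ∘ f = f ∘ idm X) :
  path_mid_map e = idm (path_mid f).
Proof.
have pid : path_map R e = idm (path_ob R f).
  by apply: mor_eq => z; rewrite app_id; apply: path_eq => // s; rewrite path_map_eval app_id.
rewrite /path_mid_map; move: (path_map_const R e); rewrite pid => e'.
exact: cell_mid_map_id.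
Qed.

Lemma path_mid_map_comp (X Y X' Y' X'' Y'' : Spaces)
    (f : mor X Y) (f' : mor X' Y') (f'' : mor X'' Y'')
    (a : mor X X') (b : mor Y Y') (a' : mor X' X'') (b' : mor Y' Y'')
    (e : b ∘ f = f' ∘ a) (e' : b' ∘ f' = f'' ∘ a')
    (e'' : (b' ∘ b) ∘ f = f'' ∘ (a' ∘ a)) :
  path_mid_map e'' = path_mid_map e' ∘ path_mid_map e.
Proof.
have pcomp : path_map R e'' = path_map R e' ∘ path_map R e.
  by apply: mor_eq => z; rewrite app_comp; apply: path_eq.
rewrite /path_mid_map; move: (path_map_const R e''); rewrite pcomp => E.
exact: cell_mid_map_comp.
Qed.

Definition path_factorization : functorial_factorization Spaces :=
  FunctorialFactorization path_factorE path_mid_map_left path_mid_map_right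
    path_mid_map_id path_mid_map_comp.

Lemma path_left_equivalence (X Y : Spaces) (f : mor X Y) :
  equivalence (path_left f).
Proof.
have [_ _ cancel] := @weq_two_of_three R k _ _ _ (path_left f) (cell_right R (path_const R f)).
apply: cancel; first exact/compressibleE/acyclic_compressible/cell_right_acyclic.
rewrite [_ ∘ _](cell_factorE R (path_const R f)).
exact/compressibleE/path_const_compressible.
Qed.

Lemma path_right_fibration (X Y : Spaces) (f : mor X Y) :
  serre_fibration R (path_right f).
Proof.
move=> n u v uv.
have [|h [hu hv]] := @path_end_fibration _ _ f n (cell_right R (path_const R f) ∘ u) v.
  by rewrite mcomp_assoc.
have [sc _] := (acyclicE _).1 (cell_right_acyclic (path_const R f)).
have [|g [gu gh]] := sc n u h; first by rewrite hu.
by exists g; split=> //; rewrite -mcomp_assoc gh.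
Qed.

End PathFactorization.

Lemma trivial_fibration_factorization :
  exists F : functorial_factorization Spaces, forall (X Y : Spaces) (g : mor X Y),
    [/\ cofibration (left_part F g), serre_fibration R (right_part F g) &
        equivalence (right_part F g)].
Proof.
exists (cell_factorization R k) => X Y g.
have [fg wg] := (acyclicE _).1 (cell_right_acyclic g).
by split=> //; exact: cell_left_cofibration.
Qed.

Lemma trivial_cofibration_factorization :
  exists F : functorial_factorization Spaces, forall (X Y : Spaces) (g : mor X Y),
    [/\ cofibration (left_part F g), equivalence (left_part F g) &
        serre_fibration R (right_part F g)].
Proof.
exists path_factorization => X Y g; split.
- exact: cell_left_cofibration.
- exact: path_left_equivalence.
- exact: path_right_fibration.
Qed.

Definition space_model_structure : model_structure Spaces :=
  @ModelStructure Spaces equivalence cofibration (@serre_fibration R k)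
    (@top_limits k) (@top_colimits k) (@weq_two_of_three R k)
    equivalence_retract fibration_retract cofibration_retract
    (fun A B X Y i p ci fp wp =>
       cofibration_lifting ci ((acyclicE p).2 (conj fp wp)))
    trivial_cofibration_lifting
    trivial_fibration_factorization trivial_cofibration_factorization.

End ModelStructure.

Theorem theorem2p5 (R : realType) (k : space_kind) :
  exists M : model_structure (Top k),
    forall (X Y : Top k) (f : mor X Y),
      [/\ weq M f <-> weak_homotopy_equivalence R f,
          cof M f <->
            relative_cell_complex R f \/
            (exists (A B : Top k) (j : mor A B),
               relative_cell_complex R j /\ retract_of f j) &
          fib M f <-> serre_fibration R f].
Proof. by exists (space_model_structure R k). Qed.
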